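(* For every fixed $\delta\in(0,1)$ there is a constant $C>0$ (depending only on $\delta$) such that the following holds. Let $\epsilon\in(0,1)$ and let $m,n,c,r$ be positive integers. One can choose positive integers $t\le C(c/\epsilon+c^2)$, $s_c\le C\,c/\epsilon$, $t'\le C(r/\epsilon+r^2)$, $s_r\le C\,r/\epsilon$, depending only on $c,r,\epsilon,\delta$, such that for all $A\in\mathbb{R}^{m\times n}$, $M\in\mathbb{R}^{m\times c}$, $N\in\mathbb{R}^{r\times n}$ the following is true. Let $\Pi_M$ be a $t\times m$ sparse embedding matrix, $G_M$ an $s_c\times t$ matrix of i.i.d. normal random variables with mean $0$ and variance $1/s_c$, $\Pi_N$ a $t'\times n$ sparse embedding matrix, and $G_N$ an $s_r\times t'$ matrix of i.i.d. normal random variables with mean $0$ and variance $1/s_r$, all four independent, and put $S_M=G_M\Pi_M$, $S_N=G_N\Pi_N$. Let $X^*=M^\dagger A N^\dagger$, a minimizer of $\|A-MXN\|_F$ over $X\in\mathbb{R}^{c\times r}$, and $\hat X=(S_M M)^\dagger S_M A S_N^T (N S_N^T)^\dagger$. Then with probability at least $1-\delta$, $$\|A-M\hat X N\|_F\le(1+\epsilon)\,\|A-MX^*N\|_F,$$ and $\hat X$ can be constructed with computational complexity $$O\Big(\mathrm{nnz}(A)+mc+nr+\tfrac{c^2r}{\epsilon^3}+\tfrac{cr^2}{\epsilon^3}+\tfrac{c^2r^2}{\epsilon^2}+\tfrac{c^3r}{\epsilon^2}+\tfrac{cr^3}{\epsilon^2}+\min\big(\tfrac{c^2r^3}{\epsilon},\tfrac{c^3r^2}{\epsilon}\big)+\tfrac{c^4}{\epsilon}+\tfrac{r^4}{\epsilon}\Big),$$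 where the implied constant depends only on $\delta$.
   Context: $\|\cdot\|_F$ is the Frobenius norm, $Y^\dagger$ is the Moore-Penrose pseudoinverse of $Y$, and $\mathrm{nnz}(Y)$ is the number of nonzero entries of $Y$. Computational complexity counts arithmetic operations (including drawing a random variable at unit cost). A $t\times m$ sparse embedding matrix is a random matrix each of whose columns has exactly one nonzero entry, located in a row chosen uniformly at random from $\{1,\dots,t\}$ and equal to $+1$ or $-1$ with probability $1/2$ each, with all these choices independent across columns (the standard CountSketch matrix). *)

(* Defs.v *)
From HB Require Import structures.
From mathcomp Require Import all_boot all_order all_algebra.
From mathcomp Require Import all_classical all_reals all_analysis.

Set Implicit Arguments.
Unset Strict Implicit.
Unset Printing Implicit Defensive.

Import Order.TTheory GRing.Theory Num.Theory.
Import numFieldNormedType.Exports.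

Local Open Scope classical_set_scope.
Local Open Scope ring_scope.

Definition frobenius (R : realType) (m n : nat) (A : 'M[R]_(m, n)) : R :=
  Num.sqrt (\sum_(i < m) \sum_(j < n) A i j ^+ 2).

Record penrose (R : realType) (m n : nat)
    (Y : 'M[R]_(m, n)) (Z : 'M[R]_(n, m)) : Prop := Penrose {
  penrose_in : Y *m Z *m Y = Y ;
  penrose_out : Z *m Y *m Z = Z ;
  penrose_syml : (Y *m Z)^T = Y *m Z ;
  penrose_symr : (Z *m Y)^T = Z *m Y }.

(* [xget]'s default 0 is never used: see [mpinvP] and [mpinv_unique].        *)
Definition mpinv (R : realType) (m n : nat) (Y : 'M[R]_(m, n)) : 'M[R]_(n, m) :=
  xget 0 [set Z | penrose Y Z].

Lemma gram_unit (R : realType) (m k : nat) (C : 'M[R]_(m, k)) :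
  \rank C = k -> C^T *m C \in unitmx.
Proof.
move=> rC; rewrite -row_free_unit -kermx_eq0; apply/rowV0P => v /sub_kermxP.
set w := v *m C^T => vC0.
have ww : w *m w^T = 0.
  by rewrite {2}/w trmx_mul trmxK mulmxA -(mulmxA v) vC0 mul0mx.
have w0 : w = 0.
  apply/rowP => j; rewrite [RHS]mxE; apply/eqP; rewrite -sqrf_eq0.
  have /eqP : \sum_(i < m) w 0 i ^+ 2 = 0.
    have /= := congr1 (fun u : 'M[R]_1 => u 0 0) ww.
    rewrite mxE [RHS]mxE => {2}<-.
    by apply: eq_bigr => i _; rewrite [w^T _ _]mxE expr2.
  rewrite psumr_eq0 => [/allP h|i _]; last exact: sqr_ge0.
  by apply: h; rewrite mem_index_enum.
have fC : row_free C^T by rewrite /row_free mxrank_tr rC.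
by apply: (row_free_inj fC); rewrite -/w w0 mul0mx.
Qed.

Lemma mpinvP (R : realType) (m n : nat) (Y : 'M[R]_(m, n)) : penrose Y (mpinv Y).
Proof.
suff [Z] : exists Z, penrose Y Z by exact: xgetI.
have [k [C [B [eY uC uB]]]] : exists k (C : 'M[R]_(m, k)) (B : 'M[R]_(k, n)),
    [/\ Y = C *m B, C^T *m C \in unitmx & B *m B^T \in unitmx].
  exists (\rank Y), (col_base Y), (row_base Y); split.
  - by rewrite mulmx_base.
  - by apply: gram_unit; apply/eqP; exact: (col_base_full Y).
  - rewrite -{1}(trmxK (row_base Y)); apply: gram_unit.
    by rewrite mxrank_tr; apply/eqP; exact: (row_base_free Y).
pose P := invmx (C^T *m C); pose Q := invmx (B *m B^T).
have Pt : P^T = P by rewrite /P trmx_inv trmx_mul trmxK.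
have Qt : Q^T = Q by rewrite /Q trmx_inv trmx_mul trmxK.
pose Z := B^T *m Q *m P *m C^T.
have YZ : Y *m Z = C *m P *m C^T.
  by rewrite eY /Z !mulmxA -(mulmxA C B) -(mulmxA C _ Q) mulmxV // mulmx1.
have ZY : Z *m Y = B^T *m Q *m B.
  by rewrite eY /Z !mulmxA -(mulmxA _ C^T C) -(mulmxA _ P) mulVmx // mulmx1.
exists Z; split.
- by rewrite YZ eY !mulmxA -(mulmxA _ C^T C) -(mulmxA _ P) mulVmx // mulmx1.
- by rewrite ZY /Z !mulmxA -(mulmxA _ B B^T) -(mulmxA _ Q (B *m _)) mulVmx // mulmx1.
- by rewrite YZ !trmx_mul trmxK Pt mulmxA.
- by rewrite ZY !trmx_mul trmxK Qt mulmxA.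
Qed.

Lemma mpinv_unique (R : realType) (m n : nat) (Y : 'M[R]_(m, n))
  (Z : 'M[R]_(n, m)) : penrose Y Z -> Z = mpinv Y.
Proof.
suff uniq (Z1 Z2 : 'M[R]_(n, m)) : penrose Y Z1 -> penrose Y Z2 -> Z1 = Z2.
  by move=> h; apply: uniq h (mpinvP Y).
move=> [a1 b1 c1 d1] [a2 b2 c2 d2].
have YZ : Y *m Z1 = Y *m Z2.
  by rewrite -[LHS]c1 -[in LHS]a2 -mulmxA trmx_mul c1 c2 mulmxA a1.
have ZY : Z1 *m Y = Z2 *m Y.
  rewrite -[LHS]d1 -[in LHS]a2 mulmxA mulmxA -(mulmxA (Z1 *m Y)) trmx_mul d1 d2.
  by rewrite -mulmxA (mulmxA Y) a1.
by rewrite -b1 -mulmxA YZ mulmxA ZY b2.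
Qed.

(* One outcome of the random choices behind S = G *m Pi: the row and the     *)
(* sign of the nonzero entry of each column of Pi, and the matrix G.         *)
Record sketch (R : realType) (s t m : nat) := Sketch {
  sk_row : 'I_m -> 'I_t ;
  sk_neg : 'I_m -> bool ;
  sk_normal : 'M[R]_(s, t) }.

Definition embedding_mx (R : realType) (s t m : nat) (D : sketch R s t m) :
    'M[R]_(t, m) :=
  \matrix_(i < t, j < m) if i == sk_row D j then (-1) ^+ sk_neg D j else 0.

Definition sketch_mx (R : realType) (s t m : nat) (D : sketch R s t m) :
    'M[R]_(s, m) :=
  sk_normal D *m embedding_mx D.

Definition Xhat (R : realType) (m n c r sc sr : nat) (A : 'M[R]_(m, n))
    (M : 'M[R]_(m, c)) (N : 'M[R]_(r, n))
    (SM : 'M[R]_(sc, m)) (SN : 'M[R]_(sr, n)) : 'M[R]_(c, r) :=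
  mpinv (SM *m M) *m SM *m A *m SN^T *m mpinv (N *m SN^T).

Definition mutually_independent (R : realType) (d : measure_display)
    (T : measurableType d) (P : probability T R) (I : finType)
    (F : I -> set_system T) : Prop :=
  forall (J : {set I}) (E : I -> set T), (forall i, i \in J -> F i (E i)) ->
    P (\bigcap_(i in [set` J]) E i) = (\prod_(i in J) P (E i))%E.

(* Rows, signs, entries of G.                                                *)
Definition choice_index (s t m : nat) : finType :=
  ('I_m + 'I_m + 'I_s * 'I_t)%type.

Definition choice_events (R : realType) (T : Type) (s t m : nat)
    (D : T -> sketch R s t m) (x : choice_index s t m) : set_system T :=
  match x with
  | inl (inl j) => preimage_set_system setT (fun w => sk_row (D w) j) setT
  | inl (inr j) => preimage_set_system setT (fun w => sk_neg (D w) j) setT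
  | inr p => preimage_set_system setT (fun w => sk_normal (D w) p.1 p.2)
               measurable
  end.

(* The second argument of [normal_prob] is the standard deviation.           *)
Record sketch_laws (R : realType) (d : measure_display) (T : measurableType d)
    (P : probability T R) (s t m : nat) (D : T -> sketch R s t m) : Prop :=
  SketchLaws {
  choice_measurable : forall x : choice_index s t m,
    choice_events D x `<=` measurable ;
  row_uniform : forall (j : 'I_m) (i : 'I_t),
    P [set w | sk_row (D w) j = i] = (t%:R^-1)%:E ;
  sign_uniform : forall (j : 'I_m) (b : bool),
    P [set w | sk_neg (D w) j = b] = (2^-1)%:E ;
  entry_normal : forall (i : 'I_s) (k : 'I_t) (B : set R), measurable B ->
    P [set w | B (sk_normal (D w) i k)]
      = normal_prob 0 (Num.sqrt s%:R^-1) B }.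

Definition independent_sketches (R : realType) (d : measure_display)
    (T : measurableType d) (P : probability T R) (s t m s' t' n : nat)
    (D : T -> sketch R s t m) (D' : T -> sketch R s' t' n) : Prop :=
  [/\ sketch_laws P D, sketch_laws P D' &
      mutually_independent P
        (fun x : choice_index s t m + choice_index s' t' n =>
           match x with
           | inl y => choice_events D y
           | inr y => choice_events D' y
           end)].

(* Algebraic computation trees. Real numbers live in write-once registers,   *)
(* numbered 0, 1, ... in order of creation (reading a nonexistent register   *)
(* gives 0). Every instruction except [Output] costs one, reads and random   *)
(* draws included; addressing is free. Real data are accessible only         *)
(* through arithmetic, comparison and copying to the output. Index data      *)
(* ([Inspect]: positions of nonzero entries, random row numbers) steer the   *)
(* control flow directly. [run] returns the output and the cost.             *)
Inductive arith := Add | Sub | Mul | Div.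

Definition arith_eval (R : realType) (o : arith) (x y : R) : R :=
  match o with
  | Add => x + y
  | Sub => x - y
  | Mul => x * y
  | Div => x / y
  end.

Inductive tree (Q D : Type) (answer : D -> Type) (c r : nat) : Type :=
| Output (o : 'M[nat]_(c, r))
| Const (z : int) (k : tree Q answer c r)
| Arith (o : arith) (i j : nat) (k : tree Q answer c r)
| IfLe (i j : nat) (k1 k2 : tree Q answer c r)
| Fetch (q : Q) (k : tree Q answer c r)
| Inspect (q : D) (k : answer q -> tree Q answer c r).

Definition tick (T : Type) (x : T * nat) : T * nat := (x.1, x.2.+1).

Fixpoint run (R : realType) (Q D : Type) (answer : D -> Type) (c r : nat)
    (fetch : Q -> R) (inspect : forall q : D, answer q)
    (p : tree Q answer c r) (regs : seq R) : 'M[R]_(c, r) * nat :=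
  match p with
  | Output o => (map_mx (nth 0 regs) o, 0%N)
  | Const z k => tick (run fetch inspect k (rcons regs z%:~R))
  | Arith o i j k =>
      tick (run fetch inspect k
              (rcons regs (arith_eval o (nth 0 regs i) (nth 0 regs j))))
  | IfLe i j k1 k2 =>
      tick (if nth 0 regs i <= nth 0 regs j then run fetch inspect k1 regs
            else run fetch inspect k2 regs)
  | Fetch q k => tick (run fetch inspect k (rcons regs (fetch q)))
  | Inspect q k => tick (run fetch inspect (k (inspect q)) regs)
  end.

(* A is given as a list of its nonzero entries, in any order; M and N are    *)
(* given entrywise.  A random variable is drawn by asking for it; asking     *)
(* again returns the same value.                                             *)
Inductive real_query (m n c r s t s' t' : nat) :=
| ValueA (k : nat)
| EntryM (i : 'I_m) (j : 'I_c)
| EntryN (i : 'I_r) (j : 'I_n)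
| DrawSignM (j : 'I_m)
| DrawSignN (j : 'I_n)
| DrawNormalM (i : 'I_s) (k : 'I_t)
| DrawNormalN (i : 'I_s') (k : 'I_t').

Inductive index_query (m n : nat) :=
| PositionA (k : nat)
| DrawRowM (j : 'I_m)
| DrawRowN (j : 'I_n).

Definition index_answer (m n t t' : nat) (q : index_query m n) : Type :=
  match q with
  | PositionA _ => option ('I_m * 'I_n)
  | DrawRowM _ => 'I_t
  | DrawRowN _ => 'I_t'
  end.

Definition algorithm (m n c r s t s' t' : nat) : Type :=
  tree (real_query m n c r s t s' t') (@index_answer m n t t') c r.

Definition fetch_input (R : realType) (m n c r s t s' t' : nat)
    (A : 'M[R]_(m, n)) (nz : seq ('I_m * 'I_n))
    (M : 'M[R]_(m, c)) (N : 'M[R]_(r, n))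
    (DM : sketch R s t m) (DN : sketch R s' t' n)
    (q : real_query m n c r s t s' t') : R :=
  match q with
  | ValueA k => if onth nz k is Some p then A p.1 p.2 else 0
  | EntryM i j => M i j
  | EntryN i j => N i j
  | DrawSignM j => (-1) ^+ sk_neg DM j
  | DrawSignN j => (-1) ^+ sk_neg DN j
  | DrawNormalM i k => sk_normal DM i k
  | DrawNormalN i k => sk_normal DN i k
  end.

Definition inspect_input (R : realType) (m n s t s' t' : nat)
    (nz : seq ('I_m * 'I_n)) (DM : sketch R s t m) (DN : sketch R s' t' n)
    (q : index_query m n) : index_answer t t' q :=
  match q with
  | PositionA k => onth nz k
  | DrawRowM j => sk_row DM j
  | DrawRowN j => sk_row DN j
  end.

Definition execute (R : realType) (m n c r s t s' t' : nat)
    (p : algorithm m n c r s t s' t')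
    (A : 'M[R]_(m, n)) (nz : seq ('I_m * 'I_n))
    (M : 'M[R]_(m, c)) (N : 'M[R]_(r, n))
    (DM : sketch R s t m) (DN : sketch R s' t' n) : 'M[R]_(c, r) * nat :=
  run (fetch_input A nz M N DM DN) (inspect_input nz DM DN) p [::].

Definition support_mx (R : realType) (m n : nat) (A : 'M[R]_(m, n)) :
    {set 'I_m * 'I_n} :=
  [set p | A p.1 p.2 != 0]%SET.

Definition nnz (R : realType) (m n : nat) (A : 'M[R]_(m, n)) : nat :=
  #|support_mx A|.

Definition cost_bound (R : realType) (z m n c r : nat) (eps : R) : R :=
  let c' : R := c%:R in
  let r' : R := r%:R in
  z%:R + m%:R * c' + n%:R * r'
  + c' ^+ 2 * r' / eps ^+ 3 + c' * r' ^+ 2 / eps ^+ 3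
  + c' ^+ 2 * r' ^+ 2 / eps ^+ 2
  + c' ^+ 3 * r' / eps ^+ 2 + c' * r' ^+ 3 / eps ^+ 2
  + Num.min (c' ^+ 2 * r' ^+ 3 / eps) (c' ^+ 3 * r' ^+ 2 / eps)
  + c' ^+ 4 / eps + r' ^+ 4 / eps.

(* Main.v *)
Require Import Defs.
From HB Require Import structures.
From mathcomp Require Import all_boot all_order all_algebra.
From mathcomp Require Import all_classical all_reals all_analysis.
From mathcomp Require Import measurable_realfun ring lra zify.

(** Let U and V be orthonormal bases of the column spaces of M and of N^T,
    let P = U U^T and Q = V V^T be the projections on them, let S and S' be
    the two sketches, and let R0 = A - P A Q, which is the residual of X* since
    M X* N = P A Q.  By Pythagoras, |A - M X N|^2 = |R0|^2 + |P A Q - M X N|^2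
    for every X; so X* is optimal, and the task is to show that for X = Xhat
    the second term is at most eps |R0|^2, with probability 1 - delta.

    Deterministic part.  M Xhat N = U a A b^T V^T, where a = U^T M (S M)^+ S
    and b, built from N^T and S', are coordinates of oblique projections.  If
    |S U x|^2 >= eta |x|^2 for all x, then a U = 1 and
    (SU)^T (SU) a = (SU)^T S, so |a W| <= |(SU)^T S W| / eta for all W.
    Since a = U^T + a (1 - P) and b = V^T + b (1 - Q), the error
    a A b^T - U^T A V is a sum of three terms, each of which contains a factor
    (1 - P) or (1 - Q): one with a, one with b, one with both.  The error is
    therefore controlled once S and S' do not shrink the two column spaces
    ([embedding_good]), and once the products (SU)^T S W are small for the
    three matrices W at hand, which are orthogonal to the relevant basis and
    satisfy |W| <= |R0| ([sketched_regression_le]).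

    Products.  For u orthogonal to z, the number <S u, S z> is, for a fixed
    sparse embedding, a quadratic form in independent normal variables, and
    <Pi u, Pi z> is, for fixed rows, a quadratic form in independent signs.
    Second moments of such forms only involve moments of order at most four
    ([mean_quadM]); they give E |(SU)^T S W|^2 = O(eta^2 (1/t + 1/s) c |W|^2),
    and t and s of order c/eps make Markov's inequality conclusive.

    No shrinking.  For the sparse embedding alone, U^T Pi^T Pi U - 1 has mean
    squared norm at most 2 c^2 / t, which is where t of order c^2 comes from.
    For the normal matrix a one-sided bound with O(c) rows is enough; it is
    proved with a barrier in the style of Batson, Spielman and Srivastava
    ([barrier_failure_le]): rows are revealed one at a time, a matrix A that
    must stay positive definite is increased by h h^T and decreased by a fixed
    multiple of Y^T Y, where Y = Pi U, and the potential tr (Y A^-1 Y^T) does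
    not increase on average.  Again fourth moments suffice.

    Every conditioning on part of the random choices goes through one fact:
    blocks of mutually independent families are independent, so that the
    integral of f(w, w) is an iterated integral when the two occurrences of w
    are seen through disjoint blocks ([freezing_block_le]).

    Algorithm.  One scan of the nonzero entries computes Pi A Pi'^T; the normal
    matrices are multiplied in the cheaper of the two orders, according to
    whether c <= r; the pseudoinverses of the s x c matrix S M and of its
    analogue for N come from a recursion on columns that costs O(c^2 s)
    ([greville_step]).  Programs are trees in continuation-passing style, with
    specifications that count instructions ([wp]).  The same tree shows that
    the entries of Xhat are measurable functions of the outcome
    ([Xhat_measurable]), hence that the success event is measurable. *)

Set Implicit Arguments.
Unset Strict Implicit.
Unset Printing Implicit Defensive.

Import Order.TTheory GRing.Theory Num.Theory.
Import numFieldNormedType.Exports.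

Local Open Scope classical_set_scope.
Local Open Scope ring_scope.

(** * Squared Frobenius norm, oblique projections and orthonormal bases *)

Section frobenius_square.
Context (R : realType).

(** The squared norm avoids square roots; [frobenius] is its square root by definition. *)
Definition frob2 (m n : nat) (A : 'M[R]_(m, n)) : R := \sum_i \sum_j A i j ^+ 2.

Lemma frob2_ge0 m n (A : 'M[R]_(m, n)) : 0 <= frob2 A.
Proof. by do 2 (apply: sumr_ge0 => ? _); exact: sqr_ge0. Qed.

Lemma frob2E m n (A : 'M[R]_(m, n)) : frob2 A = \tr (A *m A^T).
Proof.
by apply: eq_bigr => i _; rewrite mxE; apply: eq_bigr => j _; rewrite mxE expr2.
Qed.

Lemma frob2_tr m n (A : 'M[R]_(m, n)) : frob2 A^T = frob2 A.
Proof.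
by rewrite /frob2 exchange_big; do 2 (apply: eq_bigr => ? _); rewrite mxE.
Qed.

Lemma frob2_eq0 m n (A : 'M[R]_(m, n)) : frob2 A = 0 -> A = 0.
Proof.
move=> /eqP A0; apply/matrixP => i j; rewrite mxE; apply/eqP; rewrite -sqrf_eq0.
move: A0; rewrite psumr_eq0 => [/allP/(_ i)|i' _]; last first.
  by apply: sumr_ge0 => j' _; exact: sqr_ge0.
rewrite mem_index_enum => /(_ isT); rewrite psumr_eq0 => [/allP/(_ j)|j' _]; last exact: sqr_ge0.
by rewrite mem_index_enum; exact.
Qed.

Lemma frob2_0 m n : frob2 (0 : 'M[R]_(m, n)) = 0.
Proof. by rewrite /frob2 big1 // => i _; rewrite big1 // => j _; rewrite mxE expr0n. Qed.

Lemma frob2N m n (A : 'M[R]_(m, n)) : frob2 (- A) = frob2 A.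
Proof. by do 2 (apply: eq_bigr => ? _); rewrite mxE sqrrN. Qed.

Lemma frob2_orth m n (A B : 'M[R]_(m, n)) : \tr (A *m B^T) = 0 ->
  frob2 (A + B) = frob2 A + frob2 B.
Proof.
move=> AB; rewrite !frob2E linearD /= mulmxDl !mulmxDr !mxtraceD AB.
by rewrite -[X in _ + (X + _)]mxtrace_tr trmx_mul trmxK AB; ring.
Qed.

Lemma frob2_isom m k n (U : 'M[R]_(m, k)) (A : 'M[R]_(k, n)) : U^T *m U = 1%:M ->
  frob2 (U *m A) = frob2 A.
Proof.
move=> UU; rewrite -frob2_tr frob2E trmxK trmx_mul -mulmxA (mulmxA _ U) UU mul1mx.
by rewrite -frob2_tr frob2E trmxK.
Qed.

Lemma frob2_proj m n (Q : 'M[R]_m) (A : 'M[R]_(m, n)) : Q^T = Q -> Q *m Q = Q ->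
  frob2 (Q *m A) <= frob2 A.
Proof.
move=> Qt QQ; have {2}-> : A = Q *m A + (A - Q *m A) by rewrite addrC subrK.
rewrite frob2_orth ?lerDl ?frob2_ge0 //.
rewrite linearB /= trmx_mul Qt mulmxBr mxtraceD -scaleN1r mxtraceZ.
by rewrite [in X in _ + X]mulmxA [in X in _ + X]mxtrace_mulC !mulmxA QQ mulN1r subrr.
Qed.

Lemma frob2_contract m k n (U : 'M[R]_(m, k)) (A : 'M[R]_(m, n)) :
  U^T *m U = 1%:M -> frob2 (U^T *m A) <= frob2 A.
Proof.
move=> UU; rewrite -(frob2_isom _ UU) mulmxA; apply: frob2_proj.
  by rewrite trmx_mul trmxK.
by rewrite !mulmxA -(mulmxA U) UU mulmx1.
Qed.

Lemma frob2_add3 m n (A B C : 'M[R]_(m, n)) :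
  frob2 (A + B + C) <= 3 * (frob2 A + frob2 B + frob2 C).
Proof.
rewrite /frob2 -!big_split mulr_sumr /=; apply: ler_sum => i _.
rewrite -!big_split mulr_sumr /=; apply: ler_sum => j _; rewrite !mxE.
have := sqr_ge0 (A i j - B i j); have := sqr_ge0 (A i j - C i j).
by have := sqr_ge0 (B i j - C i j); nra.
Qed.

Lemma frob2_col m n (A : 'M[R]_(m, n)) : frob2 A = \sum_j frob2 (col j A).
Proof.
rewrite /frob2 exchange_big; apply: eq_bigr => j _; apply: eq_bigr => i _.
by rewrite big_ord1 mxE.
Qed.

Lemma cauchy_schwarz_sum (I : finType) (f g : I -> R) :
  (\sum_i f i * g i) ^+ 2 <= (\sum_i f i ^+ 2) * (\sum_i g i ^+ 2).
Proof.
set a := \sum_i f i ^+ 2; set b := \sum_i g i ^+ 2; set c := \sum_i _.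
have a0 : 0 <= a by apply: sumr_ge0 => i _; exact: sqr_ge0.
have H x y : 0 <= x ^+ 2 * a + 2 * x * y * c + y ^+ 2 * b.
  have -> : x ^+ 2 * a + 2 * x * y * c + y ^+ 2 * b = \sum_i (x * f i + y * g i) ^+ 2.
    rewrite !mulr_sumr -!big_split /=; apply: eq_bigr => i _; ring.
  by apply: sumr_ge0 => i _; exact: sqr_ge0.
have [a_eq0|a_neq0] := eqVneq a 0.
  have f0 i : f i = 0.
    move/eqP: a_eq0; rewrite psumr_eq0 => [/allP/(_ i)|j _]; last exact: sqr_ge0.
    by rewrite mem_index_enum sqrf_eq0 => /(_ isT)/eqP.
  rewrite a_eq0 mul0r /c big1 ?expr0n // => i _.
  by rewrite f0 mul0r.
(* The discriminant of the form x^2 a + 2 x y c + y^2 b. *)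
have := H (- c) a; have a1 : 0 < a by rewrite lt_def a_neq0.
have -> : (- c) ^+ 2 * a + 2 * - c * a * c + a ^+ 2 * b = a * (a * b - c ^+ 2) by ring.
by rewrite pmulr_rge0 // subr_ge0.
Qed.

Lemma frob2_ip m (x y : 'cV[R]_m) : (x^T *m y) 0 0 ^+ 2 <= frob2 x * frob2 y.
Proof.
rewrite mxE; apply: le_trans (cauchy_schwarz_sum _ _) _.
rewrite /frob2 le_eqVlt; apply/orP; left; apply/eqP; congr (_ * _); apply: eq_bigr => i _.
  by rewrite big_ord1 mxE.
by rewrite big_ord1.
Qed.

(** By Cauchy-Schwarz, eta |x|^2 <= x^T G x <= |x| |G x|, so G stretches every
    vector by at least eta; this is then summed over columns. *)
Lemma frob2_pd k n (G : 'M[R]_k) (eta : R) (Z : 'M[R]_(k, n)) : 0 < eta ->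
  (forall x : 'cV_k, eta * frob2 x <= (x^T *m G *m x) 0 0) ->
  eta ^+ 2 * frob2 Z <= frob2 (G *m Z).
Proof.
move=> eta0 hG; rewrite (frob2_col Z) (frob2_col (G *m Z)) mulr_sumr.
apply: ler_sum => j _; rewrite [col j (G *m Z)]colE -mulmxA -colE; set x := col j Z.
have h := hG x; have := frob2_ip x (G *m x); rewrite mulmxA => cs.
have x0 := frob2_ge0 x; have [xeq|xneq] := eqVneq (frob2 x) 0.
  by rewrite xeq mulr0 frob2_ge0.
have xp : 0 < frob2 x by rewrite lt_def xneq.
rewrite -(ler_pM2l xp); apply: le_trans cs.
rewrite (_ : frob2 x * (_ * _) = (eta * frob2 x) ^+ 2); last by ring.
by rewrite ler_sqr ?nnegrE ?mulr_ge0 ?(ltW eta0) // (le_trans _ h) ?mulr_ge0 ?(ltW eta0).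
Qed.

End frobenius_square.
Section oblique_projection.
Context (R : realType).

Lemma mpinv_tr (m n : nat) (Y : 'M[R]_(m, n)) : mpinv Y^T = (mpinv Y)^T.
Proof.
apply/esym/mpinv_unique; have [a b c e] := mpinvP Y.
split.
- by rewrite -!trmx_mul mulmxA a.
- by rewrite -!trmx_mul mulmxA b.
- by rewrite -trmx_mul trmxK e.
- by rewrite -trmx_mul trmxK c.
Qed.

Variables (m c s k : nat) (M : 'M[R]_(m, c)) (S : 'M[R]_(s, m)) (U : 'M[R]_(m, k)).
Hypothesis UU : U^T *m U = 1%:M.
Hypothesis UM : U *m U^T = M *m mpinv M.
Variable eta : R.
Hypothesis eta0 : 0 < eta.
Hypothesis embed : forall x : 'cV_k, eta * frob2 x <= frob2 (S *m U *m x).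

Let G := (S *m U)^T *m (S *m U).

(** Coordinates in the basis U of the sketched least-squares projection
    M (S M)^+ S on the column space of M. *)
Definition oblique : 'M[R]_(k, m) := U^T *m M *m mpinv (S *m M) *m S.

Let form (x : 'cV_k) : eta * frob2 x <= (x^T *m G *m x) 0 0.
Proof.
rewrite (_ : (x^T *m G *m x) 0 0 = frob2 (S *m U *m x)) //.
rewrite -frob2_tr frob2E trmxK trmx_mul /G !mulmxA /mxtrace big_ord1.
by [].
Qed.

Lemma oblique_pd n (Z : 'M[R]_(k, n)) : eta ^+ 2 * frob2 Z <= frob2 (G *m Z).
Proof. exact: frob2_pd. Qed.

Lemma basis_mulM : U *m U^T *m M = M.
Proof. by rewrite UM; case: (mpinvP M). Qed.

Lemma mul_oblique : U *m oblique = M *m mpinv (S *m M) *m S.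
Proof. by rewrite /oblique !mulmxA basis_mulM. Qed.

(** These are the normal equations of the least-squares problem
    min |S U y - S b|: the columns of S U and of S M span the same space. *)
Lemma normal_eq_oblique : G *m oblique = (S *m U)^T *m S.
Proof.
rewrite /G -mulmxA -(mulmxA S) mul_oblique !mulmxA -(mulmxA _ S M).
set Y := S *m M.
have SU : S *m U = Y *m (mpinv M *m U).
  by rewrite /Y !mulmxA -(mulmxA S M) -UM -mulmxA -mulmxA UU mulmx1.
have [a b cc e] := mpinvP Y.
have YY : Y^T *m Y *m mpinv Y = Y^T by rewrite -mulmxA -cc -trmx_mul a.
by rewrite SU trmx_mul -(mulmxA _ Y^T) -(mulmxA _ _ (mpinv Y)) YY.
Qed.

(** The normal equations show that G kills the difference of the two sides,
    and G is injective because it dominates eta. *)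
Lemma oblique_basis : oblique *m U = 1%:M.
Proof.
apply/eqP; rewrite -subr_eq0; set Z := _ - _.
have GZ : G *m Z = 0.
  by rewrite /Z mulmxBr mulmxA normal_eq_oblique mulmx1 -mulmxA subrr.
have := oblique_pd Z; rewrite GZ frob2_0 pmulr_rle0 ?exprn_gt0 // => Zle.
by apply/eqP/frob2_eq0/eqP; rewrite eq_le Zle frob2_ge0.
Qed.

Lemma oblique_le n (W : 'M[R]_(m, n)) :
  eta ^+ 2 * frob2 (oblique *m W) <= frob2 ((S *m U)^T *m S *m W).
Proof. by rewrite -normal_eq_oblique -mulmxA; exact: oblique_pd. Qed.

End oblique_projection.

(** Gram-Schmidt, one column of M at a time: a column that already lies in
    the span of the previous ones leaves U unchanged.  The stronger induction
    hypothesis U = M B makes U U^T the orthogonal projection M M^+. *)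
Lemma orthonormal_basis (R : realType) (m c : nat) (M : 'M[R]_(m, c)) :
  exists k (U : 'M[R]_(m, k)), [/\ (k <= c)%N, U^T *m U = 1%:M & U *m U^T = M *m mpinv M].
Proof.
suff [k [U [kc UU UM [B MB]]]] : exists k (U : 'M[R]_(m, k)),
    [/\ (k <= c)%N, U^T *m U = 1%:M, U *m U^T *m M = M & exists B, U = M *m B].
  exists k, U; split => //; have [a b e f] := mpinvP M.
  have H1 : U *m U^T *m (M *m mpinv M) = M *m mpinv M by rewrite mulmxA UM.
  have H2 : M *m mpinv M *m (U *m U^T) = U *m U^T.
    by rewrite mulmxA {1}MB (mulmxA _ M) a -MB.
  have := congr1 trmx H1; rewrite trmx_mul e trmx_mul trmxK => <-.
  by rewrite H2.
elim: c M => [|c IH] M.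
  exists 0%N, 0; split => //; first by apply/matrixP => -[].
    by apply/matrixP => i [].
  by exists 0; apply/matrixP => i [].
rewrite -addn1 in M *.
have [k [U [kc UU UM [B MB]]]] := IH (lsubmx M).
pose a := rsubmx M; pose q := a - U *m U^T *m a.
have Uq : U^T *m q = 0.
  by rewrite /q mulmxBr !mulmxA UU mul1mx subrr.
have M_eq : M = row_mx (lsubmx M) a by rewrite hsubmxK.
have [q0|q0] := eqVneq (frob2 q) 0.
  have qz := frob2_eq0 q0.
  exists k, U; split => //; first by rewrite addn1 leqW.
    rewrite M_eq mul_mx_row UM; congr row_mx.
    by apply/esym/eqP; rewrite -subr_eq0 -/q qz.
  by exists (col_mx B 0); rewrite M_eq mul_row_col mulmx0 addr0.
(* The component q of the new column is normalized and appended to U. *)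
pose al := (Num.sqrt (frob2 q))^-1.
have qq : q^T *m q = (frob2 q)%:M.
  by rewrite [LHS]mx11_scalar -frob2_tr frob2E trmxK /mxtrace big_ord1.
have al2 : al * al * frob2 q = 1.
  by rewrite /al -invfM -expr2 sqr_sqrtr ?frob2_ge0 // mulVf.
have qT : (al *: q)^T = al *: q^T by rewrite linearZ.
exists (k + 1)%N, (row_mx U (al *: q)); split.
- by rewrite leq_add2r.
- rewrite tr_row_mx mul_col_row UU qT -!scalemxAl -!scalemxAr Uq.
  rewrite -[q^T *m U]trmxK trmx_mul trmxK Uq trmx0 qq !scaler0 scalerA scale_scalar_mx al2.
  by rewrite -scalar_mx_block.
- have aU : a = U *m (U^T *m a) + q by rewrite mulmxA addrC subrK.
  have qL : q^T *m lsubmx M = 0.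
    by rewrite -UM !mulmxA -[q^T *m U]trmxK trmx_mul trmxK Uq trmx0 !mul0mx.
  have qa : q^T *m a = (frob2 q)%:M.
    rewrite {1}aU mulmxDr qq mulmxA -[q^T *m U]trmxK trmx_mul trmxK Uq.
    by rewrite trmx0 mul0mx add0r.
  rewrite tr_row_mx mul_row_col qT -scalemxAl -scalemxAr scalerA mulmxDl.
  rewrite {1 2}M_eq !mul_mx_row UM -!scalemxAl -!mulmxA qL qa.
  rewrite mulmx0 mul_mx_scalar scaler0 scalerA al2 scale1r add_row_mx addr0.
  by rewrite -aU -M_eq.
- exists (block_mx B (- al *: (B *m (U^T *m a))) 0 al%:M).
  rewrite [RHS](_ : _ = row_mx (lsubmx M) a *m block_mx B (- al *: (B *m (U^T *m a))) 0 al%:M);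
    last by rewrite -M_eq.
  rewrite mul_row_block -MB mulmx0 addr0; congr row_mx.
  by rewrite -scalemxAr !mulmxA -MB mul_mx_scalar scaleNr addrC -scalerBr.
Qed.

(** * Deterministic error of the doubly sketched regression *)

Section regression_error.
Context (R : realType) (m n c r : nat).
Variables (A : 'M[R]_(m, n)) (M : 'M[R]_(m, c)) (N : 'M[R]_(r, n)).

(** The residual A - M X* N is orthogonal to every M Y N, because
    M^T (A - M X* N) N^T = 0 by the Penrose identities. *)
Lemma regression_pythagoras (X : 'M[R]_(c, r)) :
  let Xstar := mpinv M *m A *m mpinv N in
  frob2 (A - M *m X *m N) =
    frob2 (A - M *m Xstar *m N) + frob2 (M *m Xstar *m N - M *m X *m N).
Proof.
move=> Xstar; rewrite -frob2_orth; first by rewrite addrA subrK.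
have -> : M *m Xstar *m N - M *m X *m N = M *m (Xstar - X) *m N.
  by rewrite mulmxBr mulmxBl.
suff Z : M^T *m (A - M *m Xstar *m N) *m N^T = 0.
  move: (A - _) (Xstar - X) Z => R1 Y Z.
  by rewrite !trmx_mul !mulmxA mxtrace_mulC !mulmxA Z mul0mx mxtrace0.
rewrite mulmxBr mulmxBl; apply/eqP; rewrite subr_eq0; apply/eqP.
have [a _ b _] := mpinvP M; have [a' _ _ b'] := mpinvP N.
have MP : M^T *m M *m mpinv M = M^T by rewrite -mulmxA -b -trmx_mul a.
have QN : mpinv N *m N *m N^T = N^T by rewrite -b' -trmx_mul mulmxA a'.
by rewrite /Xstar !mulmxA MP -!mulmxA (mulmxA _ N) QN.
Qed.

Lemma regression_optimal (X : 'M[R]_(c, r)) :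
  frobenius (A - M *m (mpinv M *m A *m mpinv N) *m N) <= frobenius (A - M *m X *m N).
Proof.
by rewrite ler_wsqrtr // -!/(frob2 _) (regression_pythagoras X) lerDl frob2_ge0.
Qed.

Variables (k k' : nat) (U : 'M[R]_(m, k)) (V : 'M[R]_(n, k')).
Hypothesis UU : U^T *m U = 1%:M.
Hypothesis UM : U *m U^T = M *m mpinv M.
Hypothesis VV : V^T *m V = 1%:M.
Hypothesis VN : V *m V^T = N^T *m mpinv N^T.

(** The parts of A that U or V misses.  The three matrices below are those that
    the two sketches multiply in the error of the sketched solution. *)
Definition res_left : 'M[R]_(m, k') := (1%:M - U *m U^T) *m A *m V.
Definition res_right : 'M[R]_(n, k) := (1%:M - V *m V^T) *m A^T *m U.
Definition res_both : 'M[R]_(m, n) :=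
  (1%:M - U *m U^T) *m A *m (1%:M - V *m V^T).

Let R0 := A - M *m (mpinv M *m A *m mpinv N) *m N.

Let VN' : V *m V^T = mpinv N *m N.
Proof.
rewrite VN mpinv_tr -trmx_mul; by case: (mpinvP N).
Qed.

Let R0E : R0 = A - U *m U^T *m A *m (V *m V^T).
Proof. by rewrite /R0 UM VN' !mulmxA. Qed.

Let projC (l q : nat) (Z : 'M[R]_(q, l)) : Z^T *m Z = 1%:M ->
  ((1%:M - Z *m Z^T)^T = 1%:M - Z *m Z^T) *
  ((1%:M - Z *m Z^T) *m (1%:M - Z *m Z^T) = 1%:M - Z *m Z^T) *
  ((1%:M - Z *m Z^T) *m Z = 0) * (Z^T *m (1%:M - Z *m Z^T) = 0).
Proof.
move=> ZZ; have H : (1%:M - Z *m Z^T) *m Z = 0.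
  by rewrite mulmxBl mul1mx -mulmxA ZZ mulmx1 subrr.
have T : (1%:M - Z *m Z^T)^T = 1%:M - Z *m Z^T.
  by rewrite linearB /= trmx1 trmx_mul trmxK.
split; [split; [split=> //|by []]|].
  by rewrite mulmxBr mulmx1 mulmxA H mul0mx subr0.
by rewrite -T -trmx_mul H trmx0.
Qed.

Lemma basis_res_left : U^T *m res_left = 0.
Proof. by rewrite /res_left !mulmxA projC ?mul0mx. Qed.

Lemma basis_res_right : V^T *m res_right = 0.
Proof. by rewrite /res_right !mulmxA projC ?mul0mx. Qed.

Lemma basis_res_both : U^T *m res_both = 0.
Proof. by rewrite /res_both !mulmxA projC ?mul0mx. Qed.

Lemma res_both_basis : res_both *m V = 0.
Proof. by rewrite /res_both -(mulmxA _ _ V) (projC VV) mulmx0. Qed.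

(** Up to a contraction, this is the residual R0 itself: 1 - U U^T kills
    the component P A Q that A and R0 differ by. *)
Lemma frob2_res_left : frob2 res_left <= frob2 R0.
Proof.
have -> : res_left = (1%:M - U *m U^T) *m (R0 *m V).
  rewrite /res_left R0E; have := projC UU; move: (1%:M - _) => Z H.
  by rewrite mulmxBl mulmxBr !mulmxA H !mul0mx subr0.
apply: le_trans (frob2_proj _ _ _) _; rewrite ?projC //.
rewrite -frob2_tr trmx_mul -[leRHS]frob2_tr; exact: frob2_contract.
Qed.

Lemma frob2_res_right : frob2 res_right <= frob2 R0.
Proof.
have -> : res_right = (1%:M - V *m V^T) *m (R0^T *m U).
  rewrite /res_right R0E linearB /= !trmx_mul !trmxK.
  have := projC VV; move: (1%:M - _) => Z H.
  by rewrite mulmxBl mulmxBr !mulmxA H !mul0mx subr0.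
apply: le_trans (frob2_proj _ _ _) _; rewrite ?projC //.
rewrite -frob2_tr trmx_mul trmxK; exact: frob2_contract.
Qed.

Lemma frob2_res_both : frob2 res_both <= frob2 R0.
Proof.
have -> : res_both = (1%:M - U *m U^T) *m (R0 *m (1%:M - V *m V^T)).
  rewrite /res_both R0E; have := projC UU; move: (1%:M - U *m _) => Z H.
  by move: (1%:M - _) => Z'; rewrite mulmxBl mulmxBr !mulmxA H !mul0mx subr0.
apply: le_trans (frob2_proj _ _ _) _; rewrite ?projC //.
rewrite -frob2_tr trmx_mul -[leRHS]frob2_tr projC //.
by apply: frob2_proj; rewrite projC.
Qed.

Variables (s s' : nat) (S : 'M[R]_(s, m)) (S' : 'M[R]_(s', n)) (eta eta' e : R).
Hypotheses (eta0 : 0 < eta) (eta0' : 0 < eta').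
Hypothesis embedM : forall x : 'cV_k, eta * frob2 x <= frob2 (S *m U *m x).
Hypothesis embedN : forall x : 'cV_k', eta' * frob2 x <= frob2 (S' *m V *m x).
Hypothesis prodM : frob2 ((S *m U)^T *m S *m res_left) <= eta ^+ 2 * (e * frob2 R0).
Hypothesis prodN : frob2 ((S' *m V)^T *m S' *m res_right) <= eta' ^+ 2 * (e * frob2 R0).
Hypothesis prodMN :
  frob2 ((S' *m V)^T *m S' *m ((S *m U)^T *m S *m res_both)^T)
    <= eta' ^+ 2 * (eta ^+ 2 * (e * frob2 R0)).

(** The error of the sketched solution splits into three terms, one for each
    hypothesis on products, and each has squared norm at most e |R0|^2; the
    factor 9 is 3 from the sum of three terms times 3 for their number. *)
Lemma sketched_regression_le :
  frob2 (A - M *m Xhat A M N S S' *m N) <= (1 + 9 * e) * frob2 R0.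
Proof.
rewrite regression_pythagoras -/R0 mulrDl mul1r lerD2l.
have e2 : 0 < eta ^+ 2 by rewrite exprn_gt0.
have e2' : 0 < eta' ^+ 2 by rewrite exprn_gt0.
pose a := oblique M S U; pose b := oblique N^T S' V.
have Ua := mul_oblique S UM; rewrite -/a in Ua.
have Vb := mul_oblique S' VN; rewrite -/b in Vb.
have aU := oblique_basis UU UM eta0 embedM; rewrite -/a in aU.
have bV := oblique_basis VV VN eta0' embedN; rewrite -/b in bV.
have Vb' : b^T *m V^T = S'^T *m mpinv (N *m S'^T) *m N.
  rewrite -trmx_mul Vb !trmx_mul -mpinv_tr trmx_mul !trmxK.
  by rewrite mulmxA.
have -> : M *m (mpinv M *m A *m mpinv N) *m N - M *m Xhat A M N S S' *m N =
    - (U *m (a *m res_left + (b *m res_right)^T + a *m res_both *m b^T) *m V^T).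
  have -> : M *m Xhat A M N S S' *m N = U *m a *m A *m (b^T *m V^T).
    by rewrite Ua Vb' /Xhat !mulmxA.
  have -> : M *m (mpinv M *m A *m mpinv N) *m N = U *m U^T *m A *m (V *m V^T).
    by rewrite UM VN' !mulmxA.
  (* Insert a = U^T + a (1 - P) and b = V^T + b (1 - Q). *)
  have AE : a *m A *m b^T = U^T *m A *m V + (a *m res_left + (b *m res_right)^T + a *m res_both *m b^T).
    clearbody a b.
    have ha : a = U^T + a *m (1%:M - U *m U^T).
      by rewrite mulmxBr mulmx1 mulmxA aU mul1mx addrC subrK.
    have hb' : b^T = V + (1%:M - V *m V^T) *m b^T.
      by rewrite mulmxBl mul1mx -mulmxA -trmx_mul bV trmx1 mulmx1 addrC subrK.
    rewrite trmx_mul /res_left /res_right /res_both !trmx_mul trmxK.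
    have -> : (1%:M - V *m V^T)^T = 1%:M - V *m V^T by rewrite (projC VV).
    move: (1%:M - U *m _) (1%:M - V *m _) ha hb' => Pc Qc ha hb'.
    rewrite [in LHS]ha [in LHS]hb' !mulmxDl !mulmxDr !mulmxA -!addrA; congr (_ + _).
    by rewrite addrCA.
  have -> : U *m a *m A *m (b^T *m V^T) = U *m (a *m A *m b^T) *m V^T.
    by rewrite !mulmxA.
  have -> : U *m U^T *m A *m (V *m V^T) = U *m (U^T *m A *m V) *m V^T.
    by rewrite !mulmxA.
  by rewrite AE [in LHS]mulmxDr mulmxDl opprD addNKr.
rewrite frob2N -frob2_tr trmx_mul trmxK frob2_isom // frob2_tr frob2_isom //.
apply: le_trans (frob2_add3 _ _ _) _; rewrite [frob2 (b *m _)^T]frob2_tr.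
have h1 : frob2 (a *m res_left) <= e * frob2 R0.
  by rewrite -(ler_pM2l e2); apply: le_trans prodM; exact: oblique_le.
have h2 : frob2 (b *m res_right) <= e * frob2 R0.
  by rewrite -(ler_pM2l e2'); apply: le_trans prodN; exact: oblique_le.
have h3 : frob2 (a *m res_both *m b^T) <= e * frob2 R0.
  rewrite -(ler_pM2l e2) -(ler_pM2l e2'); apply: le_trans prodMN.
  have := oblique_le VV VN eta0' embedN ((S *m U)^T *m S *m res_both)^T.
  apply: le_trans; rewrite ler_pM2l // -/b.
  have -> X : frob2 (b *m X^T) = frob2 (X *m b^T) by rewrite -frob2_tr trmx_mul trmxK.
  have := oblique_le UU UM eta0 embedM (res_both *m b^T).
  by rewrite -/a !mulmxA.
lra.
Qed.

End regression_error.

(** * Independent blocks of random choices and freezing *)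

Section block_independence.
Context (R : realType) (d : measure_display) (T : measurableType d).
Context (P : probability T R) (I : finType) (F : I -> set_system T).
Hypothesis indF : mutually_independent P F.
Hypothesis mF : forall i, F i `<=` measurable.
Hypothesis FT : forall i, F i setT.
Hypothesis FI : forall i, setI_closed (F i).

Definition block (A : {set I}) : set_system T := \bigcup_(i in [set` A]) F i.

(** Finite intersections of events, one for each index; they generate the same
    sigma-algebra as [block] and are closed under intersection. *)
Definition cylinder (A : {set I}) : set_system T :=
  [set E | exists2 f : I -> set T, (forall i, i \in A -> F i (f i)) &
    E = \bigcap_(i in [set` A]) f i].

Lemma cylinder_setI (A : {set I}) : setI_closed (cylinder A).
Proof.
move=> _ _ [f fF ->] [g gF ->]; exists (fun i => f i `&` g i).
  by move=> i iA; apply: FI; [exact: fF|exact: gF].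
by rewrite bigcapI.
Qed.

Lemma cylinder_measurable (A : {set I}) : cylinder A `<=` measurable.
Proof.
move=> _ [f fF ->]; apply: fin_bigcap_measurable.
  exact: finite_finset.
by move=> i /= iA; apply/mF/fF.
Qed.

Lemma cylinder_setT (A : {set I}) : cylinder A setT.
Proof. by exists (fun=> setT) => //; rewrite bigcapT. Qed.

Lemma block_cylinder (A : {set I}) : <<s block A >> `<=` <<s cylinder A >>.
Proof.
apply: smallest_sub; first exact: smallest_sigma_algebra.
move=> E [i /= iA FE]; apply: sub_sigma_algebra.
exists (fun j => if j == i then E else setT).
  by move=> j jA; case: eqP => [->|].
apply/seteqP; split=> [x Ex j /= _|x /(_ i iA)]; first by case: ifP.
by rewrite /= eqxx.
Qed.

Lemma block_measurable (A : {set I}) : <<s block A >> `<=` measurable.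
Proof.
apply: smallest_sub; first exact: sigma_algebra_measurable.
by move=> E [i _]; exact: mF.
Qed.

(** Both products of probabilities are instances of mutual independence over
    the union of the two index sets. *)
Lemma cylinder_indep (A B : {set I}) (E G : set T) : (forall i, i \in A -> i \notin B) ->
  cylinder A E -> cylinder B G -> P (E `&` G) = (P E * P G)%E.
Proof.
move=> AB [f fF ->] [g gF ->].
rewrite (indF fF) (indF gF).
pose h i := if i \in A then f i else g i.
have hA : \bigcap_(i in [set` A]) f i `&` \bigcap_(i in [set` B]) g i
    = \bigcap_(i in [set` A :|: B]) h i.
  apply/seteqP; split=> [x [fx gx] i /=|x hx].
    rewrite inE /h; case: ifPn => [iA _|_ /= iB]; first exact: fx.
    exact: gx.
  split=> i /= iX.
    by have /= := hx i; rewrite inE iX /h iX => /(_ isT).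
  have /= := hx i; rewrite inE iX orbT /h ifF; first by move/(_ isT).
  by apply/negP => /AB; rewrite iX.
rewrite hA indF; last first.
  move=> i; rewrite inE /h; case: ifPn => [iA _|_ /= iB]; first exact: fF.
  exact: gF.
rewrite (big_setID A) /=; congr (_ * _)%E.
  rewrite (_ : (A :|: B) :&: A = A)%SET; last by apply/setP => i; rewrite !inE; case: (i \in A); rewrite ?andbF.
  by apply: eq_bigr => i iA; rewrite /h iA.
rewrite (_ : (A :|: B) :\: A = B)%SET; last first.
  by apply/setP => i; rewrite !inE; case iA: (i \in A) => //=; rewrite (negbTE (AB i iA)).
apply: eq_bigr => i iB; rewrite /h ifF //.
by apply/negP => /AB; rewrite iB.
Qed.

(** Two applications of the uniqueness of finite measures that agree on a
    generating class closed under intersection: first E ranges over cylinders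
    and G over the sigma-algebra of its block, then E becomes general too. *)
Lemma block_indep (A B : {set I}) (E G : set T) : (forall i, i \in A -> i \notin B) ->
  <<s block A >> E -> <<s block B >> G -> P (E `&` G) = (P E * P G)%E.
Proof.
move=> AB AE BG.
have mE := block_measurable AE; have mG := block_measurable BG.
have cG C : cylinder A C -> P (C `&` G) = (P C * P G)%E.
  move=> cC; have mC := cylinder_measurable cC.
  have finC : P C \is a fin_num by exact: fin_num_measure.
  pose p : {nonneg R} := NngNum (fine_ge0 (measure_ge0 P C)).
  have pE : (p%:num)%:E = P C by rewrite /= fineK.
  suff : mrestr P mC G = mscale p P G by rewrite /mrestr /mscale pE setIC.
  apply: (@g_sigma_algebra_measure_unique _ R T _ (@cylinder_measurable B)
    (fun=> setT)) (block_cylinder BG) => //.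
  - by move=> _; exact: cylinder_setT.
  - by rewrite bigcup_const //; exists 0%N.
  - exact: cylinder_setI.
  - by move=> D cD; rewrite /= /mrestr /mscale pE setIC (cylinder_indep AB).
  - by move=> _; rewrite /= /mrestr setTI ltey_eq finC.
have finG : P G \is a fin_num by exact: fin_num_measure.
(* E |-> P (E n G) and E |-> P E * P G are the two finite measures compared. *)
pose p : {nonneg R} := NngNum (fine_ge0 (measure_ge0 P G)).
have pE : (p%:num)%:E = P G by rewrite /= fineK.
suff : mrestr P mG E = mscale p P E by rewrite /mrestr /mscale pE muleC.
apply: (@g_sigma_algebra_measure_unique _ R T _ (@cylinder_measurable A)
  (fun=> setT)) (block_cylinder AE) => //.
- by move=> _; exact: cylinder_setT.
- by rewrite bigcup_const //; exists 0%N.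
- exact: cylinder_setI.
- by move=> D cD; rewrite /= /mrestr /mscale pE cG // muleC.
- by move=> _; rewrite /= /mrestr setTI ltey_eq finG.
Qed.

End block_independence.

Section freezing.
Local Open Scope ereal_scope.
Context (R : realType) (d d1 d2 : measure_display) (T : measurableType d).
Context (T1 : measurableType d1) (T2 : measurableType d2).
Context (P : probability T R) (X : T -> T1) (Y : T -> T2).
Hypotheses (mX : measurable_fun setT X) (mY : measurable_fun setT Y).
Hypothesis indXY : forall A B, measurable A -> measurable B ->
  P (X @^-1` A `&` Y @^-1` B) = P (X @^-1` A) * P (Y @^-1` B).

Let mXY : measurable_fun setT (fun w => (X w, Y w)).
Proof. exact: measurable_fun_pair. Qed.

(** The joint law of X and Y is the product of their laws, so this is Tonelli. *)
Lemma freezing_ge0 (f : T1 * T2 -> \bar R) :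
  measurable_fun setT f -> (forall z, 0 <= f z) ->
  \int[P]_w f (X w, Y w) = \int[P]_w \int[P]_w' f (X w, Y w').
Proof.
move=> mf f0.
pose X' : {mfun T >-> T1} := HB.pack X (isMeasurableFun.Build _ _ _ _ _ mX).
pose Y' : {mfun T >-> T2} := HB.pack Y (isMeasurableFun.Build _ _ _ _ _ mY).
pose XY' : {mfun T >-> (T1 * T2)%type} :=
  HB.pack (fun w => (X w, Y w)) (isMeasurableFun.Build _ _ _ _ _ mXY).
pose P1 : probability T1 R := distribution P X'.
pose P2 : probability T2 R := distribution P Y'.
pose P12 : probability (T1 * T2)%type R := distribution P XY'.
transitivity (\int[P12]_z f z).
  by rewrite /P12 ge0_integral_distribution.
transitivity (\int[P1 \x P2]_z f z).
  apply: eq_measure_integral => A mA _; apply/esym.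
  by apply: product_measure_unique => // B C mB mC; exact: indXY.
rewrite fubini_tonelli1 //.
rewrite /P1 ge0_integral_distribution //; last 2 first.
- exact: measurable_fun_fubini_tonelli_F.
- by move=> x; exact: integral_ge0.
apply: eq_integral => w _ /=.
rewrite /fubini_F /P2 ge0_integral_distribution //.
exact: measurableT_comp.
Qed.

Lemma freezing_le (f : T1 * T2 -> \bar R) (h : T -> \bar R) :
  measurable_fun setT f -> (forall z, 0 <= f z) -> measurable_fun setT h ->
  (forall w, \int[P]_w' f (X w, Y w') <= h w) ->
  \int[P]_w f (X w, Y w) <= \int[P]_w h w.
Proof.
move=> mf f0 mh fh; rewrite freezing_ge0 //.
have int0 w : 0 <= \int[P]_w' f (X w, Y w') by exact: integral_ge0.
apply: ge0_le_integral => //.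
  pose Y' : {mfun T >-> T2} := HB.pack Y (isMeasurableFun.Build _ _ _ _ _ mY).
  pose P2 : probability T2 R := distribution P Y'.
  have mF : measurable_fun setT (fubini_F P2 f) by exact: measurable_fun_fubini_tonelli_F.
  have := measurableT_comp mF mX.
  apply: eq_measurable_fun => w _ /=.
  by rewrite /fubini_F /P2 ge0_integral_distribution //; exact: measurableT_comp.
Qed.

End freezing.

Section freezing_block.
Local Open Scope ereal_scope.
Context (R : realType) (d : measure_display) (T : measurableType d).
Context (P : probability T R) (I : finType) (F : I -> set_system T).
Hypothesis indF : mutually_independent P F.
Hypothesis mF : forall i, F i `<=` measurable.
Hypothesis FT : forall i, F i setT.
Hypothesis FI : forall i, setI_closed (F i).

Lemma measurable_id_block (A : {set I}) :
  measurable_fun setT (idfun : T -> g_sigma_algebraType (block F A)).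
Proof. by move=> _ B mB; rewrite setTI; exact: (block_measurable mF mB). Qed.

(** Both arguments of f are the same outcome, seen through two sigma-algebras on
    the same type; the measurability of f on the product forces the first
    argument to be used only through A and the second only through B. *)
Lemma freezing_block_le (A B : {set I}) (f : g_sigma_algebraType (block F A) *
    g_sigma_algebraType (block F B) -> \bar R) (h : T -> \bar R) :
  (forall i, i \in A -> i \notin B) ->
  measurable_fun setT f -> (forall z, 0 <= f z) -> measurable_fun setT h ->
  (forall w, \int[P]_w' f (w, w') <= h w) ->
  \int[P]_w f (w, w) <= \int[P]_w h w.
Proof.
move=> AB mf f0 mh fh.
have ind : forall (C : set (g_sigma_algebraType (block F A)))
    (D : set (g_sigma_algebraType (block F B))),
    measurable C -> measurable D ->
    P (idfun @^-1` C `&` idfun @^-1` D) = P (idfun @^-1` C) * P (idfun @^-1` D).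
  by move=> C D mC mD; exact: (block_indep indF mF FT FI AB mC mD).
exact: (freezing_le (@measurable_id_block A) (@measurable_id_block B) ind mf f0 mh fh).
Qed.

End freezing_block.

Section product_expectation.
Local Open Scope ereal_scope.
Context (R : realType) (d : measure_display) (T : measurableType d).
Context (P : probability T R) (X Y : T -> R).
Hypotheses (iX : P.-integrable setT (EFin \o X))
  (iY : P.-integrable setT (EFin \o Y)).
Hypothesis indXY : forall A B, measurable A -> measurable B ->
  P (X @^-1` A `&` Y @^-1` B) = P (X @^-1` A) * P (Y @^-1` B).

Let mX : measurable_fun setT X.
Proof. exact/measurable_EFinP/(measurable_int _ iX). Qed.
Let mY : measurable_fun setT Y.
Proof. exact/measurable_EFinP/(measurable_int _ iY). Qed.
Let mXY : measurable_fun setT (fun w => (X w, Y w)).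
Proof. exact: measurable_fun_pair. Qed.

Lemma integrable_indep_mul : P.-integrable setT (fun w => (X w * Y w)%:E).
Proof.
apply/integrableP; split; first exact/measurable_EFinP/measurable_funM.
rewrite (freezing_ge0 mX mY indXY (f := fun z => `|(z.1 * z.2)%:E|)) //; last first.
  apply: measurableT_comp => //; apply/measurable_EFinP/measurable_funM => //.
have E w : \int[P]_w' `|(X w * Y w')%:E| = `|(X w)%:E| * \int[P]_w' `|(Y w')%:E|.
  rewrite -ge0_integralZl //; last first.
    by apply: measurableT_comp => //; exact/measurable_EFinP.
  by apply: eq_integral => w' _; rewrite EFinM abseM.
under eq_integral do rewrite /= E.
rewrite ge0_integralZr //.
- case/integrableP: iX => _ lX; case/integrableP: iY => _ lY.
  by rewrite lte_mul_pinfty ?integral_ge0 // ge0_fin_numE ?integral_ge0.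
- by apply: measurableT_comp => //; exact/measurable_EFinP.
- by apply: integral_ge0.
Qed.

(** Fubini for the joint law, which is a product. *)
Lemma Rintegral_indep_mul :
  (\int[P]_w (X w * Y w) = (\int[P]_w X w) * (\int[P]_w Y w))%R.
Proof.
pose X' : {mfun T >-> R} := HB.pack X (isMeasurableFun.Build _ _ _ _ _ mX).
pose Y' : {mfun T >-> R} := HB.pack Y (isMeasurableFun.Build _ _ _ _ _ mY).
pose XY' : {mfun T >-> (R * R)%type} :=
  HB.pack (fun w => (X w, Y w)) (isMeasurableFun.Build _ _ _ _ _ mXY).
pose P1 : probability R R := distribution P X'.
pose P2 : probability R R := distribution P Y'.
pose P12 : probability (R * R)%type R := distribution P XY'.
have eqP A : measurable A -> (P1 \x P2) A = P12 A.
  by move=> mA; apply: product_measure_unique => // B C mB mC; exact: indXY.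
pose f (z : R * R) : \bar R := (z.1 * z.2)%:E.
have mf : measurable_fun setT f by apply/measurable_EFinP/measurable_funM.
have int12 : P12.-integrable setT f.
  by apply: (integrable_pushforward mXY) => //; exact: integrable_indep_mul.
have intx : (P1 \x P2).-integrable setT f.
  apply/integrableP; split => //.
  rewrite (eq_measure_integral P12) => [|A mA _]; last exact: eqP.
  by case/integrableP: int12.
have i1 : P1.-integrable setT EFin by exact: (integrable_pushforward mX).
have i2 : P2.-integrable setT EFin by exact: (integrable_pushforward mY).
rewrite /Rintegral.
have -> : \int[P]_w (X w * Y w)%:E = \int[P12]_z f z.
  by rewrite integral_distribution //; exact: integrable_indep_mul.
have -> : \int[P12]_z f z = \int[P1 \x P2]_z f z.
  by apply: eq_measure_integral => A mA _; exact/esym/eqP.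
rewrite -integral12_prod_meas1 // /fubini_F /f /=.
have -> : \int[P]_w (X w)%:E = \int[P1]_x x%:E by rewrite integral_distribution.
have -> : \int[P]_w (Y w)%:E = \int[P2]_x x%:E by rewrite integral_distribution.
rewrite -fineM; [|exact: integrable_fin_num..].
congr fine.
have E (x : R) : \int[P2]_y (x * y)%:E = x%:E * \int[P2]_y y%:E.
  by rewrite -integralZl //; apply: eq_integral => y _; rewrite EFinM.
under eq_integral do rewrite E.
rewrite -[X in _ * X]fineK; last exact: integrable_fin_num.
by rewrite -integralZr //; apply: eq_integral => x _; rewrite fineK //; exact: integrable_fin_num.
Qed.

End product_expectation.

(** * Moments of the centered normal law *)

Ltac nng := repeat first [done | exact: sqr_ge0 | exact: normal_pdf_ge0
  | exact: ltW | apply: addr_ge0 | apply: divr_ge0 | apply: exprn_ge0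
  | apply: mulr_ge0].

Section normal_moments.
Local Open Scope ereal_scope.
Context (R : realType).
Notation mu := (@lebesgue_measure R).
Implicit Types (s : R) (f : R -> \bar R).

Lemma integral_normal_prob (m s : R) f : (s != 0)%R ->
  measurable_fun setT f -> (forall x, 0 <= f x) ->
  \int[normal_prob m s]_x f x = \int[mu]_x (f x * (normal_pdf m s x)%:E).
Proof.
move=> s0 mf f0; have dom := normal_prob_dominates m s.
rewrite -(Radon_Nikodym_SigmaFinite.change_of_variables dom) //.
have mpdf : measurable_fun setT (EFin \o normal_pdf m s).
  by apply/measurable_EFinP; exact: measurable_normal_pdf.
have iRN := Radon_Nikodym_SigmaFinite.f_integrable dom.
apply: ge0_ae_eq_integral => //.
- by apply: emeasurable_funM => //; exact: measurable_int iRN.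
- exact: emeasurable_funM.
- by move=> x _; rewrite mule_ge0 // Radon_Nikodym_SigmaFinite.f_ge0.
- by move=> x _; rewrite mule_ge0 // lee_fin normal_pdf_ge0.
have : ae_eq mu setT (Radon_Nikodym_SigmaFinite.f (normal_prob m s) mu)
    (EFin \o normal_pdf m s).
  apply: integral_ae_eq => // E _ mE.
  by rewrite -(Radon_Nikodym_SigmaFinite.f_integral dom).
by apply: filterS => x /= fx xT; rewrite fx.
Qed.

Lemma normal_pdfE0 s x : (s != 0)%R ->
  normal_pdf 0 s x = (normal_peak s * expR (- (x ^+ 2 / (s ^+ 2 *+ 2))))%R.
Proof. by move=> s0; rewrite normal_pdfE // /normal_fun subr0 mulNr. Qed.

Lemma sqrt2_le : (Num.sqrt 2 <= 3 / 2 :> R)%R.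
Proof.
rewrite -[leRHS]ger0_norm ?divr_ge0 // -sqrtr_sqr ler_sqrt ?sqr_ge0 //.
by rewrite expr_div_n ler_pdivlMr ?exprn_gt0 // -!natrX -natrM ler_nat.
Qed.

Lemma normal_peak_scale s c : (0 < s)%R -> (0 < c)%R ->
  normal_peak (Num.sqrt c * s) = ((Num.sqrt c)^-1 * normal_peak s)%R.
Proof.
move=> s0 c0; rewrite /normal_peak exprMn (sqr_sqrtr (ltW c0)).
have -> : (c * s ^+ 2 * pi *+ 2 = c * (s ^+ 2 * pi *+ 2))%R by ring.
by rewrite sqrtrM ?ltW // invfM.
Qed.

(** With y = x^2 / (4 s^2), the density at x is proportional to e^(-2y) and
    x^4 = 16 s^4 y^2; as y^2 e^(-y) <= 2, the integrand is at most a multiple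
    of the density with standard deviation sqrt 2 s, whose integral is 1. *)
Lemma normal_fourth_moment_le s : (0 < s)%R ->
  \int[normal_prob 0 s]_x (x ^+ 4)%:E <= (64 * s ^+ 4)%:E.
Proof.
move=> s0; have s1 : (s != 0)%R by rewrite gt_eqF.
have r0 : (0 < Num.sqrt 2 * s)%R by rewrite mulr_gt0 // sqrtr_gt0.
rewrite integral_normal_prob //; last 2 first.
- by apply/measurable_EFinP; exact: exprn_measurable.
- by move=> x; rewrite lee_fin exprn_even_ge0.
apply: (@le_trans _ _ (\int[mu]_x ((64 * s ^+ 4)%:E * (normal_pdf 0 (Num.sqrt 2 * s) x)%:E))).
  apply: ge0_le_integral => //.
  - by move=> x _; rewrite -EFinM lee_fin mulr_ge0 ?normal_pdf_ge0 // exprn_even_ge0.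
  - apply/measurable_EFinP/measurable_funM; first exact: exprn_measurable.
    exact: measurable_normal_pdf.
  - apply/measurable_EFinP/measurable_funM => //.
    exact: measurable_normal_pdf.
  move=> x _; rewrite -!EFinM lee_fin !normal_pdfE0 ?gt_eqF //.
  rewrite normal_peak_scale // exprMn sqr_sqrtr // -[(_ *+ 2)%R]mulr_natr -[X in (_ <= _ * (_ * expR (- (_ / X))))%R]mulr_natr.
  set y := (x ^+ 2 / (2 * s ^+ 2 * 2))%R.
  have -> : (x ^+ 2 / (s ^+ 2 * 2) = y + y)%R by rewrite /y; field.
  have y0 : (0 <= y)%R.
    by apply: divr_ge0; rewrite ?sqr_ge0 // mulr_ge0 // mulr_ge0 // sqr_ge0.
  have -> : (x ^+ 4 = 16 * s ^+ 4 * y ^+ 2)%R by rewrite /y; field.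
  have p0 := normal_peak_ge0 s.
  have e0 := expR_gt0 (- y).
  have le2 : (y ^+ 2 * expR (- y) <= 2)%R.
    rewrite expRN ler_pdivrMr ?expR_gt0 //.
    (* The exponential series is at least its term y^2 / 2. *)
    have := @expR_ge1Dxn R y 1 y0; rewrite (_ : (2`!%:R = 2)%R) //; lra.
  have le3 : (1 <= 2 * (Num.sqrt 2)^-1 :> R)%R.
    rewrite ler_pdivlMr ?sqrtr_gt0 // mul1r (le_trans sqrt2_le) //.
    by rewrite ler_pdivrMr // -natrM ler_nat.
  rewrite opprD expRD; set r := (Num.sqrt 2)^-1%R in le3 *.
  set q := expR (- y) in le2 e0 *; set p := normal_peak s in p0 *.
  rewrite -subr_ge0.
  have -> : (64 * s ^+ 4 * (r * p * q) - 16 * s ^+ 4 * y ^+ 2 * (p * (q * q)) =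
    16 * (s ^+ 4 * p * q) * ((2 - y ^+ 2 * q) + 2 * (2 * r - 1)))%R by ring.
  have a0 : (0 <= s ^+ 4 * p * q)%R.
    by apply: mulr_ge0; [apply: mulr_ge0 => //; exact/exprn_ge0/ltW|exact: ltW].
  apply: mulr_ge0; first exact: mulr_ge0.
  by apply: addr_ge0; rewrite ?mulr_ge0 // subr_ge0.
rewrite ge0_integralZl //.
- by rewrite integral_normal_pdf mule1.
- by apply/measurable_EFinP; exact: measurable_normal_pdf.
- by move=> x _; rewrite lee_fin normal_pdf_ge0.
- by rewrite lee_fin mulr_ge0 // exprn_ge0 // ltW.
Qed.

(** With y = x^2 / (2 s^2), the convexity bound e^(-y) >= 1 - y gives
    2 s^2 y e^(-y) >= 2 s^2 e^(-y) - 2 s^2 e^(-2y), and both terms on the right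
    are multiples of normal densities, with standard deviations s and
    s / sqrt 2. *)
Lemma normal_second_moment_ge s : (0 < s)%R ->
  (s ^+ 2 / 2)%:E <= \int[normal_prob 0 s]_x (x ^+ 2)%:E.
Proof.
move=> s0; have s1 : (s != 0)%R by rewrite gt_eqF.
have h0 : (0 < 2^-1 :> R)%R by rewrite invr_gt0.
have r0 : (0 < Num.sqrt 2^-1 * s)%R by rewrite mulr_gt0 // sqrtr_gt0.
rewrite integral_normal_prob //; last 2 first.
- by apply/measurable_EFinP; exact: exprn_measurable.
- by move=> x; rewrite lee_fin sqr_ge0.
pose c := ((Num.sqrt 2^-1)^-1 * s ^+ 2 : R)%R.
have c0 : (0 <= c)%R by rewrite mulr_ge0 ?sqr_ge0 // invr_ge0 sqrtr_ge0.
have mp (t : R) : measurable_fun setT (fun x : R => (normal_pdf 0 t x)%:E).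
  by apply/measurable_EFinP; exact: measurable_normal_pdf.
have m2 : measurable_fun setT (fun x : R => (x ^+ 2)%:E * (normal_pdf 0 s x)%:E).
  by apply: emeasurable_funM => //; by apply/measurable_EFinP; exact: exprn_measurable.
have mc (t a : R) : measurable_fun setT (fun x : R => a%:E * (normal_pdf 0 t x)%:E).
  by apply: emeasurable_funM => //; exact: mp.
have I : \int[mu]_x ((2 * s ^+ 2)%:E * (normal_pdf 0 s x)%:E) <=
  \int[mu]_x ((x ^+ 2)%:E * (normal_pdf 0 s x)%:E + c%:E * (normal_pdf 0 (Num.sqrt 2^-1 * s) x)%:E).
  apply: ge0_le_integral => //.
  - by move=> x _; rewrite -EFinM lee_fin; nng.
  - exact: mc.
  - by apply: emeasurable_funD; [exact: m2|exact: mc].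
  move=> x _; rewrite -!EFinM -EFinD lee_fin !normal_pdfE0 ?gt_eqF //.
  rewrite normal_peak_scale // exprMn (sqr_sqrtr (ltW h0)).
  set y := (x ^+ 2 / (s ^+ 2 *+ 2))%R.
  have -> : (x ^+ 2 / (2^-1 * s ^+ 2 *+ 2) = y + y)%R by rewrite /y; field.
  have -> : (x ^+ 2 = 2 * s ^+ 2 * y)%R by rewrite /y; field.
  have p0 := normal_peak_ge0 s.
  have e0 := expR_ge0 (- y).
  have le2 := expR_ge1Dx (- y).
  rewrite /c opprD expRD; set r := (Num.sqrt _)^-1%R.
  have rr : (r * r = 2)%R.
    by rewrite /r -invfM -expr2 sqr_sqrtr ?ltW // invrK.
  set q := expR (- y) in le2 e0 *; set p := normal_peak s in p0 *.
  rewrite -subr_ge0.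
  have -> : (2 * s ^+ 2 * y * (p * q) + r * s ^+ 2 * (r * p * (q * q)) - 2 * s ^+ 2 * (p * q) =
    s ^+ 2 * p * q * (2 * (y - 1) + (r * r) * q))%R by ring.
  have a0 : (0 <= s ^+ 2 * p * q)%R.
    by apply: mulr_ge0 => //; apply: mulr_ge0 => //; exact: sqr_ge0.
  by rewrite rr; apply: mulr_ge0 => //; lra.
have J (t a : R) : (0 <= a)%R -> \int[mu]_x (a%:E * (normal_pdf 0 t x)%:E) = a%:E.
  move=> a0; rewrite ge0_integralZl //.
  - by rewrite integral_normal_pdf mule1.
  - exact: mp.
  - by move=> x _; rewrite lee_fin normal_pdf_ge0.
move: I; rewrite J; last by nng.
rewrite ge0_integralD //.
- rewrite J //.
rewrite -leeBlDr // -EFinB; apply: le_trans; rewrite lee_fin /c.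
have -> : ((Num.sqrt 2^-1)^-1 = Num.sqrt 2 :> R)%R.
  by rewrite -sqrtrV // invrK.
  have := sqrt2_le; have := sqr_ge0 s; nra.
- by move=> x _; rewrite -EFinM lee_fin; nng.
- by move=> x _; rewrite -EFinM lee_fin; nng.
- exact: mc.
Qed.

(** Both sides are the sum of the same two integrals over the half-line. *)
Lemma ge0_integral_oppr (f : R -> R) : (forall x, 0 <= f x)%R -> continuous f ->
  \int[mu]_x (f x)%:E = \int[mu]_x (f (- x))%:E.
Proof.
move=> f0 cf.
have H (g : R -> R) : (forall x, 0 <= g x)%R -> continuous g ->
    \int[mu]_x (g x)%:E = \int[mu]_(x in `[0%R, +oo[) (g (- x))%:E +
    \int[mu]_(x in `[0%R, +oo[) (g x)%:E.
  move=> g0 cg.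
  have mg : measurable_fun [set: R] (EFin \o g).
    by apply/measurable_EFinP; exact: continuous_measurable_fun.
  rewrite -(setUv `[0%R, +oo[) ge0_integral_setU //=; last 4 first.
  - exact: measurableC.
  - by rewrite setUv.
  - by move=> x _; rewrite lee_fin.
  - exact/disj_setPCl.
  rewrite addeC; congr (_ + _).
  rewrite setCitvr integral_itv_bndo_bndc; last exact: measurable_funTS.
  rewrite -{1}oppr0 ge0_integration_by_substitutionNy //.
  exact: continuous_subspaceT.
rewrite (H f) // (H (f \o -%R)) //=; last first.
  by move=> x; apply: continuous_comp; [exact: opp_continuous|exact: cf].
by rewrite addeC; congr (_ + _); apply: eq_integral => x _; rewrite /= opprK.
Qed.

(** The density is even.  Positive and negative parts are kept apart, so that
    only integrals of nonnegative functions are compared. *)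
Lemma normal_mean_eq0 s : (0 < s)%R ->
  \int[normal_prob 0 s]_x (Num.max x 0)%R%:E = \int[normal_prob 0 s]_x (Num.max (- x) 0)%R%:E.
Proof.
move=> s0; have s1 : (s != 0)%R by rewrite gt_eqF.
have cmax : continuous (fun x : R => Num.max x 0%R).
  by move=> x; apply: continuous_max; [exact: cvg_id|exact: cvg_cst].
have mmax : measurable_fun setT (fun x : R => (Num.max x 0)%R%:E).
  by apply/measurable_EFinP; exact: continuous_measurable_fun.
have mmaxN : measurable_fun setT (fun x : R => (Num.max (- x) 0)%R%:E).
  apply/measurable_EFinP; apply: continuous_measurable_fun => x.
  by apply: continuous_max; [exact: opp_continuous|exact: cvg_cst].
rewrite !integral_normal_prob //; last 2 first.
- by move=> x; rewrite lee_fin le_max lexx orbT.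
- by move=> x; rewrite lee_fin le_max lexx orbT.
under eq_integral do rewrite -EFinM.
rewrite (ge0_integral_oppr (f := fun x => Num.max x 0 * normal_pdf 0 s x)%R).
- by apply: eq_integral => x _; rewrite -EFinM !normal_pdfE0 // sqrrN.
- by move=> x; rewrite mulr_ge0 ?normal_pdf_ge0 // le_max lexx orbT.
- move=> x; apply: cvgM; first exact: cmax.
  exact: continuous_normal_pdf.
Qed.

End normal_moments.

(** * Second moments of quadratic chaos *)

Section Rintegral_sum.
Context (R : realType) (d : measure_display) (T : measurableType d).
Context (P : {measure set T -> \bar R}).

Lemma integrableD_real (f h : T -> R) : P.-integrable setT (EFin \o f) ->
  P.-integrable setT (EFin \o h) ->
  P.-integrable setT (EFin \o (fun w => f w + h w)).
Proof. by move=> intf inth; exact: (integrableD measurableT intf inth). Qed.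

Lemma integrable_sum_real (I : Type) (r : seq I) (Q : pred I) (f : I -> T -> R) :
  (forall i, P.-integrable setT (EFin \o f i)) ->
  P.-integrable setT (EFin \o (fun w => \sum_(i <- r | Q i) f i w)).
Proof.
move=> intf; elim: r => [|i r IH].
  by under eq_fun do rewrite big_nil; exact: integrable0.
under eq_fun do rewrite big_cons.
by case: (Q i) => //; exact: integrableD_real.
Qed.

Lemma Rintegral_sum (I : Type) (r : seq I) (Q : pred I) (f : I -> T -> R) :
  (forall i, P.-integrable setT (EFin \o f i)) ->
  \int[P]_w (\sum_(i <- r | Q i) f i w) = \sum_(i <- r | Q i) \int[P]_w f i w.
Proof.
move=> intf; elim: r => [|i r IH].
  by under eq_Rintegral do rewrite big_nil; rewrite big_nil Rintegral_cst // mul0r.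
under eq_Rintegral do rewrite big_cons.
rewrite big_cons; case: (Q i) => //.
by rewrite RintegralD ?IH //; exact: integrable_sum_real.
Qed.

Lemma integrableZr_real (a : R) (f : T -> R) : P.-integrable setT (EFin \o f) ->
  P.-integrable setT (EFin \o (fun w => a * f w)).
Proof.
move=> intf; exact: (integrableZl measurableT a intf).
Qed.

End Rintegral_sum.

Section independent_reals.
Context (R : realType) (d : measure_display) (T : measurableType d).
Context (P : probability T R).

(** Events that the subfamily does not constrain are taken to be the whole space. *)
Lemma mutually_independent_sub (I J : finType) (F : I -> set_system T)
    (G : J -> set_system T) (h : J -> I) :
  injective h -> (forall j, G j `<=` F (h j)) ->
  mutually_independent P F -> mutually_independent P G.
Proof.
move=> inj GF ind A E GE.
pose E' i := if [pick j in A | h j == i] is Some j then E j else setT.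
have E'h j : j \in A -> E' (h j) = E j.
  move=> jA; rewrite /E'; case: pickP => [k /andP[_ /eqP/inj ->] //|/(_ j)].
  by rewrite jA eqxx.
have := ind (h @: A)%SET E' _.
rewrite big_imset /=; last by move=> x y _ _; exact: inj.
have -> : \bigcap_(i in [set` (h @: A)%SET]) E' i = \bigcap_(i in [set` A]) E i.
  apply/seteqP; split=> x /= H j.
    by move=> jA; rewrite -E'h //; apply: H; apply/imsetP; exists j.
  by move=> /imsetP[k kA ->]; rewrite E'h //; exact: H.
move=> -> ; first by apply: eq_bigr => j jA; rewrite E'h.
by move=> i /imsetP[k kA ->]; rewrite E'h //; apply: GF; exact: GE.
Qed.

End independent_reals.

Section preimage_family.
Context (R : realType) (d : measure_display) (T : measurableType d).
Context (P : probability T R) (X : finType) (g : X -> T -> R).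

Definition real_events (x : X) : set_system T :=
  preimage_set_system setT (g x) measurable.

Hypothesis mg : forall x, measurable_fun setT (g x).
Hypothesis ind : mutually_independent P real_events.

Lemma real_events_measurable x : real_events x `<=` measurable.
Proof. by move=> _ [B mB <-]; exact: mg. Qed.

Lemma real_events_setT x : real_events x setT.
Proof. by exists setT => //; rewrite preimage_setT setTI. Qed.

Lemma real_events_setI x : setI_closed (real_events x).
Proof.
move=> _ _ [A mA <-] [B mB <-]; exists (A `&` B); first exact: measurableI.
by rewrite preimage_setI !setTI.
Qed.

Definition block_fun (A : {set X}) (f : T -> R) : Prop :=
  measurable_fun setT (f : g_sigma_algebraType (block real_events A) -> R).

Lemma block_funX (A : {set X}) x : x \in A -> block_fun A (g x).
Proof.
move=> xA; move=> _ B mB; apply: sub_sigma_algebra.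
by exists x => //; exists B.
Qed.

Lemma block_funM (A : {set X}) f h : block_fun A f -> block_fun A h ->
  block_fun A (fun w => f w * h w).
Proof. exact: measurable_funM. Qed.

Lemma block_fun_indep (A B : {set X}) f h :
  (forall i, i \in A -> i \notin B) -> block_fun A f -> block_fun B h ->
  forall C D, measurable C -> measurable D ->
  P (f @^-1` C `&` h @^-1` D) = (P (f @^-1` C) * P (h @^-1` D))%E.
Proof.
move=> AB mf mh C D mC mD.
apply: (block_indep ind real_events_measurable real_events_setT
  real_events_setI AB).
  by rewrite -[X in <<s _ >> X]setTI; exact: mf.
by rewrite -[X in <<s _ >> X]setTI; exact: mh.
Qed.

Variables (v m4 : R).
Hypothesis int4 : forall x, P.-integrable setT (EFin \o (fun w => g x w ^+ 4)).
Hypothesis mean1 : forall x, \int[P]_w g x w = 0.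
Hypothesis mean2 : forall x, \int[P]_w (g x w ^+ 2) = v.
Hypothesis mean4 : forall x, \int[P]_w (g x w ^+ 4) = m4.

(** The product is dominated by the sum of the four fourth powers. *)
Lemma integrable_prod4 a b c e :
  P.-integrable setT (EFin \o (fun w => g a w * g b w * (g c w * g e w))).
Proof.
apply: (@le_integrable _ _ _ P _ measurableT _
  (EFin \o (fun w => \sum_(x <- [:: a; b; c; e]) g x w ^+ 4))).
- by apply/measurable_EFinP; do 2 apply: measurable_funM => //.
- move=> w _; rewrite /= lee_fin [leRHS]ger0_norm; last first.
    by apply: sumr_ge0 => x _; rewrite exprn_even_ge0.
  rewrite !big_cons big_nil addr0.
  set x := g a w; set y := g b w; set z := g c w; set t := g e w.
  have := sqr_ge0 (x ^+ 2 - y ^+ 2); have := sqr_ge0 (z ^+ 2 - t ^+ 2).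
  have := sqr_ge0 (x * y - z * t); have := sqr_ge0 (x * y + z * t).
  have -> (q : R) : q ^+ 4 = (q ^+ 2) ^+ 2 by rewrite -exprM.
  rewrite ler_norml => h1 h2 h3 h4; apply/andP.
  have := sqr_ge0 (x ^+ 2); have := sqr_ge0 (y ^+ 2).
  have := sqr_ge0 (z ^+ 2); have := sqr_ge0 (t ^+ 2).
  split; nra.
- exact: integrable_sum_real.
Qed.

Lemma integrable_sqr a : P.-integrable setT (EFin \o (fun w => g a w ^+ 2)).
Proof.
apply: (@le_integrable _ _ _ P _ measurableT _
  (EFin \o (fun w => 1 + g a w ^+ 4))).
- by apply/measurable_EFinP; exact: measurable_funX.
- move=> w _; rewrite /= lee_fin !ger0_norm ?sqr_ge0 ?addr_ge0 ?exprn_even_ge0 //.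
  have := sqr_ge0 (g a w ^+ 2 - 1); nra.
- by apply: integrableD_real => //; exact: finite_measure_integrable_cst.
Qed.

Lemma integrable_id a : P.-integrable setT (EFin \o g a).
Proof.
apply: (@le_integrable _ _ _ P _ measurableT _
  (EFin \o (fun w => 1 + g a w ^+ 2))).
- exact/measurable_EFinP.
- move=> w _; rewrite /= lee_fin [leRHS]ger0_norm ?addr_ge0 ?sqr_ge0 //.
  by rewrite ler_norml; apply/andP; split; nra.
- apply: integrableD_real; first exact: finite_measure_integrable_cst.
  exact: integrable_sqr.
Qed.

Lemma integrable_prod3 b c e :
  P.-integrable setT (EFin \o (fun w => g b w * (g c w * g e w))).
Proof.
apply: (@le_integrable _ _ _ P _ measurableT _
  (EFin \o (fun w => g b w ^+ 2 + g c w * g c w * (g e w * g e w)))).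
- by apply/measurable_EFinP; do 2 apply: measurable_funM => //.
- move=> w _; rewrite /= lee_fin.
  set x := g b w; set y := g c w; set z := g e w.
  have := sqr_ge0 x; have := sqr_ge0 (y * z).
  rewrite (_ : y * y * (z * z) = (y * z) ^+ 2); last by ring.
  have := sqr_ge0 (x - y * z); have := sqr_ge0 (x + y * z) => h1 h2 h3 h4.
  rewrite [leRHS]ger0_norm; last by lra.
  by rewrite ler_norml; apply/andP; split; nra.
- by apply: integrableD_real; [exact: integrable_sqr|exact: integrable_prod4].
Qed.

Let single a b c e : a != b -> a != c -> a != e ->
  \int[P]_w (g a w * (g b w * (g c w * g e w))) = 0.
Proof.
move=> ab ac ae; rewrite Rintegral_indep_mul ?mean1 ?mul0r //.
- exact: integrable_id.
- exact: integrable_prod3.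
apply: (@block_fun_indep [set a]%SET [set b; c; e]%SET).
- by move=> i /set1P ->; rewrite !inE !negb_or ab ac ae.
- by apply: block_funX; rewrite inE.
- by do 2 ?apply: block_funM; apply: block_funX; rewrite !inE eqxx ?orbT.
Qed.

Let pair a c : a != c ->
  \int[P]_w (g a w * (g a w * (g c w * g c w))) = v ^+ 2.
Proof.
move=> ac; under eq_Rintegral do rewrite mulrA -!expr2.
rewrite Rintegral_indep_mul ?mean2 //.
- exact: integrable_sqr.
- exact: integrable_sqr.
apply: (@block_fun_indep [set a]%SET [set c]%SET).
- by move=> i /set1P ->; rewrite !inE.
- by under eq_fun do rewrite expr2; apply: block_funM; apply: block_funX; rewrite !inE eqxx ?orbT.
- by under eq_fun do rewrite expr2; apply: block_funM; apply: block_funX; rewrite !inE eqxx ?orbT.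
Qed.

(** Expand according to the coincidences among the indices.  An index that
    differs from the three others makes the mean vanish; two distinct pairs give
    v^2.  If all four indices agree then the first term gives 3 v^2, which the
    second corrects to m4. *)
Lemma mean_prod4 a b c e :
  \int[P]_w (g a w * g b w * (g c w * g e w)) =
  v ^+ 2 * (((a == b) && (c == e))%:R + ((a == c) && (b == e))%:R
    + ((a == e) && (b == c))%:R)
  + (m4 - 3 * v ^+ 2) * ((a == b) && ((a == c) && (a == e)))%:R.
Proof.
have perm (f h : T -> R) : f =1 h -> \int[P]_w f w = \int[P]_w h w.
  by move=> fh; apply: eq_Rintegral => w _; exact: fh.
have [<-{b}|ab] := eqVneq a b.
  have [<-{c}|ac] := eqVneq a c.
    have [<-{e}|ae] := eqVneq a e.
      rewrite (perm _ (fun w => g a w ^+ 4)); last by move=> w; ring.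
      by rewrite mean4 /=; ring.
    rewrite (perm _ (fun w => g e w * (g a w * (g a w * g a w)))); last by move=> w; ring.
    transitivity (0 : R); first by apply: single; first [done | by rewrite eq_sym].
    by rewrite ?eqxx ?andbF /=; ring.
  have [<-{e}|ce] := eqVneq c e.
    rewrite (perm _ (fun w => g a w * (g a w * (g c w * g c w)))); last by move=> w; ring.
    by rewrite pair // ?eqxx ?andbF /=; ring.
  rewrite (perm _ (fun w => g c w * (g a w * (g a w * g e w)))); last by move=> w; ring.
  transitivity (0 : R); first by apply: single; first [done | by rewrite eq_sym].
    by rewrite ?eqxx ?andbF /=; ring.
have [<-{c}|ac] := eqVneq a c.
  have [<-{e}|be] := eqVneq b e.
    rewrite (perm _ (fun w => g a w * (g a w * (g b w * g b w)))); last by move=> w; ring.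
    by rewrite pair // ?eqxx ?[b == a]eq_sym ?(negbTE ab) ?andbF /=; ring.
  rewrite (perm _ (fun w => g b w * (g a w * (g a w * g e w)))); last by move=> w; ring.
  transitivity (0 : R); first by apply: single; first [done | by rewrite eq_sym].
    by rewrite ?eqxx ?[b == a]eq_sym ?(negbTE ab) ?andbF /=; ring.
have [<-{e}|ae] := eqVneq a e.
  have [<-{c ac}|bc] := eqVneq b c.
    rewrite (perm _ (fun w => g a w * (g a w * (g b w * g b w)))); last by move=> w; ring.
    by rewrite pair // ?eqxx ?[b == a]eq_sym ?(negbTE ab) ?andbF /=; ring.
  rewrite (perm _ (fun w => g b w * (g a w * (g c w * g a w)))); last by move=> w; ring.
  transitivity (0 : R); first by apply: single; first [done | by rewrite eq_sym].
    by rewrite ?eqxx ?[b == a]eq_sym ?(negbTE ab) ?andbF /=; ring.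
rewrite (perm _ (fun w => g a w * (g b w * (g c w * g e w)))); last by move=> w; ring.
transitivity (0 : R); first by apply: single; first [done | by rewrite eq_sym].
    by rewrite ?eqxx ?[b == a]eq_sym ?(negbTE ab) ?andbF /=; ring.
Qed.

(** Quadratic chaos with kernel E in the variables g. *)
Definition quad (E : X -> X -> R) (w : T) : R :=
  \sum_a \sum_b E a b * (g a w * g b w).

Lemma quadM E F w : quad E w * quad F w =
  \sum_a \sum_b \sum_c \sum_e E a b * F c e * (g a w * g b w * (g c w * g e w)).
Proof.
rewrite /quad mulr_suml; apply: eq_bigr => a _; rewrite mulr_suml.
apply: eq_bigr => b _; rewrite mulr_sumr; apply: eq_bigr => c _; rewrite mulr_sumr.
by apply: eq_bigr => e _; ring.
Qed.

Lemma integrable_quadM E F :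
  P.-integrable setT (EFin \o (fun w => quad E w * quad F w)).
Proof.
under eq_fun do rewrite quadM.
do 4 (apply: integrable_sum_real => ?).
by apply: integrableZr_real; exact: integrable_prod4.
Qed.

Lemma integrable_prod2 a b : P.-integrable setT (EFin \o (fun w => g a w * g b w)).
Proof.
apply: (@le_integrable _ _ _ P _ measurableT _
  (EFin \o (fun w => g a w ^+ 2 + g b w ^+ 2))).
- by apply/measurable_EFinP; apply: measurable_funM.
- move=> w _; rewrite /= lee_fin [leRHS]ger0_norm ?addr_ge0 ?sqr_ge0 //.
  by rewrite ler_norml; apply/andP; split; nra.
- by apply: integrableD_real; exact: integrable_sqr.
Qed.

Lemma integrable_quad E : P.-integrable setT (EFin \o quad E).
Proof.
do 2 (apply: integrable_sum_real => ?).
by apply: integrableZr_real; exact: integrable_prod2.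
Qed.

Lemma mean_prod2 a b : \int[P]_w (g a w * g b w) = v * (a == b)%:R.
Proof.
have [<-{b}|ab] := eqVneq a b.
  by rewrite mulr1 -(mean2 a); apply: eq_Rintegral => w _; rewrite expr2.
rewrite mulr0 Rintegral_indep_mul ?mean1 ?mul0r //.
- exact: integrable_id.
- exact: integrable_id.
apply: (@block_fun_indep [set a]%SET [set b]%SET).
- by move=> i /set1P ->; rewrite !inE.
- by apply: block_funX; rewrite inE.
- by apply: block_funX; rewrite inE.
Qed.

Lemma sum_delta (f : X -> R) a : \sum_b f b * (a == b)%:R = f a.
Proof.
rewrite (bigD1 a) //= eqxx mulr1 big1 ?addr0 // => b.
by rewrite eq_sym => /negbTE ->; rewrite mulr0.
Qed.

Lemma mean_quad E : \int[P]_w quad E w = v * \sum_a E a a.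
Proof.
rewrite /quad Rintegral_sum; last first.
  by move=> a; apply: integrable_sum_real => b; apply: integrableZr_real; exact: integrable_prod2.
rewrite mulr_sumr; apply: eq_bigr => a _.
rewrite Rintegral_sum; last by move=> b; apply: integrableZr_real; exact: integrable_prod2.
rewrite -(sum_delta (fun b => v * E a b)); apply: eq_bigr => b _.
by rewrite RintegralZl //; [rewrite mean_prod2; ring|exact: integrable_prod2].
Qed.

(** Expand into a sum over four indices and apply [mean_prod4] to each term. *)
Lemma mean_quadM E F : \int[P]_w (quad E w * quad F w) =
  v ^+ 2 * ((\sum_a E a a) * (\sum_a F a a) + (\sum_a \sum_b E a b * F a b)
     + (\sum_a \sum_b E a b * F b a))
  + (m4 - 3 * v ^+ 2) * \sum_a E a a * F a a.
Proof.
under eq_Rintegral do rewrite quadM.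
have I a b c e : P.-integrable setT (EFin \o (fun w => E a b * F c e * (g a w * g b w * (g c w * g e w)))).
  by apply: integrableZr_real; exact: integrable_prod4.
rewrite Rintegral_sum; last by move=> a; do 3 (apply: integrable_sum_real => ?).
under eq_bigr => a _.
  rewrite Rintegral_sum; last by move=> b; do 2 (apply: integrable_sum_real => ?).
  under eq_bigr => b _.
    rewrite Rintegral_sum; last by move=> c; do 1 (apply: integrable_sum_real => ?).
    under eq_bigr => c _.
      rewrite Rintegral_sum //.
      under eq_bigr => e _.
        rewrite RintegralZl //; last exact: integrable_prod4.
        rewrite mean_prod4.
        over.
      over.
    over.
  over.
set k := m4 - _.
have D (p q : bool) : (p && q)%:R = p%:R * q%:R :> R by rewrite -natrM mulnb.
transitivity (\sum_a \sum_b (v ^+ 2 * (\sum_c E a b * F c c) * (a == b)%:R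
   + v ^+ 2 * (E a b * F a b) + v ^+ 2 * (E a b * F b a)
   + k * (E a b * F a a) * (a == b)%:R)); last first.
  rewrite [(\sum_a E a a) * _]mulrC !mulrDr !mulr_sumr -!big_split /=.
  apply: eq_bigr => a _.
  rewrite !big_split /= !sum_delta -!mulr_sumr -!mulrA.
  by ring.
apply: eq_bigr => a _; apply: eq_bigr => b _.
transitivity (\sum_c (v ^+ 2 * (E a b * F c c) * (a == b)%:R
   + (v ^+ 2 * (E a b * F c b)) * (a == c)%:R + (v ^+ 2 * (E a b * F c a)) * (b == c)%:R
   + (k * (E a b * F c a) * (a == b)%:R) * (a == c)%:R)); last first.
  by rewrite !big_split /= !sum_delta mulr_sumr mulr_suml.
apply: eq_bigr => c _.
transitivity (\sum_e ((v ^+ 2 * (E a b * F c e) * (a == b)%:R) * (c == e)%:R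
   + (v ^+ 2 * (E a b * F c e) * (a == c)%:R) * (b == e)%:R
   + (v ^+ 2 * (E a b * F c e) * (b == c)%:R) * (a == e)%:R
   + (k * (E a b * F c e) * (a == b)%:R * (a == c)%:R) * (a == e)%:R)); last first.
  by rewrite !big_split /= !sum_delta.
by apply: eq_bigr => e _; rewrite !D; ring.
Qed.

End preimage_family.

(** * Moments of normal random variables *)

Section normal_rv.
Local Open Scope ereal_scope.
Context (R : realType) (d : measure_display) (T : measurableType d).
Context (P : probability T R) (s : R) (g : T -> R).
Hypothesis s0 : (0 < s)%R.
Hypothesis mg : measurable_fun setT g.
Hypothesis lawg : forall B, measurable B -> P [set w | B (g w)] = normal_prob 0 s B.

Let transfer (f : R -> R) : measurable_fun setT f -> (forall x, 0 <= f x)%R ->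
  \int[P]_w (f (g w))%:E = \int[normal_prob 0 s]_x (f x)%:E.
Proof.
move=> mf f0.
have mf' : measurable_fun setT (EFin \o f) by exact/measurable_EFinP.
pose LR := g_sigma_algebraType (R.-ocitv.-measurable).
have mg' : measurable_fun setT (g : T -> LR) by exact: mg.
have mf2 : measurable_fun setT (EFin \o f : LR -> \bar R) by exact: mf'.
pose g' : {mfun T >-> LR} := HB.pack (g : T -> LR) (isMeasurableFun.Build _ _ _ _ _ mg').
transitivity (\int[distribution P g']_x (f x)%:E).
  by rewrite ge0_integral_distribution // => x; rewrite lee_fin.
by apply: eq_measure_integral => B mB _; exact: lawg.
Qed.

Lemma normal_int4 : P.-integrable setT (EFin \o (fun w => g w ^+ 4)%R).
Proof.
apply/integrableP; split; first exact/measurable_EFinP/measurable_funX.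
under eq_integral => w _ do rewrite /= ger0_norm ?exprn_even_ge0 //.
rewrite (transfer (f := fun x => x ^+ 4)%R) //.
  by rewrite (le_lt_trans (normal_fourth_moment_le s0)) ?ltry.
by move=> x; rewrite exprn_even_ge0.
Qed.

Lemma normal_mean4_le : (\int[P]_w (g w ^+ 4) <= 64 * s ^+ 4)%R.
Proof.
rewrite -lee_fin /Rintegral fineK; last first.
  by apply: integrable_fin_num => //; exact: normal_int4.
rewrite (transfer (f := fun x => x ^+ 4)%R) //.
  exact: normal_fourth_moment_le.
by move=> x; rewrite exprn_even_ge0.
Qed.

Let int4 (x : unit) : P.-integrable setT (EFin \o (fun w => (fun=> g) x w ^+ 4)%R).
Proof. exact: normal_int4. Qed.

Lemma normal_int2 : P.-integrable setT (EFin \o (fun w => g w ^+ 2)%R).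
Proof. exact: (integrable_sqr (fun=> mg) int4 tt). Qed.

Lemma normal_int1 : P.-integrable setT (EFin \o g).
Proof. exact: (integrable_id (fun=> mg) int4 tt). Qed.

Lemma normal_mean2_ge : (s ^+ 2 / 2 <= \int[P]_w (g w ^+ 2))%R.
Proof.
rewrite -lee_fin /Rintegral fineK; last first.
  by apply: integrable_fin_num => //; exact: normal_int2.
rewrite (transfer (f := fun x => x ^+ 2)%R) //; first exact: normal_second_moment_ge.
by move=> x; rewrite sqr_ge0.
Qed.

(** The positive and negative parts of g have the same mean by symmetry of the law. *)
Lemma normal_mean1 : (\int[P]_w g w = 0)%R.
Proof.
have cmax : continuous (fun x : R => Num.max x 0%R).
  by move=> x; apply: continuous_max; [exact: cvg_id|exact: cvg_cst].
have mp : measurable_fun setT (fun x : R => Num.max x 0%R).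
  exact: continuous_measurable_fun.
have mn : measurable_fun setT (fun x : R => Num.max (- x)%R 0%R).
  apply: continuous_measurable_fun => x.
  by apply: continuous_max; [exact: opp_continuous|exact: cvg_cst].
have ip : P.-integrable setT (fun w => (Num.max (g w) 0)%R%:E).
  apply: (le_integrable measurableT _ _ normal_int1).
    by apply/measurable_EFinP; exact: (measurableT_comp mp).
  move=> w _; rewrite /= lee_fin ger0_norm ?le_max ?lexx ?orbT //.
  by rewrite ge_max ler_norm normr_ge0.
have im : P.-integrable setT (fun w => (Num.max (- g w) 0)%R%:E).
  apply: (le_integrable measurableT _ _ normal_int1).
    by apply/measurable_EFinP; exact: (measurableT_comp mn).
  move=> w _; rewrite /= lee_fin ger0_norm ?le_max ?lexx ?orbT //.
  by rewrite ge_max -normrN ler_norm normr_ge0.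
transitivity (\int[P]_w (Num.max (g w) 0 - Num.max (- g w) 0))%R.
  by apply: eq_Rintegral => w _; rewrite /Num.max; do 2 case: ifPn; lra.
rewrite RintegralB // /Rintegral (transfer (f := fun x => Num.max x 0)%R) //; last first.
  by move=> x; rewrite le_max lexx orbT.
rewrite (transfer (f := fun x => Num.max (- x) 0)%R) //; last first.
  by move=> x; rewrite le_max lexx orbT.
by rewrite normal_mean_eq0 // subrr.
Qed.

(** The right-hand sides of this lemma and of the next one depend on the law
    only; so all entries of a normal matrix share these two moments. *)
Lemma normal_mean2E : (\int[P]_w (g w ^+ 2))%R = fine (\int[normal_prob 0 s]_x (x ^+ 2)%:E).
Proof. by rewrite /Rintegral (transfer (f := fun x => x ^+ 2)%R) // => x; rewrite sqr_ge0. Qed.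

Lemma normal_mean4E : (\int[P]_w (g w ^+ 4))%R = fine (\int[normal_prob 0 s]_x (x ^+ 4)%:E).
Proof. by rewrite /Rintegral (transfer (f := fun x => x ^+ 4)%R) // => x; rewrite exprn_even_ge0. Qed.

End normal_rv.

(** * A barrier potential for sums of rank-one matrices *)

Section psd.
Context (R : realType).

Definition qf (n : nat) (A : 'M[R]_n) (x : 'cV[R]_n) : R := (x^T *m A *m x) 0 0.

Definition psd (n : nat) (A : 'M[R]_n) : Prop := A^T = A /\ forall x, 0 <= qf A x.

Definition pd (n : nat) (A : 'M[R]_n) : Prop :=
  A^T = A /\ forall x, x != 0 -> 0 < qf A x.

Lemma qf0 n (A : 'M[R]_n) : qf A 0 = 0.
Proof. by rewrite /qf mulmx0 mxE. Qed.

Lemma pd_psd n (A : 'M[R]_n) : pd A -> psd A.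
Proof.
move=> [At Ap]; split=> // x; have [->|x0] := eqVneq x 0; first by rewrite qf0.
exact/ltW/Ap.
Qed.

Lemma tr_scalar (a : 'M[R]_1) : a^T = a.
Proof. by apply/matrixP => i j; rewrite mxE !ord1. Qed.

(** The form is nonnegative on u x + v y for all u and v; taking u = -c and v = a,
    where c = x^T A y and a = x^T A x, gives the inequality when a > 0; when
    a = 0, taking u = -(y^T A y + 1) and v = c shows that c = 0. *)
Lemma psd_cs n (A : 'M[R]_n) (x y : 'cV[R]_n) : psd A ->
  (x^T *m A *m y) 0 0 ^+ 2 <= qf A x * qf A y.
Proof.
move=> [At Ap]; set c := _ 0 0; set a := qf A x; set b := qf A y.
have H u v : 0 <= u ^+ 2 * a + 2 * u * v * c + v ^+ 2 * b.
  have tE : (u *: x + v *: y)^T = u *: x^T + v *: y^T by rewrite linearD !linearZ.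
  have := Ap (u *: x + v *: y); rewrite /qf tE !(mulmxDl, mulmxDr) -!scalemxAl -!scalemxAr -?scalemxAl.
  have -> : y^T *m A *m x = x^T *m A *m y.
    by rewrite -[LHS]tr_scalar !trmx_mul trmxK At mulmxA.
  rewrite !mxE -/(qf A x) -/(qf A y).
  move=> h; apply: le_trans h _; rewrite le_eqVlt; apply/orP; left; apply/eqP.
  rewrite /a /b /c /qf !mxE; ring.
have a0 : 0 <= a by exact: Ap.
have b0 : 0 <= b by exact: Ap.
have [aeq|aneq] := eqVneq a 0.
  rewrite aeq mul0r; have := H (- (b + 1) * c) 1; rewrite aeq.
  have -> : (- (b + 1) * c) ^+ 2 * 0 + 2 * (- (b + 1) * c) * 1 * c + 1 ^+ 2 * b =
    b - 2 * (b + 1) * c ^+ 2 by ring.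
  have := H (- (b + 1)) c; rewrite aeq; have := sqr_ge0 c.
  nra.
have := H (- c) a; have a1 : 0 < a by rewrite lt_def aneq.
have -> : (- c) ^+ 2 * a + 2 * - c * a * c + a ^+ 2 * b = a * (a * b - c ^+ 2) by ring.
by rewrite pmulr_rge0 // subr_ge0.
Qed.

Lemma pd_unit n (A : 'M[R]_n) : pd A -> A \in unitmx.
Proof.
move=> [At Ap]; rewrite -row_free_unit -kermx_eq0; apply/rowV0P => v /sub_kermxP vA.
apply/eqP; apply: contraT => v0.
have := Ap v^T; rewrite trmx_eq0 v0 /qf trmxK vA mul0mx mxE ltxx.
by move=> /(_ isT).
Qed.

Lemma pd_inv n (A : 'M[R]_n) : pd A -> psd (invmx A).
Proof.
move=> pA; have uA := pd_unit pA; have [At Ap] := pd_psd pA.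
have it : (invmx A)^T = invmx A by rewrite trmx_inv At.
split=> // x; have := Ap (invmx A *m x); rewrite /qf trmx_mul it.
by rewrite -(mulmxA _ _ A) mulVmx // mulmx1 mulmxA.
Qed.

Lemma qf_sandwich n p (A : 'M[R]_n) (B : 'M[R]_(p, n)) x :
  qf (B *m A *m B^T) x = qf A (B^T *m x).
Proof. by rewrite /qf trmx_mul trmxK !mulmxA. Qed.

Lemma psd_sandwich n p (A : 'M[R]_n) (B : 'M[R]_(p, n)) :
  psd A -> psd (B *m A *m B^T).
Proof.
move=> [At Ap]; split=> [|x]; first by rewrite !trmx_mul trmxK At mulmxA.
by rewrite qf_sandwich.
Qed.

Lemma qf_delta n (A : 'M[R]_n) i : qf A (delta_mx i 0) = A i i.
Proof.
rewrite /qf trmx_delta -rowE mxE (bigD1 i) //= !mxE !eqxx mulr1 big1 ?addr0 //.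
by move=> j /negbTE ji; rewrite !mxE ji mulr0.
Qed.

Lemma psd_diag n (A : 'M[R]_n) i : psd A -> 0 <= A i i.
Proof. by move=> [_ Ap]; rewrite -qf_delta. Qed.

Lemma psd_entry n (A : 'M[R]_n) i j : psd A -> A i j ^+ 2 <= A i i * A j j.
Proof.
move=> pA; have := psd_cs (delta_mx i 0) (delta_mx j 0) pA; rewrite !qf_delta.
congr (_ ^+ 2 <= _); rewrite trmx_delta -rowE mxE (bigD1 j) //= !mxE !eqxx mulr1.
by rewrite big1 ?addr0 // => l /negbTE lj; rewrite !mxE lj mulr0.
Qed.

Lemma psd_tr_ge0 n (A : 'M[R]_n) : psd A -> 0 <= \tr A.
Proof. by move=> pA; apply: sumr_ge0 => i _; exact: psd_diag. Qed.

(** |A_ij| <= sqrt (A_ii A_jj), and the same for B; the inequality of arithmetic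
    and geometric means then compares A_ij B_ij with the products of diagonal
    entries. *)
Lemma psd_sum_le n (A B : 'M[R]_n) : psd A -> psd B ->
  \sum_i \sum_j A i j * B i j <= \tr A * \tr B.
Proof.
move=> pA pB.
have le_ij i j : 2 * (A i j * B i j) <= A i i * B j j + A j j * B i i.
  have a0 := psd_diag i pA; have a1 := psd_diag j pA.
  have b0 := psd_diag i pB; have b1 := psd_diag j pB.
  have h1 := psd_entry i j pA; have h2 := psd_entry i j pB.
  have h3 : (A i j * B i j) ^+ 2 <= (A i i * B j j) * (A j j * B i i).
    rewrite exprMn; apply: le_trans (ler_pM _ _ h1 h2) _; rewrite ?sqr_ge0 //.
    by rewrite le_eqVlt; apply/orP; left; apply/eqP; ring.
  set p := A i j * B i j in h3 *; set u := A i i * B j j in h3 *.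
  set v := A j j * B i i in h3 *.
  have u0 : 0 <= u by rewrite mulr_ge0.
  have v0 : 0 <= v by rewrite mulr_ge0.
  rewrite leNgt; apply/negP => lt; have := sqr_ge0 (u - v).
  nra.
(* Symmetrizing makes the right-hand side a product of traces. *)
have sum2 : \sum_i \sum_j (A i i * B j j + A j j * B i i) = 2 * (\tr A * \tr B).
  transitivity (\sum_i \sum_j A i i * B j j + \sum_i \sum_j A j j * B i i).
    by rewrite -big_split /=; apply: eq_bigr => i _; rewrite big_split.
  have S : \sum_i \sum_j A i i * B j j = \tr A * \tr B.
    by rewrite mulr_suml; apply: eq_bigr => i _; rewrite mulr_sumr.
  by rewrite [X in _ + X]exchange_big /= S; ring.
rewrite -(ler_pM2l (ltr0n R 2)) -sum2 mulr_sumr; apply: ler_sum => i _.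
by rewrite mulr_sumr; apply: ler_sum => j _.
Qed.

Lemma psd_sum_ge0 n (A B : 'M[R]_n) : psd A -> psd B -> 0 <= \tr (B *m A *m B).
Proof.
move=> pA pB; have := psd_sandwich B pA; case: (pB) => -> _.
exact: psd_tr_ge0.
Qed.

Lemma psd_sqr n (A : 'M[R]_n) : psd A -> psd (A *m A).
Proof.
move=> [At Ap]; split=> [|x]; first by rewrite trmx_mul At.
rewrite (_ : qf _ _ = frob2 (A *m x)) ?frob2_ge0 //.
by rewrite -frob2_tr frob2E trmxK trmx_mul At /qf /mxtrace big_ord1 !mulmxA.
Qed.

Lemma trE_sum n (A B : 'M[R]_n) : B^T = B -> \tr (A *m B) = \sum_i \sum_j A i j * B i j.
Proof.
move=> Bt; apply: eq_bigr => i _; rewrite mxE; apply: eq_bigr => j _.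
by rewrite -[in LHS]Bt mxE.
Qed.

End psd.

Lemma qf_gram (R : realType) (k p : nat) (h : 'M[R]_(k, p)) x :
  qf (h *m h^T) x = frob2 (h^T *m x).
Proof.
by rewrite -frob2_tr frob2E trmxK trmx_mul trmxK /qf /mxtrace big_ord1 !mulmxA.
Qed.

Section barrier.
Context (R : realType) (t k : nat) (Y : 'M[R]_(t, k)).

(** How close A is to being singular, weighted by Y^T Y: the trace of
    (Y^T Y) A^-1. *)
Definition potential (A : 'M[R]_k) : R := \tr (Y *m invmx A *m Y^T).

(** The amount, relative to Y^T Y, by which the barrier moves at each row.  It
    is small enough for the second-order terms with fourth moments at most 256
    to be absorbed by the first-order gain in [barrier_mean]. *)
Definition barrier_rate : R := 600^-1.

Lemma barrier_rate_gt0 : 0 < barrier_rate. Proof. by rewrite invr_gt0 ltr0n. Qed.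

Lemma potential_ge0 A : pd A -> 0 <= potential A.
Proof. by move=> pA; apply/psd_tr_ge0/psd_sandwich/pd_inv. Qed.

(** Y A^-1 Y^T has trace at most 1, so Y^T Y <= A; concretely, Cauchy-Schwarz for
    the form A^-1 bounds each coordinate of Y x. *)
Lemma potential_le1 A x : pd A -> potential A <= 1 -> frob2 (Y *m x) <= qf A x.
Proof.
move=> pA le1; have pI := pd_inv pA; have uA := pd_unit pA.
have q0 : 0 <= qf A x by apply: (pd_psd pA).2.
apply: (@le_trans _ _ (potential A * qf A x)); last by rewrite ler_piMl.
rewrite /potential /mxtrace mulr_suml; apply: ler_sum => i _; rewrite big_ord1.
have := psd_cs ((row i Y)^T) (A *m x) pI; rewrite trmxK.
rewrite -!mulmxA (mulmxA (invmx A)) mulVmx // mul1mx.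
congr (_ <= _).
  by rewrite -row_mul mxE.
congr (_ * _).
  rewrite /qf trmxK mulmxA -row_mul [LHS]mxE [RHS]mxE; apply: eq_bigr => j _.
  by rewrite mxE; congr (_ * _); rewrite !mxE.
by rewrite /qf trmx_mul (pd_psd pA).1 -(mulmxA x^T) mulmxV // mulmx1 mulmxA.
Qed.

Variable A : 'M[R]_k.
Hypotheses (pA : pd A) (leA : potential A <= 1).

Let S := Y^T *m Y.
Let B := A - barrier_rate *: S.
Let D := Y *m invmx B *m Y^T.
Let E := Y *m invmx A *m Y^T.

Let qfS x : qf S x = frob2 (Y *m x).
Proof.
by rewrite -frob2_tr frob2E trmxK trmx_mul /qf /mxtrace big_ord1 /S !mulmxA.
Qed.

Let qfB x : qf B x = qf A x - barrier_rate * frob2 (Y *m x).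
Proof.
by rewrite -qfS /qf /B mulmxBr mulmxBl -scalemxAr -scalemxAl !mxE.
Qed.

(** A >= Y^T Y by [potential_le1], and the shift removes less than that. *)
Lemma barrier_shift : pd (A - barrier_rate *: (Y^T *m Y)).
Proof.
have [At Ap] := pA; split=> [|x x0].
  by rewrite linearB /= linearZ /= At trmx_mul trmxK.
rewrite -/S -/B qfB; have := Ap x x0; have := potential_le1 x pA leA.
have := frob2_ge0 (Y *m x); rewrite /barrier_rate; nra.
Qed.

Let pB : pd B := barrier_shift.
Let uA := pd_unit pA.
Let uB := pd_unit pB.

Let invB : invmx B - invmx A = barrier_rate *: (invmx A *m S *m invmx B).
Proof.
have : invmx A *m (A - B) *m invmx B = invmx B - invmx A.
  by rewrite mulmxBr mulVmx // mulmxBl mul1mx -mulmxA mulmxV // mulmx1.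
by move=> <-; rewrite /B opprB addrC subrK -scalemxAr -scalemxAl.
Qed.

Let DE : D - E = barrier_rate *: (E *m D).
Proof.
rewrite /D /E -mulmxBl -mulmxBr invB -scalemxAr -scalemxAl /S.
by rewrite !mulmxA.
Qed.

Lemma barrier_psd : psd D. Proof. exact/psd_sandwich/pd_inv. Qed.
Let psdE : psd E. Proof. exact/psd_sandwich/pd_inv. Qed.

(** Let D and E be Y B^-1 Y^T and Y A^-1 Y^T.  The resolvent identity is
    D - E = barrier_rate E D, and tr (E D) <= tr E tr D <= tr D. *)
Lemma barrier_trace_le2 : \tr D <= 2.
Proof.
have pD := barrier_psd.
have h : \tr D - \tr E = barrier_rate * \tr (E *m D).
  by rewrite -mxtraceZ -DE linearB.
have h2 : \tr (E *m D) <= \tr E * \tr D.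
  by rewrite trE_sum ?(pD.1) //; exact: psd_sum_le.
have h3 := psd_tr_ge0 pD; have h4 := psd_tr_ge0 psdE.
have h5 : \tr E <= 1 by [].
move: h; rewrite /barrier_rate; nra.
Qed.

(** The potential before the shift is tr E, and tr D - tr E is barrier_rate times
    tr (E D), which is at most tr (D D) because D - E = barrier_rate E D. *)
Lemma barrier_decrement : \tr D - barrier_rate * \tr (D *m D) <= potential A.
Proof.
rewrite -/(potential A) /potential -/E.
have h : \tr D - \tr E = barrier_rate * \tr (E *m D).
  by rewrite -mxtraceZ -DE linearB.
have h2 : \tr (D *m D) - \tr (E *m D) = barrier_rate * \tr (D *m E *m D).
  have -> : \tr (E *m D) = \tr (D *m E) by rewrite mxtrace_mulC.
  by rewrite -mxtraceZ -mulmxA scalemxAr -DE mulmxBr linearB.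
have h3 := psd_sum_ge0 psdE barrier_psd; have s0 := barrier_rate_gt0.
nra.
Qed.

(** By the Sherman-Morrison formula a row g lowers the potential by
    a / (1 + b), where a = g^T D^2 g and b = g^T D g.  The tangent bound
    1 / x >= 2 r - r^2 x at x = 1 + b makes this polynomial in g, so that
    its mean only involves moments of order at most four. *)
Lemma barrier_step (g : 'cV[R]_t) (h := Y^T *m g) :
  pd (B + h *m h^T) /\
  potential (B + h *m h^T) <=
    \tr D - 2 * barrier_rate * qf (D *m D) g + barrier_rate ^+ 2 * (qf (D *m D) g * (1 + qf D g)).
Proof.
have [Bt Bp] := pB.
have pC : pd (B + h *m h^T).
  split=> [|x x0]; first by rewrite linearD /= Bt trmx_mul trmxK.
  have -> : qf (B + h *m h^T) x = qf B x + frob2 (h^T *m x).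
    by rewrite {1}/qf mulmxDr mulmxDl mxE; congr (_ + _); exact: qf_gram.
  by rewrite ltr_wpDr ?frob2_ge0 // Bp.
split=> //.
set b := qf D g; have b0 : 0 <= b by apply: barrier_psd.2.
have hb : h^T *m invmx B *m h = b%:M.
  by rewrite [LHS]mx11_scalar /b /qf /D /h trmx_mul trmxK !mulmxA.
(* The Sherman-Morrison formula. *)
have inv : invmx (B + h *m h^T) = invmx B - (1 + b)^-1 *: (invmx B *m h *m (h^T *m invmx B)).
  have uC := pd_unit pC.
  apply: (can_inj (mulmxK uC)); rewrite mulVmx //.
  have e1 : invmx B *m h *m (h^T *m invmx B) *m B = invmx B *m h *m h^T.
    by rewrite -mulmxA -(mulmxA h^T) mulVmx // mulmx1.
  have e2 : invmx B *m h *m (h^T *m invmx B) *m (h *m h^T) = b *: (invmx B *m h *m h^T).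
    by rewrite mulmxA -(mulmxA (invmx B *m h)) hb mul_mx_scalar -scalemxAl.
  rewrite mulmxBl -scalemxAl (mulmxDr (invmx B) B) (mulmxDr _ B) mulVmx // e1 e2 mulmxA.
  rewrite -{2}[invmx B *m h *m h^T]scale1r -scalerDl scalerA mulVf ?scale1r ?addrK //.
  by rewrite gt_eqF // ltr_pwDl.
have a0 : 0 <= qf (D *m D) g by apply: (psd_sqr barrier_psd).2.
have -> : potential (B + h *m h^T) = \tr D - (1 + b)^-1 * qf (D *m D) g.
  rewrite /potential inv mulmxBr mulmxBl -/D linearB /=; congr (_ - _).
  rewrite -scalemxAr -scalemxAl mxtraceZ; congr (_ * _).
  have -> : Y *m (invmx B *m h *m (h^T *m invmx B)) *m Y^T = (D *m g) *m (g^T *m D).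
    by rewrite /D /h trmx_mul trmxK !mulmxA.
  by rewrite mxtrace_mulC /mxtrace big_ord1 /qf !mulmxA.
have b1 : 0 < 1 + b by lra.
(* The tangent to 1 / x at x = 1 / barrier_rate. *)
have key : 2 * barrier_rate - barrier_rate ^+ 2 * (1 + b) <= (1 + b)^-1.
  rewrite -(ler_pM2r b1) mulVf ?gt_eqF //.
  have := sqr_ge0 (1 - barrier_rate * (1 + b)); nra.
have := ler_wpM2r a0 key; lra.
Qed.

End barrier.

(** * Random rows never cross the barrier *)

(** Quadratic forms are continuous and rational vectors are dense.  Quantifying
    over rational vectors makes the failure events below countable unions. *)
Lemma qf_ge0_rat (R : realType) (k : nat) (H : 'M[R]_k) :
  (forall q : 'cV[rat]_k, 0 <= qf H (map_mx ratr q)) -> forall x, 0 <= qf H x.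
Proof.
move=> Hq x; rewrite leNgt; apply/negP => neg.
have qfE y : qf H y = \sum_a \sum_b H a b * (y a 0 * y b 0).
  rewrite /qf -mulmxA mxE; apply: eq_bigr => a _; rewrite !mxE mulr_sumr.
  by apply: eq_bigr => b _; ring.
pose K := \sum_a \sum_b `|H a b| * (`|x a 0| + `|x b 0| + 1).
have K0 : 0 <= K.
  by do 2 (apply: sumr_ge0 => ? _); rewrite mulr_ge0 // !addr_ge0.
pose eta := Num.min 1 (- qf H x / (K + 1)).
have eta0 : 0 < eta.
  by rewrite lt_min ltr01 divr_gt0 // ?oppr_gt0 // ltr_pwDr.
have [q qx] : exists q : 'cV[rat]_k, forall a, `|ratr (q a 0) - x a 0| <= eta.
  have H1 a : exists r : rat, `|ratr r - x a 0| <= eta.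
    have lt : x a 0 < x a 0 + eta by rewrite ltrDl.
    have [r] := rat_in_itvoo lt; rewrite in_itv /= => /andP[h1 h2].
    by exists r; rewrite ger0_norm; lra.
  exists (\col_a sval (cid (H1 a))) => a; rewrite mxE.
  exact: (svalP (cid (H1 a))).
have := Hq q; apply/negP; rewrite -ltNge.
apply: (@le_lt_trans _ _ (qf H x + eta * K)); last first.
  apply: (@le_lt_trans _ _ (qf H x + (- qf H x / (K + 1)) * K)).
    by rewrite lerD2l ler_wpM2r // ge_min lexx orbT.
  have K1 : 0 < K + 1 by rewrite ltr_pwDr.
  have -> : qf H x + - qf H x / (K + 1) * K = qf H x / (K + 1).
    by field; rewrite gt_eqF.
  by rewrite pmulr_llt0 // invr_gt0.
rewrite -lerBlDl !qfE -sumrB /K mulr_sumr; apply: ler_sum => a _.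
rewrite -sumrB mulr_sumr; apply: ler_sum => b _.
rewrite -mulrBr; apply: le_trans (ler_norm _) _; rewrite normrM mulrCA ler_wpM2l //.
rewrite !mxE; set u := ratr (q a 0); set v := ratr (q b 0).
have -> : u * v - x a 0 * x b 0 = (u - x a 0) * x b 0 + x a 0 * (v - x b 0) + (u - x a 0) * (v - x b 0) by ring.
apply: le_trans (ler_normD _ _) _; apply: le_trans (lerD (ler_normD _ _) (lexx _)) _.
rewrite !normrM; have h1 := qx a; have h2 := qx b; rewrite -/u -/v in h1 h2.
have e1 : eta <= 1 by rewrite ge_min lexx.
have p1 : `|u - x a 0| * `|x b 0| <= eta * `|x b 0| by rewrite ler_wpM2r.
have p2 : `|x a 0| * `|v - x b 0| <= `|x a 0| * eta by rewrite ler_wpM2l.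
have p3 : `|u - x a 0| * `|v - x b 0| <= eta * 1.
  by apply: ler_pM => //; exact: le_trans e1.
lra.
Qed.

Section barrier_probability.
Context (R : realType) (d : measure_display) (T : measurableType d).
Context (P : probability T R) (s t k : nat).
Variable g : 'I_s * 'I_t -> T -> R.
Hypothesis mg : forall x, measurable_fun setT (g x).
Hypothesis ind : mutually_independent P (real_events g).
Hypothesis int4 : forall x, P.-integrable setT (EFin \o (fun w => g x w ^+ 4)).
Hypothesis mean1 : forall x, \int[P]_w g x w = 0.
Hypothesis mean2 : forall x, \int[P]_w (g x w ^+ 2) = 1.
Variable m4 : R.
Hypothesis mean4 : forall x, \int[P]_w (g x w ^+ 4) = m4.
Hypothesis m4_le : m4 <= 256.
Variable Y : 'M[R]_(t, k).

Definition entry_row (i : 'I_s) (w : T) : 'cV[R]_t := \col_a g (i, a) w.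

Definition row_dot (i : 'I_s) (u : 'cV[R]_t) (w : T) : R := \sum_a g (i, a) w * u a 0.

Let mgi i a : measurable_fun setT ((fun a => g (i, a)) a).
Proof. exact: mg. Qed.

Let indi i : mutually_independent P (real_events (fun a : 'I_t => g (i, a))).
Proof.
apply: (mutually_independent_sub (h := fun a => (i, a))) ind; first by move=> a b [].
by move=> a E.
Qed.

Let qf_entry_row i E w : qf E (entry_row i w) = quad (fun a => g (i, a)) (fun a b => E a b) w.
Proof.
rewrite /qf -mulmxA mxE; apply: eq_bigr => a _; rewrite !mxE mulr_sumr.
by apply: eq_bigr => b _; rewrite !mxE; ring.
Qed.

(** Here tr D <= 2 bounds the fourth-order terms by a multiple of tr (D D); with
    rate 1/600 they are at most half of the first-order gain, and what is left
    pays for the shift of the barrier. *)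
Lemma barrier_mean (i : 'I_s) (D : 'M[R]_t) : psd D -> \tr D <= 2 ->
  (\int[P]_w (\tr D - 2 * barrier_rate R * qf (D *m D) (entry_row i w) +
     barrier_rate R ^+ 2 * (qf (D *m D) (entry_row i w) * (1 + qf D (entry_row i w))))%:E
   <= (\tr D - barrier_rate R * \tr (D *m D))%:E)%E.
Proof.
move=> pD trD2; have pDD := psd_sqr pD.
pose h a := g (i, a).
have int4i a : P.-integrable setT (EFin \o (fun w => h a w ^+ 4)) by exact: int4.
have iq E := integrable_quad (mgi i) int4i E.
have iqM E F := integrable_quadM (mgi i) int4i E F.
have mq E := mean_quad (mgi i) (@indi i) int4i (fun a => mean1 _) (fun a => mean2 _) E.
have mqM E F := mean_quadM (mgi i) (@indi i) int4i (fun a => mean1 _) (fun a => mean2 _) (fun a => mean4 _) E F.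
pose q1 := quad h (fun a b => (D *m D) a b); pose q2 := quad h (fun a b => D a b).
have E1 w : \tr D - 2 * barrier_rate R * qf (D *m D) (entry_row i w) +
     barrier_rate R ^+ 2 * (qf (D *m D) (entry_row i w) * (1 + qf D (entry_row i w))) =
   \tr D + ((barrier_rate R ^+ 2 - 2 * barrier_rate R) * q1 w + barrier_rate R ^+ 2 * (q1 w * q2 w)).
  by rewrite !qf_entry_row -/q1 -/q2; ring.
under eq_integral do rewrite E1.
have I2 : P.-integrable setT (EFin \o (fun w => (barrier_rate R ^+ 2 - 2 * barrier_rate R) * q1 w)).
  by apply: integrableZr_real; exact: iq.
have I3 : P.-integrable setT (EFin \o (fun w => barrier_rate R ^+ 2 * (q1 w * q2 w))).
  by apply: integrableZr_real; exact: iqM.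
have I23 := integrableD_real I2 I3.
have I1 : P.-integrable setT (EFin \o (fun=> \tr D)) by exact: finite_measure_integrable_cst.
have IT := integrableD_real I1 I23.
rewrite -[X in (X <= _)%E]fineK; last exact: integrable_fin_num.
rewrite lee_fin -/(Rintegral _ _ _) RintegralD // RintegralD // Rintegral_cst //.
rewrite !RintegralZl //; [|exact: iqM|exact: iq].
rewrite (mq (fun a b => (D *m D) a b)) (mqM (fun a b => (D *m D) a b) (fun a b => D a b)).
have P1 : fine (P [set: T]) = 1 by rewrite probability_setT.
rewrite P1.
have sym : \sum_a \sum_b (D *m D) a b * D b a = \sum_a \sum_b (D *m D) a b * D a b.
  have Ds a b : D b a = D a b by rewrite -{1}pD.1 mxE.
  by apply: eq_bigr => a _; apply: eq_bigr => b _; rewrite Ds.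
rewrite sym -!/(\tr _).
have h1 := psd_sum_le pDD pD.
have h2 : \sum_a (D *m D) a a * D a a <= \tr (D *m D) * \tr D.
  rewrite /mxtrace mulr_suml; apply: ler_sum => a _; rewrite ler_wpM2l //.
    exact: psd_diag.
  rewrite (bigD1 a) //= lerDl; apply: sumr_ge0 => b _; exact: psd_diag.
have h3 : 0 <= \sum_a (D *m D) a a * D a a.
  by apply: sumr_ge0 => a _; rewrite mulr_ge0 //; exact: psd_diag.
have t1 := psd_tr_ge0 pDD; have t2 := psd_tr_ge0 pD.
set x := \tr (D *m D) in h1 h2 t1 *; set y := \tr D in trD2 h1 h2 t2 *.
set S := \sum_a \sum_b _ in h1 *; set S' := \sum_a _ in h2 h3 *.
have xy : x * y <= x * 2 by rewrite ler_wpM2l.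
have m4S : (m4 - 3 * 1 ^+ 2) * S' <= 256 * (x * y).
  apply: (@le_trans _ _ (256 * S')); first by rewrite ler_wpM2r // expr1n; move: m4_le; lra.
  by apply: ler_wpM2l; [exact: ler0n|exact: h2].
rewrite /barrier_rate !expr1n !mul1r; move: m4S; rewrite expr1n.
lra.
Qed.

Definition rat_vec (q : 'cV[rat]_k) : 'cV[R]_k := map_mx ratr q.

(** For some rational vector x, the form A plus the squared projections of the rows in rs
    falls below the barrier, that is below (size rs) barrier_rate |Y x|^2. *)
Definition barrier_fail (rs : seq 'I_s) (A : 'M[R]_k) : set T :=
  [set w | exists q : 'cV[rat]_k, qf A (rat_vec q)
     + \sum_(i <- rs) row_dot i (Y *m rat_vec q) w ^+ 2
     - (size rs)%:R * (barrier_rate R * frob2 (Y *m rat_vec q)) < 0].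

Lemma measurable_row_dot d' (T' : measurableType d') (i : 'I_s) (u : 'cV[R]_t) (f : T' -> T) :
  (forall a, measurable_fun setT (fun z => g (i, a) (f z))) ->
  measurable_fun setT (fun z => row_dot i u (f z)).
Proof.
by move=> mf; apply: measurable_sum => a; apply: measurable_funM => //.
Qed.

Lemma barrier_fail_measurable rs A : measurable (barrier_fail rs A).
Proof.
rewrite (_ : barrier_fail rs A = \bigcup_q [set w | qf A (rat_vec q)
     + \sum_(i <- rs) row_dot i (Y *m rat_vec q) w ^+ 2
     - (size rs)%:R * (barrier_rate R * frob2 (Y *m rat_vec q)) < 0]); last first.
  by apply/seteqP; split=> [w [q wq]|w [q _ wq]]; exists q.
apply: countable_bigcupT_measurable => // q.
rewrite -[X in measurable X]setTI.
apply: (@measurable_fun_ltr _ _ _ setT _ (cst 0)) => //.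
by apply: measurable_funB => //; apply: measurable_funD => //;
  apply: measurable_sum => i; apply: measurable_funX; exact: (@measurable_row_dot _ _ i _ id).
Qed.

(** Induction on the rows, uniform in A.  The first row i is frozen; it changes
    A into A - barrier_rate Y^T Y + h h^T, and the induction hypothesis bounds
    the conditional probability of failure by the new potential, whose mean is
    at most the old one by [barrier_mean] and [barrier_decrement].  If the
    potential exceeds 1 there is nothing to prove. *)
Lemma barrier_failure_le (rs : seq 'I_s) (A : 'M[R]_k) : uniq rs -> pd A ->
  (P (barrier_fail rs A) <= (potential Y A)%:E)%E.
Proof.
elim: rs A => [|i rs IH] A /= urs pA.
  rewrite (_ : barrier_fail [::] A = set0) ?measure0 ?lee_fin ?potential_ge0 //.
  apply/seteqP; split=> // w [q]; rewrite big_nil addr0 mul0r subr0 ltNge.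
  by rewrite (pd_psd pA).2.
move/andP: urs => [irs urs].
(* The bound is at least 1, hence trivial, unless the potential is at most 1. *)
have [le1|gt1] := leP (potential Y A) 1; last first.
  apply: le_trans (probability_le1 P (barrier_fail_measurable _ _)) _.
  by rewrite lee_fin ltW.
pose B := A - barrier_rate R *: (Y^T *m Y).
have qfD (C C' : 'M[R]_k) x : qf (C + C') x = qf C x + qf C' x.
  by rewrite /qf mulmxDr mulmxDl mxE.
have qfB (C C' : 'M[R]_k) c x : qf (C - c *: C') x = qf C x - c * qf C' x.
  by rewrite /qf mulmxBr mulmxBl -scalemxAr -scalemxAl !mxE.
pose A' w := B + (Y^T *m entry_row i w) *m (Y^T *m entry_row i w)^T.
pose D := Y *m invmx B *m Y^T.
have qfA' q w w' : qf A q + (row_dot i (Y *m q) w ^+ 2 + w') - (size rs).+1%:R * (barrier_rate R * frob2 (Y *m q))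
   = qf (A' w) q + w' - (size rs)%:R * (barrier_rate R * frob2 (Y *m q)).
  have -> : qf (A' w) q = qf A q - barrier_rate R * frob2 (Y *m q) + row_dot i (Y *m q) w ^+ 2.
    rewrite /A' qfD qf_gram; congr (_ + _).
      by rewrite /B qfB -[X in Y^T *m X]trmxK qf_gram trmxK.
    rewrite /frob2 !big_ord1 trmx_mul trmxK -mulmxA mxE /row_dot; congr (_ ^+ 2).
    by apply: eq_bigr => a _; rewrite !mxE.
  rewrite -natr1; ring.
(* The entries of row i are frozen; the other rows form the second block. *)
pose S1 : {set 'I_s * 'I_t} := [set x | x.1 == i]%SET.
pose S2 : {set 'I_s * 'I_t} := [set x | x.1 \in rs]%SET.
pose T1 := g_sigma_algebraType (block (real_events g) S1).
pose T2 := g_sigma_algebraType (block (real_events g) S2).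
pose F : set (T1 * T2) := [set z | exists q : 'cV[rat]_k, qf A (rat_vec q)
     + (row_dot i (Y *m rat_vec q) z.1 ^+ 2 + \sum_(j <- rs) row_dot j (Y *m rat_vec q) z.2 ^+ 2)
     - (size rs).+1%:R * (barrier_rate R * frob2 (Y *m rat_vec q)) < 0].
have mF : measurable F.
  rewrite (_ : F = \bigcup_q [set z : T1 * T2 | qf A (rat_vec q)
     + (row_dot i (Y *m rat_vec q) z.1 ^+ 2 + \sum_(j <- rs) row_dot j (Y *m rat_vec q) z.2 ^+ 2)
     - (size rs).+1%:R * (barrier_rate R * frob2 (Y *m rat_vec q)) < 0]); last first.
    by apply/seteqP; split=> [w [q wq]|w [q _ wq]]; exists q.
  apply: countable_bigcupT_measurable => // q.
  rewrite -[X in measurable X]setTI.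
  apply: (@measurable_fun_ltr _ _ _ setT _ (cst 0)) => //.
  apply: measurable_funB => //; apply: measurable_funD => //; apply: measurable_funD.
    apply: measurable_funX; apply: (@measurable_row_dot _ _ i _ (fst : T1 * T2 -> T)) => a.
    apply: (measurableT_comp (f := g (i, a) : T1 -> R) (g := fst)) => //.
    by apply: block_funX; rewrite inE.
  under eq_fun do rewrite big_seq big_mkcond /=.
  apply: measurable_sum => j; have [jrs|//] := boolP (j \in rs).
  apply: measurable_funX; apply: (@measurable_row_dot _ _ j _ (snd : T1 * T2 -> T)) => a.
  apply: (measurableT_comp (f := g (j, a) : T2 -> R) (g := snd)) => //.
  by apply: block_funX; rewrite inE.
have PE (X : set T) : measurable X -> P X = (\int[P]_w (\1_X w)%:E)%E.
  by move=> mX; rewrite integral_indic // setIT.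
have E1 : P (barrier_fail (i :: rs) A) = (\int[P]_w (\1_F (w, w))%:E)%E.
  rewrite PE; last exact: barrier_fail_measurable.
  apply: eq_integral => w _; rewrite !indicE; congr (_%:R%:E).
  congr nat_of_bool; apply/is_true_inj/propext; rewrite !in_setE; split=> -[q H]; exists q; first by move: H; rewrite big_cons.
  by rewrite big_cons.
rewrite E1.
apply: (@le_trans _ _ (\int[P]_w (\tr D - 2 * barrier_rate R * qf (D *m D) (entry_row i w) +
     barrier_rate R ^+ 2 * (qf (D *m D) (entry_row i w) * (1 + qf D (entry_row i w))))%:E)%E); last first.
  apply: le_trans (barrier_mean i (barrier_psd pA le1) (barrier_trace_le2 pA le1)) _.
  rewrite lee_fin; exact: barrier_decrement.
apply: (freezing_block_le ind (real_events_measurable mg) (real_events_setT g)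
  (real_events_setI (g := g)) (A := S1) (B := S2) (f := fun z => (\1_F z)%:E)).
- by move=> x; rewrite !inE => /eqP ->.
- by apply/measurable_EFinP; exact: measurable_indic.
- by move=> z; rewrite lee_fin.
- have mq E : measurable_fun setT (fun w => qf E (entry_row i w)).
    under eq_fun do rewrite qf_entry_row /quad.
    by do 2 (apply: measurable_sum => ?); do 2 (apply: measurable_funM => //).
  apply/measurable_EFinP; apply: measurable_funD.
    by apply: measurable_funB => //; apply: measurable_funM.
  apply: measurable_funM => //; apply: measurable_funM; first exact: mq.
  by apply: measurable_funD => //; exact: mq.
move=> w; have [pA' leA'] := barrier_step pA le1 (entry_row i w).
rewrite (_ : (\int[P]_w' _)%E = P (barrier_fail rs (A' w))); last first.
  rewrite PE; last exact: barrier_fail_measurable.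
  apply: eq_integral => w' _; rewrite !indicE; congr (_%:R%:E).
  congr nat_of_bool; apply/is_true_inj/propext; rewrite !in_setE; split=> -[q H]; exists q; first by rewrite -qfA'.
  by move: H; rewrite /= qfA'.
apply: le_trans (IH _ urs pA') _.
by rewrite lee_fin.
Qed.

Hypothesis Ypd : forall x : 'cV[R]_k, frob2 x <= 2 * frob2 (Y *m x).
Hypothesis s_gt0 : (0 < s)%N.

Let beta : R := s%:R * barrier_rate R / 2.
Let beta0 : 0 < beta.
Proof. by rewrite divr_gt0 // mulr_gt0 ?ltr0n // barrier_rate_gt0. Qed.

Definition embed_fail : set T := barrier_fail (enum 'I_s) (beta *: (Y^T *m Y)).

Let qfZ (C : 'M[R]_k) c x : qf (c *: C) x = c * qf C x.
Proof. by rewrite /qf -scalemxAr -scalemxAl mxE. Qed.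

Let qfY x : qf (Y^T *m Y) x = frob2 (Y *m x).
Proof. by rewrite -[X in Y^T *m X]trmxK qf_gram trmxK. Qed.

Let pd_gram : pd (Y^T *m Y).
Proof.
split=> [|x x0]; first by rewrite trmx_mul trmxK.
rewrite qfY; have := Ypd x; have := frob2_ge0 x.
have : frob2 x != 0 by apply: contra_neq x0 => /frob2_eq0.
move=> h1 h2 h3; have : 0 < frob2 x by rewrite lt_def h1.
lra.
Qed.

Let pd_start : pd (beta *: (Y^T *m Y)).
Proof.
have [St Sp] := pd_gram; split=> [|x x0]; first by rewrite linearZ /= St.
by rewrite qfZ mulr_gt0 // Sp.
Qed.

Lemma embed_fail_measurable : measurable embed_fail.
Proof. exact: barrier_fail_measurable. Qed.

(** The initial matrix is beta Y^T Y with beta = s barrier_rate / 2: its potential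
    is k / beta = 1200 k / s, while the final barrier s barrier_rate Y^T Y
    exceeds it by a factor two. *)
Lemma embed_fail_le : (P embed_fail <= (1200 * k%:R / s%:R)%:E)%E.
Proof.
apply: le_trans (barrier_failure_le (enum_uniq _) pd_start) _.
have uS := pd_unit pd_gram.
rewrite lee_fin /potential invmxZ ?(pd_unit pd_start) //.
rewrite -scalemxAr -scalemxAl mxtraceZ mxtrace_mulC mulmxA mulmxV // mxtrace1.
rewrite /beta /barrier_rate !invfM !invrK.
have s0 : s%:R != 0 :> R by rewrite pnatr_eq0 -lt0n.
by rewrite le_eqVlt; apply/orP; left; apply/eqP; field.
Qed.

(** The barrier s barrier_rate |Y x|^2 minus the initial beta |Y x|^2 leaves
    half of it, and |x|^2 <= 2 |Y x|^2 costs another factor two. *)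
Lemma embed_good w (x : 'cV[R]_k) : ~ embed_fail w ->
  s%:R * barrier_rate R / 4 * frob2 x <= \sum_i row_dot i (Y *m x) w ^+ 2.
Proof.
move=> good.
pose H := beta *: (Y^T *m Y) + \sum_i (Y^T *m entry_row i w) *m (Y^T *m entry_row i w)^T
   - (s%:R * barrier_rate R) *: (Y^T *m Y).
have qfH y : qf H y = qf (beta *: (Y^T *m Y)) y + \sum_(i <- enum 'I_s) row_dot i (Y *m y) w ^+ 2
     - (size (enum 'I_s))%:R * (barrier_rate R * frob2 (Y *m y)).
  rewrite size_enum_ord big_enum /= /H.
  have -> C C' : qf (C - C') y = qf C y - qf C' y.
    by rewrite /qf mulmxBr mulmxBl !mxE.
  have -> C C' : qf (C + C') y = qf C y + qf C' y.
    by rewrite /qf mulmxDr mulmxDl !mxE.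
  rewrite [qf (_ * _ *: _) _]qfZ qfY mulrA; congr (_ + _ - _).
  rewrite /qf mulmx_sumr mulmx_suml summxE; apply: eq_bigr => i _.
  rewrite -/(qf _ _) qf_gram /frob2 !big_ord1 trmx_mul trmxK -mulmxA mxE /row_dot; congr (_ ^+ 2).
  by apply: eq_bigr => a _; rewrite !mxE.
have := @qf_ge0_rat R k H _ x; rewrite qfH size_enum_ord big_enum /= qfZ qfY => /(_ _) h.
have {}h : 0 <= beta * frob2 (Y *m x) + \sum_i row_dot i (Y *m x) w ^+ 2 - s%:R * (barrier_rate R * frob2 (Y *m x)).
  apply: h => q; rewrite leNgt; apply/negP => neg; apply: good; exists q.
  by move: neg; rewrite qfH.
have h2 := Ypd x; have sb : 0 < s%:R * barrier_rate R by rewrite mulr_gt0 ?ltr0n // barrier_rate_gt0.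
move: h; rewrite /beta; set b := s%:R * barrier_rate R in sb *.
rewrite (_ : s%:R * (barrier_rate R * _) = b * frob2 (Y *m x)); last by rewrite /b mulrA.
have : b * frob2 x <= b * (2 * frob2 (Y *m x)) by rewrite ler_pM2l.
lra.
Qed.

End barrier_probability.

(** * Collisions in a sparse embedding *)

Section one_sketch.
Context (R : realType) (d : measure_display) (T : measurableType d).
Context (P : probability T R) (s t m : nat) (D : T -> sketch R s t m).
Hypothesis laws : sketch_laws P D.
Hypothesis indD : mutually_independent P (choice_events D).
Hypotheses (s0 : (0 < s)%N) (t0 : (0 < t)%N).

Definition row_at (j : 'I_m) (a : 'I_t) (w : T) : R := (sk_row (D w) j == a)%:R.
Definition col_sign (j : 'I_m) (w : T) : R := (-1) ^+ sk_neg (D w) j.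
Definition gauss (p : 'I_s * 'I_t) (w : T) : R := sk_normal (D w) p.1 p.2.

Lemma choice_setT x : choice_events D x setT.
Proof. by case: x => [[j|j]|p]; exists setT => //; rewrite preimage_setT setTI. Qed.

Lemma choice_setI x : setI_closed (choice_events D x).
Proof.
by case: x => [[j|j]|p] _ _ [A mA <-] [B mB <-]; exists (A `&` B);
  rewrite ?preimage_setI ?setTI //; exact: measurableI.
Qed.

Lemma row_at_events j a B : choice_events D (inl (inl j)) (row_at j a @^-1` B).
Proof.
exists [set i | B (i == a)%:R] => //; rewrite setTI.
by apply/seteqP; split.
Qed.

Lemma col_sign_events j B : choice_events D (inl (inr j)) (col_sign j @^-1` B).
Proof.
exists [set b : bool | B ((-1) ^+ b)] => //; rewrite setTI.
by apply/seteqP; split.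
Qed.

Lemma gauss_events p B : measurable B -> choice_events D (inr p) (gauss p @^-1` B).
Proof. by move=> mB; exists B => //; rewrite setTI. Qed.

Definition sk_block (A : {set choice_index s t m}) := g_sigma_algebraType (block (choice_events D) A).

Lemma row_at_block (A : {set choice_index s t m}) j a : inl (inl j) \in A ->
  measurable_fun setT (row_at j a : sk_block A -> R).
Proof.
by move=> jA _ B mB; rewrite setTI; apply: sub_sigma_algebra; exists (inl (inl j)) => //; exact: row_at_events.
Qed.

Lemma col_sign_block (A : {set choice_index s t m}) j : inl (inr j) \in A ->
  measurable_fun setT (col_sign j : sk_block A -> R).
Proof.
by move=> jA _ B mB; rewrite setTI; apply: sub_sigma_algebra; exists (inl (inr j)) => //; exact: col_sign_events.
Qed.

Lemma gauss_block (A : {set choice_index s t m}) p : inr p \in A ->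
  measurable_fun setT (gauss p : sk_block A -> R).
Proof.
by move=> jA _ B mB; rewrite setTI; apply: sub_sigma_algebra; exists (inr p) => //; exact: gauss_events.
Qed.

Let mC := choice_measurable laws.

Lemma row_at_measurable j a : measurable_fun setT (row_at j a).
Proof. by move=> _ B mB; rewrite setTI; apply: (mC (x := inl (inl j))); exact: row_at_events. Qed.

Lemma col_sign_measurable j : measurable_fun setT (col_sign j).
Proof. by move=> _ B mB; rewrite setTI; apply: (mC (x := inl (inr j))); exact: col_sign_events. Qed.

Lemma gauss_measurable p : measurable_fun setT (gauss p).
Proof. by move=> _ B mB; rewrite setTI; apply: (mC (x := inr p)); exact: gauss_events. Qed.

Lemma col_sign_ind : mutually_independent P (real_events col_sign).
Proof.
apply: (mutually_independent_sub (h := fun j => inl (inr j))) indD; first by move=> ? ? [].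
by move=> j _ [B _ <-]; rewrite setTI; exact: col_sign_events.
Qed.

Lemma row_at_ind a : mutually_independent P (real_events (fun j => row_at j a)).
Proof.
apply: (mutually_independent_sub (h := fun j => inl (inl j))) indD; first by move=> ? ? [].
by move=> j _ [B _ <-]; rewrite setTI; exact: row_at_events.
Qed.

Lemma gauss_ind : mutually_independent P (real_events gauss).
Proof.
apply: (mutually_independent_sub (h := inr)) indD; first by move=> ? ? [].
by move=> p _ [B mB <-]; rewrite setTI; exact: gauss_events.
Qed.

Lemma col_sign_sqr j w : col_sign j w * col_sign j w = 1.
Proof. by rewrite /col_sign -expr2 sqrr_sign. Qed.

Lemma col_sign_pow4 j w : col_sign j w ^+ 4 = 1.
Proof.
have -> : col_sign j w ^+ 4 = (col_sign j w * col_sign j w) * (col_sign j w * col_sign j w) by ring.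
by rewrite col_sign_sqr mulr1.
Qed.

Lemma col_sign_int4 j : P.-integrable setT (EFin \o (fun w => col_sign j w ^+ 4)).
Proof.
rewrite (_ : _ \o _ = EFin \o cst 1); first exact: finite_measure_integrable_cst.
by apply/funext => w /=; rewrite col_sign_pow4.
Qed.

Let P1 : fine (P [set: T]) = 1. Proof. by rewrite probability_setT. Qed.

Lemma col_sign_mean2 j : \int[P]_w (col_sign j w ^+ 2) = 1.
Proof.
under eq_Rintegral do rewrite expr2 col_sign_sqr.
by rewrite Rintegral_cst // P1 mul1r.
Qed.

Lemma col_sign_mean4 j : \int[P]_w (col_sign j w ^+ 4) = 1.
Proof.
under eq_Rintegral do rewrite col_sign_pow4.
by rewrite Rintegral_cst // P1 mul1r.
Qed.

Lemma Rintegral_indic E : measurable E -> \int[P]_w (\1_E w : R) = fine (P E).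
Proof. by move=> mE; rewrite /Rintegral integral_indic // setIT. Qed.

Lemma integrable_indic_real E : measurable E -> P.-integrable setT (EFin \o (\1_E : T -> R)).
Proof.
move=> mE; apply/integrableP; split; first exact/measurable_EFinP.
under eq_integral do rewrite /= ger0_norm //.
rewrite integral_indic // setIT; apply: le_lt_trans (probability_le1 P mE) _.
by rewrite ltry.
Qed.

Lemma col_sign_mean1 j : \int[P]_w col_sign j w = 0.
Proof.
pose E := [set w | sk_neg (D w) j = true].
have mE : measurable E.
  by apply: (mC (x := inl (inr j))); exists [set true] => //; rewrite setTI.
rewrite (_ : \int[P]_w _ = \int[P]_w (1 + - 2 * \1_E w)); last first.
  apply: eq_Rintegral => w _; rewrite /col_sign indicE.
  case E1: (sk_neg (D w) j); rewrite ?expr1 ?expr0.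
    by rewrite mem_set //= mulr1; ring.
  by rewrite memNset ?mulr0 ?addr0 // /E /= E1.
rewrite RintegralD //; last 2 first.
- exact: finite_measure_integrable_cst.
- by apply: integrableZr_real; exact: integrable_indic_real.
rewrite Rintegral_cst // P1 RintegralZl //; last exact: integrable_indic_real.
by rewrite Rintegral_indic // /E (sign_uniform laws) /=; field.
Qed.

Lemma row_atE j a : row_at j a = \1_[set w | sk_row (D w) j = a].
Proof. by apply/funext => w; rewrite /row_at indicE; case: eqP => E; [rewrite mem_set|rewrite memNset]. Qed.

Lemma row_measurable j a : measurable [set w | sk_row (D w) j = a].
Proof. by apply: (mC (x := inl (inl j))); exists [set a] => //; rewrite setTI. Qed.

Definition collide (j l : 'I_m) (w : T) : R := \sum_a row_at j a w * row_at l a w.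

Lemma collideE j l w : collide j l w = (sk_row (D w) j == sk_row (D w) l)%:R.
Proof.
rewrite /collide /row_at (bigD1 (sk_row (D w) l)) //= eqxx mulr1 big1 ?addr0 // => a.
by rewrite eq_sym => /negbTE ->; rewrite mulr0.
Qed.

(** Whether j and l fall in the same row is a sum over rows of products of
    independent indicators, each of mean 1/t. *)
Lemma collide_mean j l : j != l -> (\int[P]_w (collide j l w)%:E = (t%:R^-1)%:E)%E.
Proof.
move=> jl.
have ia x a : P.-integrable setT (EFin \o row_at x a).
  by rewrite row_atE; apply: integrable_indic_real; exact: row_measurable.
have H a C E : measurable C -> measurable E ->
    P (row_at j a @^-1` C `&` row_at l a @^-1` E) = (P (row_at j a @^-1` C) * P (row_at l a @^-1` E))%E.
  apply: (@block_fun_indep _ _ _ P _ (fun j => row_at j a) _ _ [set j]%SET [set l]%SET).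
  - by move=> x; exact: row_at_measurable.
  - exact: row_at_ind.
  - by move=> i /set1P ->; rewrite !inE.
  - by apply: (@block_funX _ _ _ _ (fun j => row_at j a)); rewrite inE.
  - by apply: (@block_funX _ _ _ _ (fun j => row_at j a)); rewrite inE.
have ip a : P.-integrable setT (EFin \o (fun w => row_at j a w * row_at l a w)).
  exact: (integrable_indep_mul (ia j a) (ia l a) (H a)).
have fin : (\int[P]_w (collide j l w)%:E)%E \is a fin_num.
  by apply: integrable_fin_num => //; exact: integrable_sum_real.
rewrite -[LHS]fineK //; congr EFin; rewrite -/(Rintegral _ _ _) Rintegral_sum //.
have mr x a : \int[P]_w row_at x a w = t%:R^-1.
  by rewrite row_atE Rintegral_indic ?(row_uniform laws) //; exact: row_measurable.
under eq_bigr => a _ do rewrite (Rintegral_indep_mul (ia j a) (ia l a) (H a)) !mr.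
rewrite sumr_const card_ord -[LHS]mulr_natl; field.
by rewrite pnatr_eq0 -lt0n t0.
Qed.

Definition inner n (u z : 'cV[R]_n) : R := \sum_j u j 0 * z j 0.

Definition emb w : 'M[R]_(t, m) := embedding_mx (D w).

Lemma embE w a j : emb w a j = row_at j a w * col_sign j w.
Proof.
rewrite /emb mxE /row_at /col_sign eq_sym.
by case: eqP; rewrite ?mul1r ?mul0r.
Qed.

Definition collision_kernel (u z : 'cV[R]_m) w (j l : 'I_m) : R :=
  (j != l)%:R * (u j 0 * z l 0 * collide j l w).

(** The diagonal terms of <Pi u, Pi z> are exact because signs square to one; the
    rest is a quadratic chaos in the signs, whose kernel records collisions. *)
Lemma emb_inner u z w : inner (emb w *m u) (emb w *m z) = inner u z + quad col_sign (collision_kernel u z w) w.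
Proof.
rewrite /inner /quad.
transitivity (\sum_j \sum_l u j 0 * z l 0 * collide j l w * (col_sign j w * col_sign l w)).
  rewrite /collide.
  under [RHS]eq_bigr => j _.
    under eq_bigr => l _ do rewrite mulr_sumr mulr_suml.
    rewrite exchange_big /=; over.
  rewrite [RHS]exchange_big /=; apply: eq_bigr => a _.
  rewrite !mxE mulr_suml; apply: eq_bigr => j _; rewrite mulr_sumr.
  by apply: eq_bigr => l _; rewrite !embE; ring.
rewrite -big_split /=; apply: eq_bigr => j _.
rewrite (bigD1 j) //= [in RHS](bigD1 j) //= /collision_kernel eqxx !mul0r add0r; congr (_ + _).
  by rewrite collideE eqxx col_sign_sqr !mulr1.
by apply: eq_bigr => l jl; rewrite eq_sym jl mul1r.
Qed.

Lemma collide_ge0 j l w : 0 <= collide j l w.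
Proof. by rewrite collideE. Qed.

Lemma collide_measurable d' (T' : measurableType d') j l (f : T' -> T) :
  (forall j a, measurable_fun setT (fun z => row_at j a (f z))) ->
  measurable_fun setT (fun z => collide j l (f z)).
Proof.
by move=> mf; apply: measurable_sum => a; apply: measurable_funM.
Qed.

Lemma emb_measurable d' (T' : measurableType d') (f : T' -> T) n (u : 'M[R]_(m, n)) a b :
  (forall j a, measurable_fun setT (fun z => row_at j a (f z))) ->
  (forall j, measurable_fun setT (fun z => col_sign j (f z))) ->
  measurable_fun setT (fun z => (emb (f z) *m u) a b).
Proof.
move=> mr ms; under eq_fun do rewrite mxE.
apply: measurable_sum => j; apply: measurable_funM => //.
by under eq_fun do rewrite embE; exact: measurable_funM.
Qed.

Lemma frob2_colE n (u : 'cV[R]_n) : frob2 u = \sum_j u j 0 ^+ 2.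
Proof. by rewrite /frob2; apply: eq_bigr => j _; rewrite big_ord1. Qed.

(** For frozen rows, the second moment of the chaos in the signs is at most
    2 sum_(j != l) u_j^2 z_l^2 [j and l collide]; then collisions have
    probability 1/t. *)
Lemma emb_inner_var (u z : 'cV[R]_m) :
  (\int[P]_w ((inner (emb w *m u) (emb w *m z) - inner u z) ^+ 2)%:E
    <= (2 / t%:R * (frob2 u * frob2 z))%:E)%E.
Proof.
pose A1 : {set choice_index s t m} := [set x | if x is inl (inl _) then true else false]%SET.
pose A2 : {set choice_index s t m} := [set x | if x is inl (inr _) then true else false]%SET.
pose h w := \sum_j \sum_l 2 * ((j != l)%:R * (u j 0 ^+ 2 * z l 0 ^+ 2)) * collide j l w.
have ct w : (inner (emb w *m u) (emb w *m z) - inner u z) ^+ 2 = quad col_sign (collision_kernel u z w) w ^+ 2.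
  by rewrite emb_inner addrAC subrr add0r.
under eq_integral do rewrite ct.
apply: (@le_trans _ _ (\int[P]_w (h w)%:E)%E).
  apply: (freezing_block_le indD mC choice_setT (@choice_setI) (A := A1) (B := A2)
     (f := fun x => (quad col_sign (collision_kernel u z x.1) x.2 ^+ 2)%:E)).
  - by move=> [[j|j]|p]; rewrite !inE.
  - apply/measurable_EFinP; apply: measurable_funX.
    apply: measurable_sum => j; apply: measurable_sum => l.
    apply: measurable_funM.
      apply: measurable_funM => //; apply: measurable_funM => //.
      apply: (@collide_measurable _ (sk_block A1 * sk_block A2)%type j l fst) => j' a.
      apply: (measurableT_comp (f := row_at j' a : sk_block A1 -> R) (g := fst)) => //.
      by apply: row_at_block; rewrite inE.
    apply: measurable_funM.
      apply: (measurableT_comp (f := col_sign j : sk_block A2 -> R) (g := snd)) => //.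
      by apply: col_sign_block; rewrite inE.
    apply: (measurableT_comp (f := col_sign l : sk_block A2 -> R) (g := snd)) => //.
    by apply: col_sign_block; rewrite inE.
  - by move=> x; rewrite lee_fin sqr_ge0.
  - apply/measurable_EFinP; apply: measurable_sum => j; apply: measurable_sum => l.
    by apply: measurable_funM => //; apply: (@collide_measurable _ _ j l id) => *; exact: row_at_measurable.
  move=> w; set E := collision_kernel u z w.
  have iq := integrable_quadM col_sign_measurable col_sign_int4 E E.
  have := mean_quadM col_sign_measurable col_sign_ind col_sign_int4 col_sign_mean1 col_sign_mean2 col_sign_mean4 E E.
  have E0 j : E j j = 0 by rewrite /E /collision_kernel eqxx mul0r.
  have S0 : \sum_j E j j = 0 by rewrite big1.
  have S1 : \sum_j E j j * E j j = 0 by rewrite big1 // => j _; rewrite E0 mul0r.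
  rewrite S0 S1 !mul0r !mulr0 addr0 add0r expr1n mul1r => eqq.
  under eq_integral => w' _ do rewrite expr2.
  rewrite -[X in (X <= _)%E]fineK; last exact: integrable_fin_num.
  rewrite lee_fin -/(Rintegral _ _ _) eqq /h.
  have EE j l : E j l * E j l = (j != l)%:R * (u j 0 ^+ 2 * z l 0 ^+ 2) * collide j l w.
    rewrite /E /collision_kernel collideE; case: (j != l); case: (_ == _); rewrite ?mul0r ?mulr0 ?mul1r ?mulr1 //.
    by ring.
  (* The two off-diagonal pairings are compared by 2 x y <= x^2 + y^2. *)
  have tr : \sum_j \sum_l E j l * E l j <= \sum_j \sum_l E j l * E j l.
    have : \sum_j \sum_l E j l * E l j <= \sum_j \sum_l (E j l * E j l + E l j * E l j) / 2.
      apply: ler_sum => j _; apply: ler_sum => l _; have := sqr_ge0 (E j l - E l j).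
      set x := E j l; set y := E l j.
      have -> : (x - y) ^+ 2 = x * x + y * y - 2 * (x * y) by ring.
      lra.
    move/le_trans; apply.
    under eq_bigr => j _ do rewrite -mulr_suml big_split /=.
    rewrite -mulr_suml big_split /= [X in _ + X]exchange_big /=.
    by set S := \sum_j _; rewrite ler_pdivrMr // mulr_natr.
  rewrite [leRHS](_ : _ = 2 * \sum_j \sum_l E j l * E j l); last first.
    rewrite mulr_sumr; apply: eq_bigr => j _; rewrite mulr_sumr.
    by apply: eq_bigr => l _; rewrite EE [RHS]mulrA.
  by move: tr; set S := \sum_j _; set S' := \sum_j _; lra.
rewrite /h.
under eq_integral => w _.
  rewrite -sumEFin; under eq_bigr => j _ do rewrite -sumEFin.
  over.
have c0 j l : 0 <= 2 * ((j != l)%:R * (u j 0 ^+ 2 * z l 0 ^+ 2)).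
  apply: mulr_ge0; first by []. apply: mulr_ge0; first exact: ler0n. by apply: mulr_ge0; exact: sqr_ge0.
have mcol j l : measurable_fun setT (fun w => (2 * ((j != l)%:R * (u j 0 ^+ 2 * z l 0 ^+ 2)) * collide j l w)%:E).
  apply/measurable_EFinP; apply: measurable_funM => //.
  by apply: (@collide_measurable _ _ j l id) => *; exact: row_at_measurable.
have p0 j l w : (0 <= (2 * ((j != l)%:R * (u j 0 ^+ 2 * z l 0 ^+ 2)) * collide j l w)%:E)%E.
  by rewrite lee_fin mulr_ge0 // collide_ge0.
rewrite ge0_integral_sum //; last 2 first.
- by move=> j; apply: emeasurable_sum => l.
- by move=> j w _; apply: sume_ge0 => l _.
rewrite !frob2_colE mulr_suml mulr_sumr -sumEFin; apply: lee_sum => j _.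
rewrite ge0_integral_sum // mulr_sumr mulr_sumr -sumEFin; apply: lee_sum => l _.
under eq_integral do rewrite EFinM.
rewrite ge0_integralZl //; last 3 first.
- apply/measurable_EFinP; apply: (@collide_measurable _ _ j l id) => *; exact: row_at_measurable.
- by move=> w _; rewrite lee_fin collide_ge0.
- by rewrite lee_fin.
have t0' : 0 < t%:R^-1 :> R by rewrite invr_gt0 ltr0n.
have [->|jl] := eqVneq j l.
  rewrite !mul0r mulr0 mul0e lee_fin; apply: mulr_ge0; last by rewrite mulr_ge0 ?sqr_ge0.
  by rewrite mulr_ge0 // ltW.
rewrite collide_mean // -EFinM lee_fin mul1r le_eqVlt; apply/orP; left; apply/eqP.
ring.
Qed.

End one_sketch.

(** * Bounding means, and norms after a sparse embedding *)

Section mean_bounds.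
Context (R : realType) (d : measure_display) (T : measurableType d).
Context (P : probability T R).
Local Open Scope ereal_scope.

Lemma mean_le_comb (f g : T -> R) (a b F G : R) : (0 <= a)%R -> (0 <= b)%R ->
  measurable_fun setT f -> measurable_fun setT g ->
  (forall w, 0 <= f w)%R -> (forall w, 0 <= g w)%R ->
  \int[P]_w (f w)%:E <= F%:E -> \int[P]_w (g w)%:E <= G%:E ->
  \int[P]_w (a * f w + b * g w)%:E <= (a * F + b * G)%:E.
Proof.
move=> a0 b0 mf mg f0 g0 fF gG.
have mEf : measurable_fun setT (EFin \o f) by exact/measurable_EFinP.
have mEg : measurable_fun setT (EFin \o g) by exact/measurable_EFinP.
under eq_integral do rewrite EFinD !EFinM.
rewrite ge0_integralD //; last 4 first.
- by move=> w _; rewrite -EFinM lee_fin mulr_ge0.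
- by apply: measurable_funeM.
- by move=> w _; rewrite -EFinM lee_fin mulr_ge0.
- by apply: measurable_funeM.
rewrite !ge0_integralZl ?lee_fin //; try by move=> w _; rewrite lee_fin.
by rewrite EFinD !EFinM; apply: leeD; apply: lee_wpmul2l; rewrite ?lee_fin.
Qed.

Lemma mean_mono (f g : T -> R) (G : \bar R) :
  measurable_fun setT f -> measurable_fun setT g ->
  (forall w, 0 <= f w)%R -> (forall w, f w <= g w)%R ->
  \int[P]_w (g w)%:E <= G -> \int[P]_w (f w)%:E <= G.
Proof.
move=> mf mg f0 fg; apply: le_trans; apply: ge0_le_integral => //;
  try exact/measurable_EFinP; move=> w _; rewrite lee_fin //.
Qed.

Lemma mean_cst (c : R) : \int[P]_w c%:E <= c%:E.
Proof. by rewrite integral_cst // [X in (_ * X <= _)%E]probability_setT mule1. Qed.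

Lemma mean_le_sum (I : finType) (f : I -> T -> R) (F : I -> R) :
  (forall i, measurable_fun setT (f i)) -> (forall i w, 0 <= f i w)%R ->
  (forall i, \int[P]_w (f i w)%:E <= (F i)%:E) ->
  \int[P]_w (\sum_i f i w)%R%:E <= (\sum_i F i)%R%:E.
Proof.
move=> mf f0 fF; under eq_integral do rewrite -sumEFin.
rewrite ge0_integral_sum //; first by rewrite -sumEFin; apply: lee_sum => i _.
- by move=> i; exact/measurable_EFinP.
- by move=> i w _; rewrite lee_fin.
Qed.

Lemma markov_mean (f : T -> R) (a F : R) : (0 < a)%R ->
  measurable_fun setT f -> (forall w, 0 <= f w)%R ->
  \int[P]_w (f w)%:E <= F%:E -> P [set w | (a < f w)%R] <= (F / a)%:E.
Proof.
move=> a0 mf f0 fF.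
have mS : measurable [set w | (a < f w)%R].
  by rewrite -[X in measurable X]setTI; exact: measurable_fun_ltr.
rewrite EFinM lee_pdivlMr // muleC.
apply: le_trans fF; rewrite -[X in P X]setIT -integral_indic //.
rewrite -ge0_integralZl //; last 2 first.
- by apply/measurable_EFinP; exact: measurable_indic.
- by rewrite lee_fin ltW.
apply: ge0_le_integral => //.
- by move=> w _; rewrite -EFinM lee_fin mulr_ge0 // ltW.
- by apply: measurable_funeM; apply/measurable_EFinP; exact: measurable_indic.
- by apply/measurable_EFinP.
move=> w _; rewrite -EFinM lee_fin indicE; have [wS|wS] := boolP (w \in _).
  by rewrite mulr1; move: wS; rewrite in_setE /= => /ltW.
by rewrite mulr0.
Qed.

End mean_bounds.

Section one_sketch_moments.
Context (R : realType) (d : measure_display) (T : measurableType d).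
Context (P : probability T R) (s t m : nat) (D : T -> sketch R s t m).
Hypothesis laws : sketch_laws P D.
Hypothesis indD : mutually_independent P (choice_events D).
Hypotheses (s0 : (0 < s)%N) (t0 : (0 < t)%N).

Let mr := row_at_measurable laws.
Let ms := col_sign_measurable laws.
Let mg := gauss_measurable laws.
Lemma inner_frob2 n (u : 'cV[R]_n) : inner u u = frob2 u.
Proof. by rewrite frob2_colE; apply: eq_bigr => j _; rewrite expr2. Qed.

Lemma inner_fun_measurable d' (T' : measurableType d') n (u z : T' -> 'cV[R]_n) :
  (forall a, measurable_fun setT (fun x => u x a 0)) ->
  (forall a, measurable_fun setT (fun x => z x a 0)) ->
  measurable_fun setT (fun x => inner (u x) (z x)).
Proof. by move=> mu mz; apply: measurable_sum => a; apply: measurable_funM. Qed.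

Lemma frob2_fun_measurable d' (T' : measurableType d') n q (u : T' -> 'M[R]_(n, q)) :
  (forall a b, measurable_fun setT (fun x => u x a b)) ->
  measurable_fun setT (fun x => frob2 (u x)).
Proof.
by move=> mu; do 2 (apply: measurable_sum => ?); apply: measurable_funX.
Qed.

Let memb n (u : 'M[R]_(m, n)) a b : measurable_fun setT (fun w => (emb D w *m u) a b).
Proof. exact: (@emb_measurable _ _ _ _ _ _ D _ _ id). Qed.

Let two_t : 2 / t%:R <= 2 :> R.
Proof. by rewrite ler_pdivrMr ?ltr0n // ler_peMr // ler1n. Qed.

(** Compare |Pi u|^2 with |u|^2 by [emb_inner_var] for u = z. *)
Lemma emb_norm4 (u : 'cV[R]_m) :
  (\int[P]_w (frob2 (emb D w *m u) ^+ 2)%:E <= (6 * frob2 u ^+ 2)%:E)%E.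
Proof.
apply: (@mean_mono _ _ _ P _ (fun w => 2 * frob2 u ^+ 2 + 2 * (inner (emb D w *m u) (emb D w *m u) - inner u u) ^+ 2)).
- by apply: measurable_funX; exact: frob2_fun_measurable.
- apply: measurable_funD => //; apply: measurable_funM => //; apply: measurable_funX.
  by apply: measurable_funB => //; exact: inner_fun_measurable.
- by move=> w; rewrite sqr_ge0.
- move=> w; rewrite !inner_frob2; set x := frob2 _; set y := frob2 u.
  have := sqr_ge0 (x - 2 * y); nra.
have H := emb_inner_var laws indD t0 u u.
apply: le_trans (mean_le_comb _ _ _ _ _ _ (mean_cst P (frob2 u ^+ 2)) H) _ => //.
- apply: measurable_funX.
  by apply: measurable_funB => //; exact: inner_fun_measurable.
- by move=> w; rewrite sqr_ge0.
- by move=> w; rewrite sqr_ge0.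
rewrite lee_fin -expr2; have : 2 / t%:R * frob2 u ^+ 2 <= 2 * frob2 u ^+ 2 by rewrite ler_wpM2r ?sqr_ge0.
by lra.
Qed.

(** The inequality 2 x y <= p x^2 + y^2 / p with p = |z|^2 / |u|^2 reduces this
    to [emb_norm4] for u and for z. *)
Lemma emb_norm22 (u z : 'cV[R]_m) :
  (\int[P]_w (frob2 (emb D w *m u) * frob2 (emb D w *m z))%:E <= (6 * (frob2 u * frob2 z))%:E)%E.
Proof.
have frob2_emb0 (x : 'cV[R]_m) : frob2 x = 0 -> forall w, frob2 (emb D w *m x) = 0.
  by move=> /frob2_eq0 -> w; rewrite mulmx0 frob2_0.
have [u0|u0] := eqVneq (frob2 u) 0.
  under eq_integral do rewrite frob2_emb0 // mul0r.
  by rewrite integral_cst // mul0e u0 mul0r mulr0.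
have [z0|z0] := eqVneq (frob2 z) 0.
  under eq_integral do rewrite (frob2_emb0 z) // mulr0.
  by rewrite integral_cst // mul0e z0 mulr0 mulr0.
have pu : 0 < frob2 u by rewrite lt_def u0 frob2_ge0.
have pz : 0 < frob2 z by rewrite lt_def z0 frob2_ge0.
have mf (x : 'cV[R]_m) : measurable_fun setT (fun w => frob2 (emb D w *m x)) by exact: frob2_fun_measurable.
apply: (@mean_mono _ _ _ P _ (fun w => frob2 z / frob2 u / 2 * frob2 (emb D w *m u) ^+ 2 +
   frob2 u / frob2 z / 2 * frob2 (emb D w *m z) ^+ 2)).
- by apply: measurable_funM.
- by apply: measurable_funD; apply: measurable_funM => //; apply: measurable_funX.
- by move=> w; rewrite mulr_ge0 ?frob2_ge0.
- move=> w; set x := frob2 (_ *m u); set y := frob2 (_ *m z).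
  rewrite -subr_ge0.
  have -> : frob2 z / frob2 u / 2 * x ^+ 2 + frob2 u / frob2 z / 2 * y ^+ 2 - x * y
     = (frob2 z * x - frob2 u * y) ^+ 2 / (frob2 u * frob2 z * 2) by field; rewrite z0 u0.
  by rewrite divr_ge0 ?sqr_ge0 // mulr_ge0 // mulr_ge0 // ltW.
apply: le_trans (mean_le_comb _ _ _ _ _ _ (emb_norm4 u) (emb_norm4 z)) _.
- by rewrite divr_ge0 // divr_ge0 // ltW.
- by rewrite divr_ge0 // divr_ge0 // ltW.
- by apply: measurable_funX.
- by apply: measurable_funX.
- by move=> w; rewrite sqr_ge0.
- by move=> w; rewrite sqr_ge0.
rewrite lee_fin le_eqVlt; apply/orP; left; apply/eqP; field.
by rewrite z0 u0.
Qed.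

(** The second moment, and below the fourth, of an entry of the normal matrix.
    They enter only through the bounds [gauss_var_ge] and [gauss_m4_le], since
    the scale of a sketch cancels in the end. *)
Definition gauss_var : R := fine (\int[normal_prob 0 (Num.sqrt s%:R^-1)]_x (x ^+ 2)%:E).
Definition gauss_m4 : R := fine (\int[normal_prob 0 (Num.sqrt s%:R^-1)]_x (x ^+ 4)%:E).

Let sd0 : 0 < Num.sqrt s%:R^-1 :> R.
Proof. by rewrite sqrtr_gt0 invr_gt0 ltr0n. Qed.

Let lawg p B : measurable B -> P [set w | B (gauss D p w)] = normal_prob 0 (Num.sqrt s%:R^-1) B.
Proof. by move=> mB; exact: (entry_normal laws). Qed.

Lemma gauss_int4 p : P.-integrable setT (EFin \o (fun w => gauss D p w ^+ 4)).
Proof. exact: (normal_int4 sd0 (@mg p) (@lawg p)). Qed.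
Lemma gauss_mean1 p : \int[P]_w gauss D p w = 0.
Proof. exact: (normal_mean1 sd0 (@mg p) (@lawg p)). Qed.
Lemma gauss_mean2 p : \int[P]_w (gauss D p w ^+ 2) = gauss_var.
Proof. exact: (normal_mean2E (@mg p) (@lawg p)). Qed.
Lemma gauss_mean4 p : \int[P]_w (gauss D p w ^+ 4) = gauss_m4.
Proof. exact: (normal_mean4E (@mg p) (@lawg p)). Qed.

End one_sketch_moments.

(** * Inner products after a whole sketch *)

Section sketch_moments.
Context (R : realType) (d : measure_display) (T : measurableType d).
Context (P : probability T R) (s t m : nat) (D : T -> sketch R s t m).
Hypothesis laws : sketch_laws P D.
Hypothesis indD : mutually_independent P (choice_events D).
Hypotheses (s0 : (0 < s)%N) (t0 : (0 < t)%N).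

Let mr := row_at_measurable laws.
Let ms := col_sign_measurable laws.
Let mg := gauss_measurable laws.
Let mC := choice_measurable laws.
Let v : R := gauss_var R s.
Let p0 : 'I_s * 'I_t := (Ordinal s0, Ordinal t0).
Let sd0 : 0 < Num.sqrt s%:R^-1 :> R.
Proof. by rewrite sqrtr_gt0 invr_gt0 ltr0n. Qed.
Let sd2 : Num.sqrt s%:R^-1 ^+ 2 = s%:R^-1 :> R.
Proof. by rewrite sqr_sqrtr // invr_ge0 ler0n. Qed.
Let lawg B : measurable B -> P [set w | B (gauss D p0 w)] = normal_prob 0 (Num.sqrt s%:R^-1) B.
Proof. by move=> mB; exact: (entry_normal laws). Qed.

Lemma gauss_var_ge : s%:R^-1 / 2 <= v.
Proof. by rewrite /v -(gauss_mean2 laws p0) -sd2; exact: (normal_mean2_ge sd0 (@mg p0) lawg). Qed.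

Lemma gauss_var_gt0 : 0 < v.
Proof. by apply: lt_le_trans gauss_var_ge; rewrite divr_gt0 // invr_gt0 ltr0n. Qed.

(** The fourth moment is at most 64 sd^4 and the variance at least sd^2 / 2. *)
Lemma gauss_m4_le : gauss_m4 R s <= 256 * v ^+ 2.
Proof.
rewrite -(gauss_mean4 laws p0); apply: le_trans (normal_mean4_le sd0 (@mg p0) lawg) _.
have -> : Num.sqrt s%:R^-1 ^+ 4 = (s%:R^-1) ^+ 2 :> R by rewrite -[in RHS]sd2 -exprM.
have := gauss_var_ge; have : 0 < s%:R^-1 :> R by rewrite invr_gt0 ltr0n.
move: (s%:R^-1) => x x0 xv; have : x ^+ 2 <= (2 * v) ^+ 2.
  by rewrite lerXn2r ?nnegrE; lra.
rewrite exprMn; lra.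
Qed.

Definition gauss_mx w : 'M[R]_(s, t) := sk_normal (D w).

(** The kernel of the quadratic form <G y, G z>: entries of G interact only within a row. *)
Definition gauss_kernel (y z : 'cV[R]_t) (p q : 'I_s * 'I_t) : R :=
  (p.1 == q.1)%:R * (y p.2 0 * z q.2 0).

Lemma sum_gauss_kernel (f : 'I_s * 'I_t -> 'I_s * 'I_t -> R) :
  \sum_p \sum_q (p.1 == q.1)%:R * f p q = \sum_i \sum_a \sum_b f (i, a) (i, b).
Proof.
rewrite [RHS](pair_bigA _ (fun i a => \sum_b f (i, a) (i, b))) /=.
apply: eq_bigr => -[i a] _ /=.
transitivity (\sum_(q : 'I_s * 'I_t) (i == q.1)%:R * f (i, a) (q.1, q.2)).
  by apply: eq_bigr => -[].
rewrite -(pair_bigA _ (fun i' b => (i == i')%:R * f (i, a) (i', b))) /= (bigD1 i) //=.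
rewrite [X in _ + X]big1 ?addr0 => [|i' ii]; last first.
  by rewrite big1 // => b _; rewrite eq_sym (negbTE ii) mul0r.
by apply: eq_bigr => b _; rewrite eqxx mul1r.
Qed.

Lemma gauss_mx_inner y z w : inner (gauss_mx w *m y) (gauss_mx w *m z) = quad (gauss D) (gauss_kernel y z) w.
Proof.
rewrite /quad /inner.
under [RHS]eq_bigr => p _ do under eq_bigr => q _ do rewrite /gauss_kernel -mulrA.
rewrite (sum_gauss_kernel (fun p q => y p.2 0 * z q.2 0 * (gauss D p w * gauss D q w))) /=.
apply: eq_bigr => i _; rewrite !mxE mulr_suml; apply: eq_bigr => a _; rewrite mulr_sumr.
by apply: eq_bigr => b _; rewrite /gauss_mx /gauss /=; ring.
Qed.

(** The three pairings of [mean_quadM] contribute s^2 <y, z>^2, s |y|^2 |z|^2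
    and s <y, z>^2, and the excess of the fourth moment, at most 256 v^2,
    contributes 256 s |y|^2 |z|^2. *)
Lemma gauss_mx_inner_mean (y z : 'cV[R]_t) :
  (\int[P]_w (quad (gauss D) (gauss_kernel y z) w ^+ 2)%:E <=
   (v ^+ 2 * (2 * s%:R ^+ 2 * inner y z ^+ 2 + 257 * s%:R * (frob2 y * frob2 z)))%:E)%E.
Proof.
set E := gauss_kernel y z.
have i4 := gauss_int4 laws s0.
have iq := integrable_quadM mg i4 E E.
have := mean_quadM mg (gauss_ind indD) i4 (gauss_mean1 laws s0) (gauss_mean2 laws) (gauss_mean4 laws) E E.
under eq_integral => w' _ do rewrite expr2.
rewrite -[X in (X <= _)%E]fineK; last exact: integrable_fin_num.
rewrite lee_fin -/(Rintegral _ _ _) => ->.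
have -> : \sum_p E p p = s%:R * inner y z.
  rewrite /E /gauss_kernel -(pair_bigA _ (fun i a => (i == i)%:R * (y a 0 * z a 0))) /=.
  under eq_bigr do under eq_bigr do rewrite eqxx mul1r.
  by rewrite sumr_const card_ord mulr_natl.
have b2 (b : bool) x x' : (b%:R * x) * (b%:R * x') = b%:R * (x * x') :> R.
  by case: b; rewrite ?mul1r ?mul0r.
have -> : \sum_p \sum_q E p q * E p q = s%:R * (frob2 y * frob2 z).
  rewrite /E /gauss_kernel; under eq_bigr do under eq_bigr do rewrite b2.
  rewrite (sum_gauss_kernel (fun p q => y p.2 0 * z q.2 0 * (y p.2 0 * z q.2 0))) /=.
  rewrite sumr_const card_ord -[LHS]mulr_natl !frob2_colE; congr (_ * _).
  rewrite mulr_suml; apply: eq_bigr => a _; rewrite mulr_sumr.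
  by apply: eq_bigr => b _; ring.
have -> : \sum_p \sum_q E p q * E q p = s%:R * inner y z ^+ 2.
  rewrite /E /gauss_kernel; under eq_bigr do under eq_bigr do rewrite [in X in _ * X]eq_sym b2.
  rewrite (sum_gauss_kernel (fun p q => y p.2 0 * z q.2 0 * (y q.2 0 * z p.2 0))) /=.
  rewrite sumr_const card_ord -[LHS]mulr_natl expr2 /inner; congr (_ * _).
  rewrite mulr_suml; apply: eq_bigr => a _; rewrite mulr_sumr.
  by apply: eq_bigr => b _; ring.
have D0 : 0 <= \sum_p E p p * E p p.
  by apply: sumr_ge0 => p _; rewrite -expr2 sqr_ge0.
have DE : \sum_p E p p * E p p <= s%:R * (frob2 y * frob2 z).
  rewrite /E /gauss_kernel -(pair_bigA _ (fun i a => (i == i)%:R * (y a 0 * z a 0) * ((i == i)%:R * (y a 0 * z a 0)))) /=.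
  under eq_bigr do under eq_bigr do rewrite eqxx !mul1r.
  rewrite sumr_const card_ord -[leLHS]mulr_natl ler_wpM2l ?ler0n //.
  rewrite !frob2_colE mulr_suml; apply: ler_sum => a _.
  rewrite (bigD1 a) //= mulrDr -[leLHS]addr0; apply: lerD.
    by rewrite le_eqVlt; apply/orP; left; apply/eqP; ring.
  by rewrite mulr_ge0 ?sqr_ge0 // sumr_ge0 // => b _; rewrite sqr_ge0.
have v2 : 0 <= v ^+ 2 by rewrite sqr_ge0.
have h1 : (gauss_m4 R s - 3 * v ^+ 2) * (\sum_p E p p * E p p) <= 256 * v ^+ 2 * (s%:R * (frob2 y * frob2 z)).
  apply: (@le_trans _ _ (256 * v ^+ 2 * \sum_p E p p * E p p)).
    by rewrite ler_wpM2r //; have := gauss_m4_le; lra.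
  by apply: ler_wpM2l; [apply: mulr_ge0; [exact: ler0n|exact: v2]|exact: DE].
have h2 : v ^+ 2 * (s%:R * inner y z ^+ 2) <= v ^+ 2 * (s%:R ^+ 2 * inner y z ^+ 2).
  rewrite ler_wpM2l // ler_wpM2r ?sqr_ge0 // expr2 ler_peMr ?ler0n //.
  by rewrite ler1n.
apply: le_trans (lerD (lexx _) h1) _; rewrite -/v.
move: h2; set x := inner y z ^+ 2; set q := frob2 y * frob2 z.
have -> : s%:R * inner y z * (s%:R * inner y z) = s%:R ^+ 2 * x by rewrite /x; ring.
set V := v ^+ 2; set S := s%:R : R => h2.
rewrite -subr_ge0.
have -> : V * (2 * S ^+ 2 * x + 257 * S * q) -
  (V * (S ^+ 2 * x + S * q + S * x) + 256 * V * (S * q)) = V * (S ^+ 2 * x) - V * (S * x) by ring.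
by rewrite subr_ge0.
Qed.

Lemma gauss_mx_emb w : sketch_mx (D w) = gauss_mx w *m emb D w.
Proof. by []. Qed.

(** The scale v^2 s^2 is that of the fourth power of the norm of a sketched
    unit vector.  The constants are 4 = 2 * 2 and 1542 = 257 * 6, by
    [gauss_mx_inner_mean], [emb_inner_var] and [emb_norm22]. *)
Definition product_rate : R := v ^+ 2 * s%:R ^+ 2 * (4 / t%:R + 1542 / s%:R).

Let memb n (u : 'M[R]_(m, n)) a b : measurable_fun setT (fun w => (emb D w *m u) a b).
Proof. exact: (@emb_measurable _ _ _ _ _ _ D _ _ id). Qed.

(** Freeze the sparse embedding: [gauss_mx_inner_mean] bounds the conditional second
    moment by <Pi u, Pi z>^2 and |Pi u|^2 |Pi z|^2, whose means are known. *)
Lemma sketch_inner_mean (u z : 'cV[R]_m) : inner u z = 0 ->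
  (\int[P]_w (inner (sketch_mx (D w) *m u) (sketch_mx (D w) *m z) ^+ 2)%:E <=
   (product_rate * (frob2 u * frob2 z))%:E)%E.
Proof.
move=> uz.
pose A1 : {set choice_index s t m} := [set x | if x is inl _ then true else false]%SET.
pose A2 : {set choice_index s t m} := [set x | if x is inr _ then true else false]%SET.
pose f (x : T * T) : R := quad (gauss D) (gauss_kernel (emb D x.1 *m u) (emb D x.1 *m z)) x.2 ^+ 2.
pose h w := v ^+ 2 * (2 * s%:R ^+ 2) * inner (emb D w *m u) (emb D w *m z) ^+ 2
  + v ^+ 2 * (257 * s%:R) * (frob2 (emb D w *m u) * frob2 (emb D w *m z)).
have -> : (\int[P]_w (inner (sketch_mx (D w) *m u) (sketch_mx (D w) *m z) ^+ 2)%:E = \int[P]_w (f (w, w))%:E)%E.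
  by apply: eq_integral => w _; rewrite !gauss_mx_emb -!mulmxA gauss_mx_inner.
have mh1 : measurable_fun setT (fun w => inner (emb D w *m u) (emb D w *m z) ^+ 2).
  by apply: measurable_funX; exact: inner_fun_measurable.
have mh2 : measurable_fun setT (fun w => frob2 (emb D w *m u) * frob2 (emb D w *m z)).
  by apply: measurable_funM; apply: frob2_fun_measurable.
apply: (@le_trans _ _ (\int[P]_w (h w)%:E)%E).
  apply: (freezing_block_le indD mC (choice_setT D) (choice_setI (D := D)) (A := A1) (B := A2)
     (f := fun x => (f x)%:E)).
  - by move=> [[j|j]|p]; rewrite !inE.
  - have me (u' : 'cV[R]_m) a : measurable_fun setT (fun x : sk_block D A1 * sk_block D A2 => (emb D x.1 *m u') a 0).
      apply: (measurableT_comp (f := fun w : sk_block D A1 => (emb D w *m u') a 0) (g := fst)) => //.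
      apply: (@emb_measurable _ _ _ _ _ _ D _ (sk_block D A1) id).
        by move=> j b; apply: row_at_block; rewrite inE.
      by move=> j; apply: col_sign_block; rewrite inE.
    have mG p : measurable_fun setT (fun x : sk_block D A1 * sk_block D A2 => gauss D p x.2).
      apply: (measurableT_comp (f := gauss D p : sk_block D A2 -> R) (g := snd)) => //.
      by apply: gauss_block; rewrite inE.
    apply/measurable_EFinP; apply: measurable_funX.
    apply: measurable_sum => p; apply: measurable_sum => q.
    apply: measurable_funM; last exact: measurable_funM.
    by apply: measurable_funM => //; apply: measurable_funM; exact: me.
  - by move=> x; rewrite lee_fin sqr_ge0.
  - by apply/measurable_EFinP; apply: measurable_funD; apply: measurable_funM.
  - move=> w; apply: le_trans (gauss_mx_inner_mean (emb D w *m u) (emb D w *m z)) _.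
    rewrite lee_fin /h.
    move: (inner _ _) (frob2 _ * _) => x y; rewrite mulrDr.
    by rewrite -!mulrA.
have H1 := emb_inner_var laws indD t0 u z.
have {}H1 : (\int[P]_w (inner (emb D w *m u) (emb D w *m z) ^+ 2)%:E <= (2 / t%:R * (frob2 u * frob2 z))%:E)%E.
  by move: H1; under eq_integral do rewrite uz subr0.
have H2 := emb_norm22 laws indD t0 u z.
apply: le_trans (mean_le_comb _ _ mh1 mh2 _ _ H1 H2) _.
- by apply: mulr_ge0; [exact: sqr_ge0|apply: mulr_ge0; [exact: ler0n|exact: sqr_ge0]].
- by apply: mulr_ge0; [exact: sqr_ge0|apply: mulr_ge0; exact: ler0n].
- by move=> w; rewrite sqr_ge0.
- by move=> w; rewrite mulr_ge0 ?frob2_ge0.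
rewrite lee_fin /product_rate le_eqVlt; apply/orP; left; apply/eqP; field.
by rewrite !pnatr_eq0 -!lt0n t0 s0.
Qed.

End sketch_moments.

(** * A sketch embeds a subspace and approximates products *)

Section sketch_guarantees.
Context (R : realType) (d : measure_display) (T : measurableType d).
Context (P : probability T R) (s t m : nat) (D : T -> sketch R s t m).
Hypothesis laws : sketch_laws P D.
Hypothesis indD : mutually_independent P (choice_events D).
Hypotheses (s0 : (0 < s)%N) (t0 : (0 < t)%N).

Let mr := row_at_measurable laws.
Let ms := col_sign_measurable laws.
Let mg := gauss_measurable laws.
Let mC := choice_measurable laws.
Let v : R := gauss_var R s.
Let v_gt0 : 0 < v. Proof. exact: gauss_var_gt0 laws s0 t0. Qed.

Let memb n (u : 'M[R]_(m, n)) a b : measurable_fun setT (fun w => (emb D w *m u) a b).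
Proof. exact: (@emb_measurable _ _ _ _ _ _ D _ _ id). Qed.

Lemma sketch_mul_measurable d' (T' : measurableType d') (f : T' -> T) n (u : 'M[R]_(m, n)) a b :
  (forall j a, measurable_fun setT (fun z => row_at D j a (f z))) ->
  (forall j, measurable_fun setT (fun z => col_sign D j (f z))) ->
  (forall p, measurable_fun setT (fun z => gauss D p (f z))) ->
  measurable_fun setT (fun z => (sketch_mx (D (f z)) *m u) a b).
Proof.
move=> h1 h2 h3; under eq_fun do rewrite gauss_mx_emb -mulmxA mxE.
apply: measurable_sum => j; apply: measurable_funM; first exact: (h3 (a, j)).
exact: emb_measurable.
Qed.

Lemma inner_mx n k q (A : 'M[R]_(n, k)) (B : 'M[R]_(n, q)) i j :
  (A^T *m B) i j = inner (col i A) (col j B).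
Proof. by rewrite mxE; apply: eq_bigr => a _; rewrite !mxE. Qed.

Lemma mul_col n p k (A : 'M[R]_(n, p)) (B : 'M[R]_(p, k)) j : col j (A *m B) = A *m col j B.
Proof. by apply/colP => i; rewrite !mxE; apply: eq_bigr => a _; rewrite !mxE. Qed.

Lemma sketch_product_measurable d' (T' : measurableType d') (f : T' -> T)
    n q (U : 'M[R]_(m, n)) (W : 'M[R]_(m, q)) a b :
  (forall j a, measurable_fun setT (fun z => row_at D j a (f z))) ->
  (forall j, measurable_fun setT (fun z => col_sign D j (f z))) ->
  (forall p, measurable_fun setT (fun z => gauss D p (f z))) ->
  measurable_fun setT (fun z => ((sketch_mx (D (f z)) *m U)^T *m sketch_mx (D (f z)) *m W) a b).
Proof.
move=> h1 h2 h3; under eq_fun do rewrite -mulmxA mxE.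
apply: measurable_sum => j; apply: measurable_funM; last exact: sketch_mul_measurable.
by under eq_fun do rewrite mxE; exact: sketch_mul_measurable.
Qed.

(** Each entry of the product is an inner product of two sketched orthogonal columns. *)
Lemma sketch_product_mean k q (U : 'M[R]_(m, k)) (W : 'M[R]_(m, q)) : U^T *m W = 0 ->
  (\int[P]_w (frob2 ((sketch_mx (D w) *m U)^T *m sketch_mx (D w) *m W))%:E
    <= (product_rate R s t * (frob2 U * frob2 W))%:E)%E.
Proof.
move=> UW.
have E w : frob2 ((sketch_mx (D w) *m U)^T *m sketch_mx (D w) *m W) =
    \sum_i \sum_j inner (sketch_mx (D w) *m col i U) (sketch_mx (D w) *m col j W) ^+ 2.
  rewrite /frob2; apply: eq_bigr => i _; apply: eq_bigr => j _.
  by rewrite -mulmxA inner_mx !mul_col.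
under eq_integral do rewrite E.
have mS n (u : 'M[R]_(m, n)) a b : measurable_fun setT (fun w => (sketch_mx (D w) *m u) a b).
  exact: (@sketch_mul_measurable _ _ id).
have mI i j : measurable_fun setT (fun w => inner (sketch_mx (D w) *m col i U) (sketch_mx (D w) *m col j W) ^+ 2).
  by apply: measurable_funX; apply: inner_fun_measurable => a.
rewrite (frob2_col U) (frob2_col W) mulr_suml mulr_sumr.
apply: mean_le_sum => [i|i w|i].
- by apply: measurable_sum.
- by apply: sumr_ge0 => j _; rewrite sqr_ge0.
rewrite mulr_sumr mulr_sumr; apply: mean_le_sum => [//|j w|j]; first by rewrite sqr_ge0.
apply: (sketch_inner_mean laws indD s0 t0).
by rewrite -inner_mx UW mxE.
Qed.

Lemma emb_gram_mean k (U : 'M[R]_(m, k)) : U^T *m U = 1%:M ->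
  (\int[P]_w (frob2 ((emb D w *m U)^T *m (emb D w *m U) - 1%:M))%:E
    <= (2 / t%:R * k%:R ^+ 2)%:E)%E.
Proof.
move=> UU.
have E w : frob2 ((emb D w *m U)^T *m (emb D w *m U) - 1%:M) =
    \sum_i \sum_j (inner (emb D w *m col i U) (emb D w *m col j U) - inner (col i U) (col j U)) ^+ 2.
  rewrite /frob2; apply: eq_bigr => i _; apply: eq_bigr => j _.
  by rewrite [in LHS]mxE inner_mx -UU [X in _ + X]mxE inner_mx !mul_col.
under eq_integral do rewrite E.
have mI i j : measurable_fun setT (fun w => (inner (emb D w *m col i U) (emb D w *m col j U) - inner (col i U) (col j U)) ^+ 2).
  by apply: measurable_funX; apply: measurable_funB => //; apply: inner_fun_measurable => a.
have UE : frob2 U = k%:R by rewrite -frob2_tr frob2E trmxK UU mxtrace1.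
rewrite expr2 -{1}UE -UE (frob2_col U) mulr_suml mulr_sumr.
apply: mean_le_sum => [i|i w|i].
- by apply: measurable_sum.
- by apply: sumr_ge0 => j _; rewrite sqr_ge0.
rewrite mulr_sumr mulr_sumr; apply: mean_le_sum => [//|j w|j]; first by rewrite sqr_ge0.
exact: (emb_inner_var laws indD t0).
Qed.

Definition gram_fail k (U : 'M[R]_(m, k)) : set T :=
  [set w | 4^-1 < frob2 ((emb D w *m U)^T *m (emb D w *m U) - 1%:M)].

Lemma gram_fail_le k (U : 'M[R]_(m, k)) : U^T *m U = 1%:M ->
  (P (gram_fail U) <= (8 * k%:R ^+ 2 / t%:R)%:E)%E.
Proof.
move=> UU; apply: le_trans (markov_mean _ _ _ (emb_gram_mean UU)) _ => //.
- apply: frob2_fun_measurable => a b; under eq_fun do rewrite mxE.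
  apply: measurable_funD => //; under eq_fun do rewrite inner_mx.
  by apply: inner_fun_measurable => a'; under eq_fun do rewrite mxE; exact: memb.
- by move=> w; exact: frob2_ge0.
rewrite lee_fin le_eqVlt; apply/orP; left; apply/eqP; field.
by rewrite pnatr_eq0 -lt0n.
Qed.

(** Let H = (Pi U)^T (Pi U) - 1, of norm at most 1/2.  Then
    |x|^2 - |Pi U x|^2 = - x^T H x <= |x|^2 / 2. *)
Lemma gram_good k (U : 'M[R]_(m, k)) w (x : 'cV[R]_k) : ~ gram_fail U w ->
  frob2 x <= 2 * frob2 (emb D w *m U *m x).
Proof.
rewrite /gram_fail /= => /negP; rewrite -leNgt.
set Y := emb D w *m U => h.
have e : frob2 x - frob2 (Y *m x) = - (x^T *m ((Y^T *m Y - 1%:M) *m x)) 0 0.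
  rewrite mulmxBl mulmxBr mul1mx.
  have E n (z : 'cV[R]_n) : frob2 z = (z^T *m z) 0 0.
    by rewrite -frob2_tr frob2E /mxtrace big_ord1 trmxK.
  rewrite !E trmx_mul !mulmxA; move: (_ *m x) (_ *m x) => a b.
  by rewrite !mxE opprD opprK addrC.
have := frob2_ip x ((Y^T *m Y - 1%:M) *m x); set b := (_ *m _) 0 0 => hb.
have hm : frob2 ((Y^T *m Y - 1%:M) *m x) <= 4^-1 * frob2 x.
  apply: (@le_trans _ _ (frob2 (Y^T *m Y - 1%:M) * frob2 x)); last by rewrite ler_wpM2r ?frob2_ge0.
  rewrite /frob2 mulr_suml; apply: ler_sum => i _; rewrite big_ord1 mxE.
  apply: le_trans (cauchy_schwarz_sum _ _) _.
  by rewrite le_eqVlt; apply/orP; left; apply/eqP; congr (_ * _); apply: eq_bigr => j _; rewrite big_ord1.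
have x0 := frob2_ge0 x.
have hb2 : b ^+ 2 <= (frob2 x / 2) ^+ 2.
  apply: le_trans hb _; apply: le_trans (ler_wpM2l x0 hm) _.
  by rewrite le_eqVlt; apply/orP; left; apply/eqP; field.
have hb3 : - b <= frob2 x / 2.
  have [b0|b0] := leP 0 (- b); last by apply: le_trans (ltW b0) _; rewrite divr_ge0.
  by rewrite -(@ler_pXn2r _ 2) ?nnegrE ?divr_ge0 // sqrrN.
move: e; rewrite -/b; lra.
Qed.

Let ghat (p : 'I_s * 'I_t) (w : T) : R := (Num.sqrt v)^-1 * gauss D p w.

Let v2 : (Num.sqrt v)^-1 ^+ 2 = v^-1.
Proof. by rewrite exprVn sqr_sqrtr // ltW. Qed.

Let mgh p : measurable_fun setT (ghat p).
Proof. exact: measurable_funM. Qed.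

Let ghat_ind : mutually_independent P (real_events ghat).
Proof.
apply: (mutually_independent_sub (h := inr)) indD; first by move=> ? ? [].
move=> p _ [B mB <-]; exists ((fun x => (Num.sqrt v)^-1 * x) @^-1` B) => //.
rewrite -[X in measurable X]setTI; apply: (measurable_funM (f := cst _) (g := id)) => //.
Qed.

Let ghat4 p w : ghat p w ^+ 4 = v^-1 ^+ 2 * gauss D p w ^+ 4.
Proof. by rewrite /ghat exprMn -v2 -exprM. Qed.

Let ghat_int4 p : P.-integrable setT (EFin \o (fun w => ghat p w ^+ 4)).
Proof.
rewrite (_ : (fun w => _) = (fun w => v^-1 ^+ 2 * gauss D p w ^+ 4)); last first.
  by apply/funext => w; rewrite ghat4.
by apply: integrableZr_real; exact: gauss_int4 laws s0 p.
Qed.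

Let ghat_mean1 p : \int[P]_w ghat p w = 0.
Proof.
have i4 : forall p, P.-integrable setT (EFin \o (fun w => gauss D p w ^+ 4)) by exact: gauss_int4.
by rewrite /ghat RintegralZl ?gauss_mean1 ?mulr0 //; exact: (integrable_id mg i4).
Qed.

Let ghat_mean2 p : \int[P]_w (ghat p w ^+ 2) = 1.
Proof.
have i4 : forall p, P.-integrable setT (EFin \o (fun w => gauss D p w ^+ 4)) by exact: gauss_int4.
under eq_Rintegral do rewrite /ghat exprMn v2.
by rewrite RintegralZl ?gauss_mean2 //; [rewrite mulVf // gt_eqF|exact: (integrable_sqr mg i4)].
Qed.

Let ghat_mean4 p : \int[P]_w (ghat p w ^+ 4) = v^-1 ^+ 2 * gauss_m4 R s.
Proof.
under eq_Rintegral do rewrite ghat4.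
by rewrite RintegralZl ?gauss_mean4 //; exact: (gauss_int4 laws s0).
Qed.

Let m4_le : v^-1 ^+ 2 * gauss_m4 R s <= 256.
Proof.
have h := gauss_m4_le laws s0 t0; rewrite exprVn mulrC ler_pdivrMr ?exprn_gt0 //.
Qed.

(** The factor by which a good sketch may shrink squared lengths: v s is their
    mean growth, and 2400 = 4 * 600 comes from [embed_good]. *)
Definition embed_rate : R := v * s%:R / 2400.

Definition embedding_fail k (U : 'M[R]_(m, k)) : set T :=
  [set w | exists q : 'cV[rat]_k,
     frob2 (sketch_mx (D w) *m U *m map_mx ratr q) < embed_rate * frob2 (map_mx ratr q : 'cV[R]_k)].

Lemma embedding_good k (U : 'M[R]_(m, k)) w (x : 'cV[R]_k) : ~ embedding_fail U w ->
  embed_rate * frob2 x <= frob2 (sketch_mx (D w) *m U *m x).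
Proof.
move=> good; pose S := sketch_mx (D w) *m U.
have qfE y : qf (S^T *m S - embed_rate%:M) y = frob2 (S *m y) - embed_rate * frob2 y.
  rewrite /qf mulmxBr mulmxBl [LHS]mxE; congr (_ + _).
    by rewrite -/(qf _ _) -[X in X *m S]trmxK -[X in _ *m X]trmxK trmxK qf_gram trmxK.
  rewrite mxE mul_mx_scalar -scalemxAl mxE; congr (- (_ * _)).
  by rewrite -frob2_tr frob2E trmxK /mxtrace big_ord1.
rewrite -subr_ge0 -qfE; apply: qf_ge0_rat => q; rewrite qfE subr_ge0 leNgt.
by apply/negP => h; apply: good; exists q.
Qed.

Lemma embedding_fail_measurable k (U : 'M[R]_(m, k)) : measurable (embedding_fail U).
Proof.
rewrite (_ : embedding_fail U = \bigcup_q [set w | frob2 (sketch_mx (D w) *m U *m map_mx ratr q) < embed_rate * frob2 (map_mx ratr q : 'cV[R]_k)]); last first.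
  by apply/seteqP; split=> [w [q wq]|w [q _ wq]]; exists q.
apply: countable_bigcupT_measurable => // q.
rewrite -[X in measurable X]setTI.
apply: (@measurable_fun_ltr _ _ _ setT _ (cst _)) => //.
apply: frob2_fun_measurable => a b; under eq_fun do rewrite -mulmxA.
exact: (@sketch_mul_measurable _ _ id).
Qed.

(** Either the sparse embedding already distorts the basis, which is [gram_fail],
    or it is frozen, and the rows of the normal matrix, divided by their
    standard deviation, are used in the barrier argument with Y = Pi U. *)
Lemma embedding_fail_le k (U : 'M[R]_(m, k)) : U^T *m U = 1%:M ->
  (P (embedding_fail U) <= (8 * k%:R ^+ 2 / t%:R + 1200 * k%:R / s%:R)%:E)%E.
Proof.
move=> UU.
pose A1 : {set choice_index s t m} := [set x | if x is inl _ then true else false]%SET.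
pose A2 : {set choice_index s t m} := [set x | if x is inr _ then true else false]%SET.
pose F : set (sk_block D A1 * sk_block D A2) :=
  [set z | frob2 ((emb D z.1 *m U)^T *m (emb D z.1 *m U) - 1%:M) <= 4^-1] `&`
  [set z | exists q : 'cV[rat]_k,
     frob2 (gauss_mx D z.2 *m (emb D z.1 *m (U *m map_mx ratr q))) < embed_rate * frob2 (map_mx ratr q : 'cV[R]_k)].
have me n (u : 'M[R]_(m, n)) a b : measurable_fun setT (fun z : sk_block D A1 * sk_block D A2 => (emb D z.1 *m u) a b).
  apply: (measurableT_comp (f := fun w : sk_block D A1 => (emb D w *m u) a b) (g := fst)) => //.
  apply: (@emb_measurable _ _ _ _ _ _ D _ (sk_block D A1) id).
    by move=> j a'; apply: row_at_block; rewrite inE.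
  by move=> j; apply: col_sign_block; rewrite inE.
have mG p : measurable_fun setT (fun z : sk_block D A1 * sk_block D A2 => gauss D p z.2).
  apply: (measurableT_comp (f := gauss D p : sk_block D A2 -> R) (g := snd)) => //.
  by apply: gauss_block; rewrite inE.
have mF : measurable F.
  apply: measurableI.
    rewrite -[X in measurable X]setTI; apply: measurable_fun_ler => //.
    apply: frob2_fun_measurable => a b; under eq_fun do rewrite mxE.
    apply: measurable_funD => //; under eq_fun do rewrite inner_mx.
    by apply: inner_fun_measurable => a'; under eq_fun do rewrite mxE; exact: me.
  rewrite (_ : [set z | _] = \bigcup_q [set z | frob2 (gauss_mx D z.2 *m (emb D z.1 *m (U *m map_mx ratr q))) < embed_rate * frob2 (map_mx ratr q : 'cV[R]_k)]); last first.
    by apply/seteqP; split=> [w [q wq]|w [q _ wq]]; exists q.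
  apply: countable_bigcupT_measurable => // q.
  rewrite -[X in measurable X]setTI.
  apply: (@measurable_fun_ltr _ _ _ setT _ (cst _)) => //.
  apply: frob2_fun_measurable => a b; under eq_fun do rewrite mxE.
  by apply: measurable_sum => j; apply: measurable_funM; [exact: (mG (a, j))|exact: me].
have mgf : measurable (gram_fail U).
  rewrite -[X in measurable X]setTI; apply: measurable_fun_ltr => //.
  apply: frob2_fun_measurable => a b; under eq_fun do rewrite mxE.
  apply: measurable_funD => //; under eq_fun do rewrite inner_mx.
  by apply: inner_fun_measurable => a'; under eq_fun do rewrite mxE; exact: memb.
have mE := embedding_fail_measurable U.
apply: (@le_trans _ _ (P (gram_fail U) + P (embedding_fail U `\` gram_fail U))%E).
  apply: (@le_trans _ _ (P (gram_fail U `|` (embedding_fail U `\` gram_fail U)))).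
    apply: le_measure; rewrite ?inE //.
      by apply: measurableU => //; exact: measurableD.
    by move=> w Ew; have [?|?] := pselect (gram_fail U w); [left|right].
  by apply: measureU2 => //; exact: measurableD.
rewrite EFinD; apply: leeD; first exact: gram_fail_le.
have PE (X : set T) : measurable X -> P X = (\int[P]_w (\1_X w)%:E)%E.
  by move=> mX; rewrite integral_indic // setIT.
have -> : P (embedding_fail U `\` gram_fail U) = (\int[P]_w (\1_F (w, w))%:E)%E.
  rewrite PE; last exact: measurableD.
  apply: eq_integral => w _; rewrite !indicE; congr (_%:R%:E).
  congr nat_of_bool; apply/is_true_inj/propext; rewrite !in_setE.
  rewrite /F /embedding_fail /gram_fail /=; split.
    move=> [[q h] /negP]; rewrite -leNgt => h2; split=> //; exists q.
    by move: h; rewrite gauss_mx_emb -!mulmxA.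
  move=> [h2 [q h]]; split; last by apply/negP; rewrite -leNgt.
  by exists q; rewrite gauss_mx_emb -!mulmxA.
apply: le_trans (mean_cst P _).
apply: (freezing_block_le indD mC (choice_setT D) (choice_setI (D := D)) (A := A1) (B := A2)
     (f := fun x => (\1_F x)%:E)).
- by move=> [[j|j]|p]; rewrite !inE.
- by apply/measurable_EFinP; exact: measurable_indic.
- by move=> z; rewrite lee_fin.
- exact: measurable_cst.
move=> w; have [bad|good] := pselect (gram_fail U w).
  have c0 : 0 <= 1200 * k%:R / s%:R :> R.
    by apply: divr_ge0; [apply: mulr_ge0; exact: ler0n|exact: ler0n].
  rewrite integral0_eq; first by rewrite lee_fin.
  move=> w' _.
  rewrite indicE memNset // => -[/= h _]; move: bad; rewrite /gram_fail /=.
  by rewrite ltNge h.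
pose Y := emb D w *m U.
have Ypd (x : 'cV[R]_k) : frob2 x <= 2 * frob2 (Y *m x) by exact: (gram_good x good).
have := embed_fail_le mgh ghat_ind ghat_int4 ghat_mean1 ghat_mean2 ghat_mean4 m4_le Ypd s0.
apply: le_trans; have mf := embed_fail_measurable mgh Y.
rewrite PE //; apply: ge0_le_integral => //.
- apply/measurable_EFinP.
  apply: (measurableT_comp (f := \1_F : _ -> R) (g := fun w' : T => ((w, w') : sk_block D A1 * sk_block D A2))).
    exact: measurable_indic.
  by apply: measurable_fun_pair; [exact: measurable_cst|exact: (measurable_id_block mC)].
- by apply/measurable_EFinP; exact: measurable_indic.
move=> w' _; rewrite lee_fin !indicE ler_nat.
have [h|//] := boolP ((w, w') \in F); rewrite mem_set //.
move: h; rewrite in_setE => -[/= _ [q h]].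
apply: contrapT => gd; have := embed_good Ypd s0 (map_mx ratr q) gd.
apply/negP; rewrite -ltNge.
have -> : \sum_i row_dot ghat i (Y *m map_mx ratr q) w' ^+ 2 = v^-1 * frob2 (gauss_mx D w' *m (emb D w *m (U *m map_mx ratr q))).
  rewrite frob2_colE mulr_sumr; apply: eq_bigr => i _; rewrite -v2 -exprMn; congr (_ ^+ 2).
  rewrite /row_dot mxE mulr_sumr; apply: eq_bigr => a _; rewrite -mulmxA mulrA; congr (_ * _).
have iv : 0 < v^-1 by rewrite invr_gt0.
rewrite -(ltr_pM2l v_gt0) mulrA mulfV ?(gt_eqF v_gt0) // mul1r; apply: lt_le_trans h _.
by rewrite /embed_rate /barrier_rate le_eqVlt; apply/orP; left; apply/eqP; field.
Qed.

End sketch_guarantees.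

(** * Failure probabilities for one and for two sketches *)

Section one_sketch_failures.
Context (R : realType) (d : measure_display) (T : measurableType d).
Context (P : probability T R) (s t m : nat) (D : T -> sketch R s t m).
Hypothesis laws : sketch_laws P D.
Hypothesis indD : mutually_independent P (choice_events D).
Hypotheses (s0 : (0 < s)%N) (t0 : (0 < t)%N).

Let mr := row_at_measurable laws.
Let ms := col_sign_measurable laws.
Let mg := gauss_measurable laws.

(** The mean squared norm of a product, in units of [embed_rate] squared; this is
    the form in which products enter the error bound. *)
Definition fail_rate (s t : nat) : R := 2400 ^+ 2 * (4 / t%:R + 1542 / s%:R).

Lemma embed_rate_gt0 : 0 < embed_rate R s.
Proof.
rewrite /embed_rate; have := gauss_var_gt0 laws s0 t0; move: (gauss_var R s) => v v0.
apply: divr_gt0; last by rewrite ltr0n.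
by apply: mulr_gt0; rewrite ?ltr0n.
Qed.

Lemma product_rateE : product_rate R s t = embed_rate R s ^+ 2 * fail_rate s t.
Proof.
rewrite /product_rate /embed_rate /fail_rate; by move: (4 / t%:R + _) => x; field.
Qed.

Lemma fail_rate_ge0 (s' t' : nat) : 0 <= fail_rate s' t'.
Proof.
rewrite /fail_rate; apply: mulr_ge0; first exact: sqr_ge0.
by apply: addr_ge0; apply: divr_ge0; rewrite ler0n.
Qed.

Lemma frob2_orthonormal k (U : 'M[R]_(m, k)) : U^T *m U = 1%:M -> frob2 U = k%:R.
Proof. by move=> UU; rewrite -frob2_tr frob2E trmxK UU mxtrace1. Qed.

Definition product_fail k q (U : 'M[R]_(m, k)) (W : 'M[R]_(m, q)) (b : R) : set T :=
  [set w | embed_rate R s ^+ 2 * b < frob2 ((sketch_mx (D w) *m U)^T *m sketch_mx (D w) *m W)].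

Lemma product_fail_measurable k q (U : 'M[R]_(m, k)) (W : 'M[R]_(m, q)) b :
  measurable (product_fail U W b).
Proof.
rewrite -[X in measurable X]setTI; apply: measurable_fun_ltr => //.
by apply: frob2_fun_measurable => i j; exact: (@sketch_product_measurable _ _ _ _ _ _ D _ _ id).
Qed.

(** Markov when F > 0; when F = 0 the matrix W vanishes and there is no failure,
    since the inequality in [product_fail] is strict. *)
Lemma product_fail_le k q (U : 'M[R]_(m, k)) (W : 'M[R]_(m, q)) (e F : R) : 0 < e ->
  U^T *m U = 1%:M -> U^T *m W = 0 -> frob2 W <= F ->
  (P (product_fail U W (e * F)) <= (fail_rate s t * k%:R / e)%:E)%E.
Proof.
move=> e0 UU UW WF; have [F0|F0] := leP F 0.
  rewrite (_ : product_fail _ _ _ = set0) ?measure0; last first.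
    rewrite -subset0 => w; rewrite /product_fail /=.
    have -> : W = 0 by apply/frob2_eq0/le_anti; rewrite frob2_ge0 (le_trans WF).
    rewrite mulmx0 frob2_0 ltNge => /negP; apply.
    rewrite (_ : F = 0) ?mulr0 //; apply/le_anti; rewrite F0 /=.
    exact: le_trans (frob2_ge0 W) WF.
  rewrite lee_fin; apply: divr_ge0; last exact: ltW.
  by apply: mulr_ge0; rewrite ?fail_rate_ge0 ?ler0n.
have h := sketch_product_mean laws indD s0 t0 UW.
have er := embed_rate_gt0.
apply: le_trans (markov_mean _ _ _ h) _.
- by apply: mulr_gt0; [exact: exprn_gt0|exact: mulr_gt0].
- by apply: frob2_fun_measurable => i j; exact: (@sketch_product_measurable _ _ _ _ _ _ D _ _ id).
- by move=> w; exact: frob2_ge0.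
rewrite lee_fin product_rateE (frob2_orthonormal UU); have := fail_rate_ge0 s t.
move: (embed_rate R s) er (fail_rate s t) => r r0 f f0.
rewrite ler_pdivrMr; last by rewrite mulr_gt0 ?exprn_gt0 // mulr_gt0.
have -> : f * k%:R / e * (r ^+ 2 * (e * F)) = r ^+ 2 * f * (k%:R * F).
  by field; rewrite gt_eqF.
apply: ler_wpM2l; first by rewrite mulr_ge0 // sqr_ge0.
by rewrite ler_wpM2l ?ler0n.
Qed.

End one_sketch_failures.

Section two_sketches.
Context (R : realType) (d : measure_display) (T : measurableType d).
Context (P : probability T R) (s t m s' t' n : nat).
Context (DM : T -> sketch R s t m) (DN : T -> sketch R s' t' n).
Hypothesis indep : independent_sketches P DM DN.
Hypotheses (s0 : (0 < s)%N) (t0 : (0 < t)%N) (s0' : (0 < s')%N) (t0' : (0 < t')%N).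

Let lawsM : sketch_laws P DM. Proof. by case: indep. Qed.
Let lawsN : sketch_laws P DN. Proof. by case: indep. Qed.
Let family (x : choice_index s t m + choice_index s' t' n) : set_system T :=
  match x with inl y => choice_events DM y | inr y => choice_events DN y end.
Let indF : mutually_independent P family. Proof. by case: indep. Qed.
Let indM : mutually_independent P (choice_events DM).
Proof.
apply: (mutually_independent_sub (h := inl)) indF; first by move=> ? ? [].
by move=> x E.
Qed.
Let indN : mutually_independent P (choice_events DN).
Proof.
apply: (mutually_independent_sub (h := inr)) indF; first by move=> ? ? [].
by move=> x E.
Qed.
Let mF x : family x `<=` measurable.
Proof. by case: x => y; [exact: (choice_measurable lawsM)|exact: (choice_measurable lawsN)]. Qed.
Let FT x : family x setT.
Proof. by case: x => y; exact: choice_setT. Qed.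
Let FI x : setI_closed (family x).
Proof. by case: x => y; exact: choice_setI. Qed.

Let mrM := row_at_measurable lawsM.
Let msM := col_sign_measurable lawsM.
Let mgM := gauss_measurable lawsM.
Let mrN := row_at_measurable lawsN.
Let msN := col_sign_measurable lawsN.
Let mgN := gauss_measurable lawsN.

Let A1 : {set choice_index s t m + choice_index s' t' n} := [set x | if x is inl _ then true else false]%SET.
Let A2 : {set choice_index s t m + choice_index s' t' n} := [set x | if x is inr _ then true else false]%SET.
Let T1 := g_sigma_algebraType (block family A1).
Let T2 := g_sigma_algebraType (block family A2).

Let block_inl y E : choice_events DM y E -> (<<s block family A1 >>) E.
Proof. by move=> h; apply: sub_sigma_algebra; exists (inl y) => //=; rewrite inE. Qed.
Let block_inr y E : choice_events DN y E -> (<<s block family A2 >>) E.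
Proof. by move=> h; apply: sub_sigma_algebra; exists (inr y) => //=; rewrite inE. Qed.

(** The product for the term of the error that involves both sketches; the first
    outcome drives the sketch of M and the second that of N. *)
Definition core_product k k' (U : 'M[R]_(m, k)) (V : 'M[R]_(n, k')) (W : 'M[R]_(m, n)) (w w' : T) : 'M[R]_(k', k) :=
  (sketch_mx (DN w') *m V)^T *m sketch_mx (DN w') *m ((sketch_mx (DM w) *m U)^T *m sketch_mx (DM w) *m W)^T.

Let core_measurable d' (T' : measurableType d') (f f' : T' -> T) k k' (U : 'M[R]_(m, k)) (V : 'M[R]_(n, k')) W a b :
  (forall j a, measurable_fun setT (fun z => row_at DM j a (f z))) ->
  (forall j, measurable_fun setT (fun z => col_sign DM j (f z))) ->
  (forall p, measurable_fun setT (fun z => gauss DM p (f z))) ->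
  (forall j a, measurable_fun setT (fun z => row_at DN j a (f' z))) ->
  (forall j, measurable_fun setT (fun z => col_sign DN j (f' z))) ->
  (forall p, measurable_fun setT (fun z => gauss DN p (f' z))) ->
  measurable_fun setT (fun z => core_product U V W (f z) (f' z) a b).
Proof.
move=> h1 h2 h3 h1' h2' h3'; under eq_fun do rewrite /core_product mxE.
apply: measurable_sum => j; apply: measurable_funM; last first.
  by under eq_fun do rewrite mxE; exact: sketch_product_measurable.
have E z : (sketch_mx (DN (f' z)) *m V)^T *m sketch_mx (DN (f' z)) =
    (sketch_mx (DN (f' z)) *m V)^T *m sketch_mx (DN (f' z)) *m 1%:M by rewrite mulmx1.
by under eq_fun do rewrite E; exact: sketch_product_measurable.
Qed.

(** Freeze the sketch of M.  Then the other sketch multiplies a fixed matrix whose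
    columns are orthogonal to V, and [sketch_product_mean] applies twice. *)
Lemma core_product_mean k k' (U : 'M[R]_(m, k)) (V : 'M[R]_(n, k')) (W : 'M[R]_(m, n)) :
  U^T *m W = 0 -> W *m V = 0 ->
  (\int[P]_w (frob2 (core_product U V W w w))%:E
    <= (product_rate R s' t' * frob2 V * (product_rate R s t * (frob2 U * frob2 W)))%:E)%E.
Proof.
move=> UW WV.
pose X w := (sketch_mx (DM w) *m U)^T *m sketch_mx (DM w) *m W.
have mX : measurable_fun setT (fun w => frob2 (X w)).
  by apply: frob2_fun_measurable => a b; exact: (@sketch_product_measurable _ _ _ _ _ _ DM _ _ id).
have sk0 : 0 <= product_rate R s' t' * frob2 V.
  apply: mulr_ge0; last exact: frob2_ge0.
  rewrite product_rateE; apply: mulr_ge0; first exact: sqr_ge0.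
  exact: fail_rate_ge0.
apply: (@le_trans _ _ (\int[P]_w (product_rate R s' t' * frob2 V * frob2 (X w))%:E)%E).
  apply: (freezing_block_le indF mF FT FI (A := A1) (B := A2)
     (f := fun x => (frob2 (core_product U V W x.1 x.2))%:E)).
  - by move=> [x|x]; rewrite !inE.
  - apply/measurable_EFinP; apply: frob2_fun_measurable => a b.
    apply: (@core_measurable _ (T1 * T2)%type fst snd).
    + move=> j c; apply: (measurableT_comp (f := row_at DM j c : T1 -> R) (g := fst)) => //.
      by move=> _ B mB; rewrite setTI; exact: block_inl (row_at_events _ _ _ _).
    + move=> j; apply: (measurableT_comp (f := col_sign DM j : T1 -> R) (g := fst)) => //.
      by move=> _ B mB; rewrite setTI; exact: block_inl (col_sign_events _ _ _).
    + move=> p; apply: (measurableT_comp (f := gauss DM p : T1 -> R) (g := fst)) => //.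
      by move=> _ B mB; rewrite setTI; exact: block_inl (gauss_events _ _ mB).
    + move=> j c; apply: (measurableT_comp (f := row_at DN j c : T2 -> R) (g := snd)) => //.
      by move=> _ B mB; rewrite setTI; exact: block_inr (row_at_events _ _ _ _).
    + move=> j; apply: (measurableT_comp (f := col_sign DN j : T2 -> R) (g := snd)) => //.
      by move=> _ B mB; rewrite setTI; exact: block_inr (col_sign_events _ _ _).
    + move=> p; apply: (measurableT_comp (f := gauss DN p : T2 -> R) (g := snd)) => //.
      by move=> _ B mB; rewrite setTI; exact: block_inr (gauss_events _ _ mB).
  - by move=> x; rewrite lee_fin frob2_ge0.
  - by apply/measurable_EFinP; apply: measurable_funM.
  move=> w; have VX : V^T *m (X w)^T = 0.
    by rewrite -trmx_mul /X -[_ *m W *m V]mulmxA WV mulmx0 trmx0.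
  have := sketch_product_mean lawsN indN s0' t0' VX.
  by rewrite frob2_tr mulrA.
under eq_integral do rewrite EFinM.
rewrite ge0_integralZl ?lee_fin //; last 2 first.
- exact/measurable_EFinP.
- by move=> w _; rewrite lee_fin frob2_ge0.
rewrite [X in (_ <= X)%E]EFinM; apply: lee_wpmul2l; first by rewrite lee_fin.
exact: (sketch_product_mean lawsM indM s0 t0 UW).
Qed.

Definition core_fail k k' (U : 'M[R]_(m, k)) (V : 'M[R]_(n, k')) (W : 'M[R]_(m, n)) (b : R) : set T :=
  [set w | embed_rate R s' ^+ 2 * (embed_rate R s ^+ 2 * b) < frob2 (core_product U V W w w)].

Let core_measurable_id k k' (U : 'M[R]_(m, k)) (V : 'M[R]_(n, k')) W :
  measurable_fun setT (fun w => frob2 (core_product U V W w w)).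
Proof. by apply: frob2_fun_measurable => a b; exact: (@core_measurable _ _ id id). Qed.

Lemma core_fail_measurable k k' (U : 'M[R]_(m, k)) (V : 'M[R]_(n, k')) W b :
  measurable (core_fail U V W b).
Proof. by rewrite -[X in measurable X]setTI; apply: measurable_fun_ltr. Qed.

Lemma core_fail_le k k' (U : 'M[R]_(m, k)) (V : 'M[R]_(n, k')) (W : 'M[R]_(m, n)) (e F : R) :
  0 < e -> U^T *m U = 1%:M -> V^T *m V = 1%:M -> U^T *m W = 0 -> W *m V = 0 ->
  frob2 W <= F ->
  (P (core_fail U V W (e * F)) <=
    (fail_rate R s t * k%:R * (fail_rate R s' t' * k'%:R) / e)%:E)%E.
Proof.
move=> e0 UU VV UW WV WF.
have fr : 0 <= fail_rate R s t * k%:R * (fail_rate R s' t' * k'%:R).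
  by apply: mulr_ge0; apply: mulr_ge0; rewrite ?fail_rate_ge0 ?ler0n.
have [F0|F0] := leP F 0.
  rewrite (_ : core_fail _ _ _ _ = set0) ?measure0.
    by rewrite lee_fin; apply: divr_ge0 => //; exact: ltW.
  rewrite -subset0 => w; rewrite /core_fail /core_product /=.
  have -> : W = 0 by apply/frob2_eq0/le_anti; rewrite frob2_ge0 (le_trans WF).
  rewrite mulmx0 trmx0 mulmx0 frob2_0 ltNge => /negP; apply.
  rewrite (_ : F = 0) ?mulr0 //; apply/le_anti; rewrite F0 /=.
  exact: le_trans (frob2_ge0 W) WF.
have erM := embed_rate_gt0 lawsM s0 t0; have erN := embed_rate_gt0 lawsN s0' t0'.
have den : 0 < embed_rate R s' ^+ 2 * (embed_rate R s ^+ 2 * (e * F)).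
  apply: mulr_gt0; first exact: exprn_gt0.
  by apply: mulr_gt0; [exact: exprn_gt0|exact: mulr_gt0].
apply: le_trans (markov_mean den _ _ (core_product_mean UW WV)) _.
- exact: core_measurable_id.
- by move=> w; exact: frob2_ge0.
rewrite lee_fin !product_rateE (frob2_orthonormal UU) (frob2_orthonormal VV).
have := fail_rate_ge0 R s t; have := fail_rate_ge0 R s' t'; move: den {fr}.
move: (embed_rate R s) erM (embed_rate R s') erN (fail_rate R s t) (fail_rate R s' t').
move=> r r0 r' r0' f f' den f0' f0; rewrite ler_pdivrMr //.
have -> : f * k%:R * (f' * k'%:R) / e * (r' ^+ 2 * (r ^+ 2 * (e * F))) =
  r' ^+ 2 * f' * k'%:R * (r ^+ 2 * f * (k%:R * F)) by field; rewrite gt_eqF.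
have q0 (x y : R) : 0 <= y -> 0 <= x ^+ 2 * y by move=> y0; rewrite mulr_ge0 ?sqr_ge0.
apply: ler_wpM2l; first by rewrite mulr_ge0 ?ler0n // q0.
apply: ler_wpM2l; first by rewrite q0.
by rewrite ler_wpM2l ?ler0n.
Qed.

End two_sketches.

(** * Sketch sizes and the probability of success *)

(** With L = floor (c/eps) + 1, which lies between c/eps and 2 c/eps, take
    t = B (L + c^2) and s = B L for an integer B of order 1/delta.  The
    factors 5 and 9 anticipate five failure events of probability delta/5
    each, and the factor 9 of [sketched_regression_le]. *)
Lemma sketch_sizes (R : realType) (delta : R) : 0 < delta ->
  exists2 C : R, 1 <= C & forall (eps : R) (c : nat), 0 < eps < 1 -> (0 < c)%N ->
  exists t s : nat, [/\ (0 < t)%N, (0 < s)%N,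
    t%:R <= C * (c%:R / eps + c%:R ^+ 2) & s%:R <= C * (c%:R / eps)] /\
    8 * c%:R ^+ 2 / t%:R + 1200 * c%:R / s%:R <= delta / 5 /\
    fail_rate R s t * c%:R <= delta / 5 * (eps / 9).
Proof.
move=> d0; have [a aE a1] : exists2 a : R, a = 2400 ^+ 2 * 1546 & 1208 <= a * 9.
  by exists (2400 ^+ 2 * 1546) => //; lra.
have [B B1 aB] : exists2 B : nat, (0 < B)%N & a * 9 / B%:R <= delta / 5.
  exists (Num.truncn (a * 9 / (delta / 5))).+1 => //.
  have /andP[_ h] : (Num.truncn (a * 9 / (delta / 5)))%:R <= a * 9 / (delta / 5)
      < (Num.truncn (a * 9 / (delta / 5))).+1%:R.
    apply: truncn_itv; apply: divr_ge0; first by lra.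
    by apply: divr_ge0 => //; exact: ltW.
  rewrite ler_pdivrMr ?ltr0n // [leRHS]mulrC -ler_pdivrMr; first exact: ltW.
  by apply: divr_gt0; rewrite ?ltr0n.
have B0 : 0 < B%:R :> R by rewrite ltr0n.
have B1' : 1 <= B%:R :> R by rewrite ler1n.
exists (2 * B%:R) => [|eps c /andP[e0 e1] c0]; first by lra.
have c1 : 1 <= c%:R :> R by rewrite ler1n.
have ce : c%:R <= c%:R / eps :> R.
  by rewrite ler_pdivlMr // ler_piMr // ltW.
pose L := (Num.truncn (c%:R / eps : R)).+1.
have /andP[L1 L2] : (Num.truncn (c%:R / eps : R))%:R <= c%:R / eps < L%:R.
  by apply: truncn_itv; apply: divr_ge0; rewrite ?ler0n ?ltW.
have LR : L%:R = (Num.truncn (c%:R / eps : R))%:R + 1 :> R by rewrite /L -natr1.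
have Lc : c%:R <= L%:R :> R by clear aB a1; lra.
have L0 : 0 < L%:R :> R by clear aB a1; lra.
have Le : L%:R <= 2 * (c%:R / eps) :> R by clear aB a1; lra.
have c2 : 0 < c%:R ^+ 2 :> R by apply: exprn_gt0; rewrite ltr0n.
exists (B * (L + c ^ 2))%N, (B * L)%N.
have tE : (B * (L + c ^ 2))%:R = B%:R * (L%:R + c%:R ^+ 2) :> R by rewrite natrM natrD natrX.
have sE : (B * L)%:R = B%:R * L%:R :> R by rewrite natrM.
rewrite /fail_rate tE sE; split; first split.
- by rewrite muln_gt0 B1 addn_gt0.
- by rewrite muln_gt0 B1.
- rewrite -mulrA mulrCA ler_pM2l // mulrDr; apply: lerD => //; clear -c2; lra.
- by rewrite -mulrA mulrCA ler_pM2l.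
have tL : (B%:R * (L%:R + c%:R ^+ 2))^-1 <= (B%:R * L%:R)^-1 :> R.
  rewrite lef_pV2 ?posrE ?mulr_gt0 ?addr_gt0 // ler_pM2l // lerDl; exact: ltW.
have tc : (B%:R * (L%:R + c%:R ^+ 2))^-1 <= (B%:R * c%:R ^+ 2)^-1 :> R.
  rewrite lef_pV2 ?posrE; first by rewrite ler_pM2l // lerDr; exact: ltW.
    by apply: mulr_gt0 => //; exact: addr_gt0.
  exact: mulr_gt0.
have cL : c%:R / (B%:R * L%:R) <= B%:R^-1 :> R.
  by rewrite invfM mulrCA ler_piMr ?invr_ge0 ?ler0n // ler_pdivrMr // mul1r.
split.
  apply: le_trans aB; apply: (@le_trans _ _ (8 * B%:R^-1 + 1200 * B%:R^-1)).
    apply: lerD; last by rewrite -mulrA ler_pM2l ?ltr0n.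
    rewrite -mulrA ler_pM2l ?ltr0n // -ler_pdivlMl //.
    by rewrite -invfM [X in _ <= X^-1]mulrC.
  rewrite -mulrDl ler_pM2r ?invr_gt0 //; move: a1; lra.
have h : 4 / (B%:R * (L%:R + c%:R ^+ 2)) + 1542 / (B%:R * L%:R) <= 1546 / (B%:R * L%:R) :> R.
  move: tL; set x := _^-1; set y := (B%:R * L%:R)^-1; lra.
rewrite mulrA ler_pdivlMr ?ltr0n //.
apply: (@le_trans _ _ (a * 9 / B%:R * eps)); last by rewrite ler_pM2r.
have b0 : 0 < 2400 ^+ 2 :> R by apply: exprn_gt0; rewrite ltr0n.
have z0 : 0 <= 1546 :> R by exact: ler0n.
clear a1 aB; rewrite aE; move: (2400 ^+ 2) b0 (1546 : R) z0 (4 / _ + _) h => b b0 z z0 W Wz.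
apply: (@le_trans _ _ (b * (z / (B%:R * L%:R)) * c%:R * 9)).
  by rewrite ler_pM2r ?ltr0n // ler_wpM2r ?ler0n // ler_pM2l.
have -> : b * (z / (B%:R * L%:R)) * c%:R * 9 = b * z * 9 / B%:R * (c%:R / L%:R).
  by field; rewrite !gt_eqF.
apply: ler_wpM2l.
  apply: divr_ge0; last exact: ler0n.
  by apply: mulr_ge0; [apply: mulr_ge0 => //; exact: ltW|exact: ler0n].
rewrite ler_pdivrMr // mulrC -ler_pdivrMr //; exact: ltW.
Qed.

Section success.
Context (R : realType) (d : measure_display) (T : measurableType d).
Context (P : probability T R) (s t m s' t' n c r : nat).
Context (DM : T -> sketch R s t m) (DN : T -> sketch R s' t' n).
Hypothesis indep : independent_sketches P DM DN.
Hypotheses (s0 : (0 < s)%N) (t0 : (0 < t)%N) (s0' : (0 < s')%N) (t0' : (0 < t')%N).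
Variables (A : 'M[R]_(m, n)) (M : 'M[R]_(m, c)) (N : 'M[R]_(r, n)) (delta e : R).
Hypotheses (d01 : 0 < delta < 1) (e01 : 0 < e <= 1).
Hypothesis embM : 8 * c%:R ^+ 2 / t%:R + 1200 * c%:R / s%:R <= delta / 5.
Hypothesis embN : 8 * r%:R ^+ 2 / t'%:R + 1200 * r%:R / s'%:R <= delta / 5.
Hypothesis rateM : fail_rate R s t * c%:R <= delta / 5 * e.
Hypothesis rateN : fail_rate R s' t' * r%:R <= delta / 5 * e.

Let R0 := A - M *m (mpinv M *m A *m mpinv N) *m N.

(** Outside five bad events, two on embeddings and three on products, the
    hypotheses of [sketched_regression_le] hold. *)
Lemma sketched_regression_success : exists bad : set T,
  [/\ measurable bad, (P bad <= delta%:E)%E & forall w, ~ bad w ->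
    frob2 (A - M *m Xhat A M N (sketch_mx (DM w)) (sketch_mx (DN w)) *m N)
      <= (1 + 9 * e) * frob2 R0].
Proof.
have [lawsM lawsN indF] := indep; move/andP: e01 => [e0 e1]; move/andP: d01 => [d0 d1].
have indM : mutually_independent P (choice_events DM).
  apply: (mutually_independent_sub (h := inl)) indF; first by move=> ? ? [].
  by move=> x E.
have indN : mutually_independent P (choice_events DN).
  apply: (mutually_independent_sub (h := inr)) indF; first by move=> ? ? [].
  by move=> x E.
have [k [U [kc UU UM]]] := orthonormal_basis M.
have [k' [V [kr VV VN]]] := orthonormal_basis N^T.
have kcR : k%:R <= c%:R :> R by rewrite ler_nat.
have krR : k'%:R <= r%:R :> R by rewrite ler_nat.
pose L := res_left A U V; pose Rt := res_right A U V; pose B := res_both A U V.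
pose bads := [:: embedding_fail DM U; embedding_fail DN V;
  product_fail DM U L (e * frob2 R0); product_fail DN V Rt (e * frob2 R0);
  core_fail DM DN U V B (e * frob2 R0)].
have mb i : measurable (nth set0 bads i).
  case: i => [|[|[|[|[|i]]]]] /=; last by rewrite nth_nil.
  - exact: (embedding_fail_measurable lawsM).
  - exact: (embedding_fail_measurable lawsN).
  - exact: (product_fail_measurable lawsM).
  - exact: (product_fail_measurable lawsN).
  - exact: (core_fail_measurable indep).
have emb_mono (x y s1 t1 : nat) : (x <= y)%N -> 8 * y%:R ^+ 2 / t1%:R + 1200 * y%:R / s1%:R <= delta / 5 ->
    8 * x%:R ^+ 2 / t1%:R + 1200 * x%:R / s1%:R <= delta / 5 :> R.
  move=> xy; apply: le_trans; have xyR : x%:R <= y%:R :> R by rewrite ler_nat.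
  apply: lerD; apply: ler_wpM2r; rewrite ?invr_ge0 ?ler0n //; apply: ler_wpM2l; rewrite ?ler0n //.
  by rewrite lerXn2r ?nnegrE ?ler0n.
have rM : fail_rate R s t * k%:R <= delta / 5 * e.
  by apply: le_trans rateM; apply: ler_wpM2l => //; exact: fail_rate_ge0.
have rN : fail_rate R s' t' * k'%:R <= delta / 5 * e.
  by apply: le_trans rateN; apply: ler_wpM2l => //; exact: fail_rate_ge0.
have rM0 : 0 <= fail_rate R s t * k%:R by apply: mulr_ge0; [exact: fail_rate_ge0|exact: ler0n].
have rN0 : 0 <= fail_rate R s' t' * k'%:R by apply: mulr_ge0; [exact: fail_rate_ge0|exact: ler0n].
have Pb i : (i < 5)%N -> (P (nth set0 bads i) <= (delta / 5)%:E)%E.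
  case: i => [|[|[|[|[|i]]]]] //= _.
  - apply: le_trans (embedding_fail_le lawsM indM s0 t0 UU) _; rewrite lee_fin.
    exact: emb_mono embM.
  - apply: le_trans (embedding_fail_le lawsN indN s0' t0' VV) _; rewrite lee_fin.
    exact: emb_mono embN.
  - apply: le_trans (product_fail_le lawsM indM s0 t0 e0 UU _ _) _.
    + exact: basis_res_left.
    + exact: (frob2_res_left _ UU UM VV VN).
    + by rewrite lee_fin ler_pdivrMr.
  - apply: le_trans (product_fail_le lawsN indN s0' t0' e0 VV _ _) _.
    + exact: basis_res_right.
    + exact: (frob2_res_right _ UU UM VV VN).
    + by rewrite lee_fin ler_pdivrMr.
  - apply: le_trans (core_fail_le indep s0 t0 s0' t0' e0 UU VV _ _ _) _.
    + exact: basis_res_both.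
    + exact: res_both_basis.
    + exact: (frob2_res_both _ UU UM VV VN).
    rewrite lee_fin ler_pdivrMr //; apply: (@le_trans _ _ (delta / 5 * e * 1)); last by rewrite mulr1.
    apply: ler_pM => //; apply: le_trans rN _.
    apply: (@le_trans _ _ (1 * e)); last by rewrite mul1r.
    rewrite ler_pM2r // ler_pdivrMr ?ltr0n // mul1r.
    by apply: le_trans (ltW d1) _; rewrite ler1n.
exists (\big[setU/set0]_(i < 5) nth set0 bads i); split.
- by apply: bigsetU_measurable => i _.
- apply: le_trans (Boole_inequality P (n := 5%N) (fun i _ => mb i)) _.
  apply: (@le_trans _ _ (\sum_(i < 5) (delta / 5)%:E)%E).
    by apply: lee_sum => i _; exact: Pb.
  rewrite sumEFin lee_fin sumr_const card_ord -[leLHS]mulr_natr mulfVK ?lexx //.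
move=> w good; have gd i : (i < 5)%N -> ~ nth set0 bads i w.
  move=> i5 h; apply: good; rewrite (bigD1 (Ordinal i5)) //=; left; exact: h.
apply: (sketched_regression_le UU UM VV VN (embed_rate_gt0 lawsM s0 t0) (embed_rate_gt0 lawsN s0' t0')).
- by move=> x; exact: (embedding_good x (gd 0%N isT)).
- by move=> x; exact: (embedding_good x (gd 1%N isT)).
- by rewrite leNgt; apply/negP; exact: (gd 2%N isT).
- by rewrite leNgt; apply/negP; exact: (gd 3%N isT).
- by rewrite leNgt; apply/negP; exact: (gd 4%N isT).
Qed.

End success.

(** * One step of the column recursion for pseudoinverses *)

Section greville.
Context (R : realType) (s c : nat).

(** Let Y have pseudoinverse Z and let e be a unit vector with Y e = 0 and
    e^T Z = 0; adding a e^T puts the column a in the empty position e.  If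
    the component q of a orthogonal to the columns of Y is nonzero then
    b = q^T / |q|^2 reads off the new coordinate; otherwise a = Y d, and b
    spreads a over d and e so as to minimize the norm.  The dimensions
    never change, so that one set of registers serves all steps. *)
Lemma greville_step (Y : 'M[R]_(s, c)) (Z : 'M[R]_(c, s)) (e : 'cV[R]_c)
    (a : 'cV[R]_s) (b : 'rV[R]_s) :
  let d := Z *m a in
  let q := a - Y *m d in
  penrose Y Z -> e^T *m e = 1%:M -> Y *m e = 0 -> e^T *m Z = 0 ->
  (if (q^T *m q) 0 0 == 0 then b = (1 + (d^T *m d) 0 0)^-1 *: (d^T *m Z)
   else b = ((q^T *m q) 0 0)^-1 *: q^T) ->
  penrose (Y + a *m e^T) (Z + (e - d) *m b).
Proof.
move=> d q [YZY ZYZ sYZ sZY] ee Ye eZ hb.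
have ed : e^T *m d = 0 by rewrite /d mulmxA eZ mul0mx.
have ZYd : Z *m Y *m d = d by rewrite /d mulmxA ZYZ.
have YZa : Y *m Z *m a = Y *m d by rewrite /d mulmxA.
have eeb : e^T *m (e - d) = 1%:M by rewrite mulmxBr ee ed subr0.
have qY : q^T *m Y = 0.
  rewrite /q linearB /= mulmxBl -YZa trmx_mul sYZ -(mulmxA a^T) YZY.
  by rewrite subrr.
have aq : a = q + Y *m d by rewrite subrK.
have YZ' : (Y + a *m e^T) *m (Z + (e - d) *m b) = Y *m Z + q *m b.
  rewrite mulmxDl !mulmxDr -(mulmxA a) eZ mulmx0 add0r.
  rewrite -(mulmxA a) (mulmxA e^T) eeb mul1mx mulmxA mulmxBr Ye sub0r mulNmx.
  by rewrite /q mulmxBl -!addrA; congr (_ + _); rewrite addrC.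
have sq x : x^T = x -> ((e - d) *m x *m (e - d)^T)^T = (e - d) *m x *m (e - d)^T.
  by move=> xs; rewrite !trmx_mul trmxK xs mulmxA.
move: hb; case: ifPn => [/eqP q0|q0] hb.
- have qz : q = 0.
    apply/matrixP => i j; rewrite ord1 [RHS]mxE; apply/eqP; rewrite -sqrf_eq0.
    move/eqP: q0; rewrite mxE psumr_eq0 => [/allP/(_ i)|k _].
      by rewrite mem_index_enum mxE expr2; exact.
    by rewrite mxE -expr2 sqr_ge0.
  have aYd : a = Y *m d by rewrite aq qz add0r.
  set w := 1 + _ in hb.
  have w0 : w != 0.
    rewrite gt_eqF // /w ltr_wpDr // mxE sumr_ge0 // => i _.
    by rewrite mxE -expr2 sqr_ge0.
  have dZY : d^T *m Z *m Y = d^T.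
    by rewrite -mulmxA -sZY -trmx_mul ZYd.
  have bY : b *m Y = w^-1 *: d^T by rewrite hb -scalemxAl dZY.
  have ba : b *m a = 1%:M - w^-1%:M.
    rewrite aYd mulmxA bY -scalemxAl [d^T *m d]mx11_scalar.
    rewrite (_ : (d^T *m d) 0 0 = w - 1); last by rewrite /w addrC addKr.
    by rewrite scale_scalar_mx mulrBr mulVf // mulr1 raddfB.
  have bYZ : b *m (Y *m Z) = b.
    by rewrite hb -scalemxAl -mulmxA (mulmxA Z) ZYZ.
  have ZY' : (Z + (e - d) *m b) *m (Y + a *m e^T) =
      Z *m Y + e *m e^T - w^-1 *: ((e - d) *m (e - d)^T).
    have fe : d *m e^T + (e - d) *m e^T = e *m e^T.
      by rewrite -mulmxDl addrC subrK.
    rewrite mulmxDl !mulmxDr mulmxA -/d -(mulmxA _ b Y) bY.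
    have et : (e - d)^T = e^T - d^T by rewrite linearB.
    rewrite mulmxA -(mulmxA _ b a) ba -fe et.
    move: (e - d) => f; rewrite !mulmxBr mulmx1 mul_mx_scalar mulmxBl.
    rewrite scalerBr -!scalemxAr -!scalemxAl opprB -!addrA; congr (_ + (_ + _)).
    by rewrite addrC -addrA; congr (_ + _); rewrite addrC.
  split.
  + rewrite YZ' qz mul0mx addr0 mulmxDr YZY; congr (_ + _).
    by rewrite mulmxA YZa -aYd.
  + rewrite -mulmxA YZ' qz mul0mx addr0 mulmxDl [Z *m _]mulmxA ZYZ; congr (_ + _).
    by rewrite -mulmxA bYZ.
  + by rewrite YZ' qz mul0mx addr0.
  + rewrite ZY'; move: (e - d) => f.
    have sff (x : 'cV[R]_c) : (x *m x^T)^T = x *m x^T by rewrite trmx_mul trmxK.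
    have trB (A B : 'M[R]_c) : (A - B)^T = A^T - B^T by rewrite linearB.
    have trD (A B : 'M[R]_c) : (A + B)^T = A^T + B^T by rewrite linearD.
    have trZ (x : R) (A : 'M[R]_c) : (x *: A)^T = x *: A^T by rewrite linearZ.
    by rewrite trB trD trZ !sff sZY.
- have ba : b *m a = 1%:M.
    have qa : q^T *m a = q^T *m q by rewrite aq mulmxDr mulmxA qY mul0mx addr0.
    by rewrite hb -scalemxAl qa {2}[q^T *m q]mx11_scalar scale_scalar_mx mulVf.
  have bY : b *m Y = 0 by rewrite hb -scalemxAl qY scaler0.
  have ZY' : (Z + (e - d) *m b) *m (Y + a *m e^T) = Z *m Y + e *m e^T.
    rewrite mulmxDl !mulmxDr mulmxA -/d -(mulmxA _ b Y) bY mulmx0 add0r.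
    rewrite mulmxA -(mulmxA _ b a) ba mulmx1 mulmxBl -addrA; congr (_ + _).
    by rewrite addrC subrK.
  split.
  + rewrite YZ' mulmxDl !mulmxDr YZY -(mulmxA q b Y) bY mulmx0 add0r.
    rewrite (mulmxA _ a) YZa (mulmxA (q *m b)) -(mulmxA q b a) ba mulmx1.
    by rewrite -addrA -mulmxDl [_ + q]addrC -aq.
  + rewrite ZY' mulmxDl !mulmxDr ZYZ -(mulmxA e e^T Z) eZ mulmx0 add0r.
    rewrite -addrA; congr (_ + _).
    rewrite !mulmxA -(mulmxA e e^T) eeb mulmx1 mulmxBr -(mulmxA Z Y e) Ye mulmx0 ZYd.
    by rewrite sub0r -mulmxDl addrC.
  + have trD (A B : 'M[R]_s) : (A + B)^T = A^T + B^T by rewrite linearD.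
    have trZ (x : R) (A : 'M[R]_s) : (x *: A)^T = x *: A^T by rewrite linearZ.
    by rewrite YZ' trD sYZ hb -scalemxAr trZ trmx_mul trmxK.
  + by rewrite ZY' linearD /= sZY trmx_mul trmxK.
Qed.

End greville.

(** * Programs with cost-counting specifications *)

Section programs.
Context (R : realType) (Q D : Type) (answer : D -> Type) (c r : nat).
Variables (fetch : Q -> R) (inspect : forall q : D, answer q).

Local Notation tr := (tree Q answer c r).

(** A program passes its result and the number of registers used so far to the
    rest of the tree, so that programs can name the registers they create. *)
Definition prog (X : Type) := (X -> nat -> tr) -> nat -> tr.

Definition ret (X : Type) (x : X) : prog X := fun k n => k x n.
Definition bind (X Y : Type) (p : prog X) (f : X -> prog Y) : prog Y :=
  fun k n => p (fun x n' => f x k n') n.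
Definition op_const (z : int) : prog nat := fun k n => Const z (k n n.+1).
Definition op_arith (o : arith) (i j : nat) : prog nat :=
  fun k n => Arith o i j (k n n.+1).
Definition op_le (i j : nat) : prog bool :=
  fun k n => IfLe i j (k true n) (k false n).
Definition op_fetch (q : Q) : prog nat := fun k n => Fetch q (k n n.+1).
Definition op_inspect (q : D) : prog (answer q) :=
  fun k n => Inspect (fun a => k a n).

Fixpoint iter_prog (X St : Type) (xs : seq X) (body : X -> St -> prog St)
    (st : St) : prog St :=
  if xs is x :: xs' then bind (body x st) (iter_prog xs' body) else ret st.

Definition addcost (t : nat) (y : 'M[R]_(c, r) * nat) := (y.1, (y.2 + t)%N).

(** Running p from regs appends some registers, establishes post on its result,
    and costs at most the given number of instructions more than what follows. *)
Definition wp (X : Type) (p : prog X) (regs : seq R) (cost : nat)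
    (post : X -> seq R -> Prop) : Prop :=
  exists x ext t, [/\ (t <= cost)%N, post x (regs ++ ext) &
    forall k, run fetch inspect (p k (size regs)) regs =
      addcost t (run fetch inspect (k x (size (regs ++ ext))) (regs ++ ext))].

Definition extends (regs regs' : seq R) : Prop := exists ext, regs' = regs ++ ext.

Lemma extends_refl regs : extends regs regs.
Proof. by exists [::]; rewrite cats0. Qed.

Lemma extends_trans r1 r2 r3 : extends r1 r2 -> extends r2 r3 -> extends r1 r3.
Proof. by move=> [e1 ->] [e2 ->]; exists (e1 ++ e2); rewrite catA. Qed.

Lemma wp_weaken X (p : prog X) regs cost cost' (post post' : X -> seq R -> Prop) :
  (cost <= cost')%N ->
  (forall x regs', extends regs regs' -> post x regs' -> post' x regs') ->
  wp p regs cost post -> wp p regs cost' post'.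
Proof.
move=> cc pp [x [ext [t [tc px e]]]]; exists x, ext, t; split=> //.
  exact: leq_trans cc.
by apply: pp => //; exists ext.
Qed.

Lemma wp_ret X (x : X) regs (post : X -> seq R -> Prop) :
  post x regs -> wp (ret x) regs 0 post.
Proof.
move=> px; exists x, [::], 0%N; rewrite cats0; split=> // k.
by rewrite /addcost addn0 -surjective_pairing.
Qed.

Lemma wp_bind X Y (p : prog X) (f : X -> prog Y) regs c1 c2
    (post : Y -> seq R -> Prop) :
  wp p regs c1 (fun x regs' => wp (f x) regs' c2 post) ->
  wp (bind p f) regs (c1 + c2) post.
Proof.
move=> [x [ext [t [tc [y [ext' [t' [tc' py e']]]] e]]]].
exists y, (ext ++ ext'), (t + t')%N; rewrite catA; split=> //.
  exact: leq_add.
by move=> k; rewrite /bind e e' /addcost /= -addnA [(t' + t)%N]addnC.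
Qed.

Lemma wp_seq X Y (p : prog X) (f : X -> prog Y) regs c1 c2
    (mid : X -> seq R -> Prop) (post : Y -> seq R -> Prop) :
  wp p regs c1 mid ->
  (forall x regs', extends regs regs' -> mid x regs' -> wp (f x) regs' c2 post) ->
  wp (bind p f) regs (c1 + c2) post.
Proof. by move=> wpp H; apply: wp_bind; apply: wp_weaken wpp. Qed.

Definition holds (regs : seq R) (i : nat) (v : R) : Prop :=
  (i < size regs)%N /\ nth 0 regs i = v.

Lemma holds_extends regs regs' i v : extends regs regs' ->
  holds regs i v -> holds regs' i v.
Proof.
move=> [ext ->] [isz <-]; split; first by rewrite size_cat ltn_addr.
by rewrite nth_cat isz.
Qed.

Let holds_rcons regs v : holds (regs ++ [:: v]) (size regs) v.
Proof. by split; rewrite ?size_cat ?addn1 // nth_cat ltnn subnn. Qed.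

Let run_tick y : tick y = addcost 1 y.
Proof. by rewrite /tick /addcost addn1. Qed.

Lemma wp_const z regs : wp (op_const z) regs 1 (fun i regs' => holds regs' i z%:~R).
Proof.
exists (size regs), [:: z%:~R], 1%N; split=> // k.
by rewrite /op_const /= run_tick cats1 size_rcons.
Qed.

Lemma wp_arith o i j x y regs : holds regs i x -> holds regs j y ->
  wp (op_arith o i j) regs 1 (fun l regs' => holds regs' l (arith_eval o x y)).
Proof.
move=> [_ xi] [_ yj]; exists (size regs), [:: arith_eval o x y], 1%N; split=> // k.
by rewrite /op_arith /= run_tick cats1 size_rcons xi yj.
Qed.

Lemma wp_le i j x y regs : holds regs i x -> holds regs j y ->
  wp (op_le i j) regs 1 (fun b _ => b = (x <= y)).
Proof.
move=> [_ xi] [_ yj]; exists (x <= y), [::], 1%N; split=> // k.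
by rewrite /op_le /= run_tick cats0 xi yj; case: ifP.
Qed.

Lemma wp_fetch q regs : wp (op_fetch q) regs 1 (fun i regs' => holds regs' i (fetch q)).
Proof.
exists (size regs), [:: fetch q], 1%N; split=> // k.
by rewrite /op_fetch /= run_tick cats1 size_rcons.
Qed.

Lemma wp_inspect q regs : wp (@op_inspect q) regs 1 (fun a _ => a = inspect q).
Proof.
exists (inspect q), [::], 1%N; split=> // k.
by rewrite /op_inspect /= run_tick cats0.
Qed.

(** The invariant is indexed by the part of the list already processed. *)
Lemma wp_iter (X St : Type) (xs : seq X) (body : X -> St -> prog St) (st : St)
    regs cost (Inv : seq X -> St -> seq R -> Prop) :
  Inv [::] st regs ->
  (forall done x rest st' regs', done ++ x :: rest = xs -> extends regs regs' ->
     Inv done st' regs' ->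
     wp (body x st') regs' cost (fun st'' regs'' => Inv (rcons done x) st'' regs'')) ->
  wp (iter_prog xs body st) regs (size xs * cost) (fun st' regs' => Inv xs st' regs').
Proof.
move=> I0 step.
suff H rest done st' regs' : done ++ rest = xs -> extends regs regs' ->
    Inv done st' regs' ->
    wp (iter_prog rest body st') regs' (size rest * cost) (fun st'' => Inv xs st'').
  by apply: (H xs [::]) => //; exact: extends_refl.
elim: rest done st' regs' => [|x rest IH] done st' regs' xsE ext I.
  by rewrite mul0n; apply: wp_ret; rewrite -xsE cats0.
rewrite /= mulSn; apply: (wp_seq (step _ _ _ _ _ xsE ext I)) => st'' regs'' ext' I'.
by apply: (IH (rcons done x)) => //; [rewrite cat_rcons|exact: extends_trans ext'].
Qed.

(** A family of registers, one for each element of X, is a function to register numbers. *)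
Definition upd (X : eqType) (f : X -> nat) (x : X) (i : nat) : X -> nat :=
  fun y => if y == x then i else f y.

Definition tabulate (X : finType) (body : X -> prog nat) : prog (X -> nat) :=
  iter_prog (enum X) (fun x f => bind (body x) (fun i => ret (upd f x i))) (fun=> 0%N).

Lemma wp_tabulate (X : finType) (body : X -> prog nat) regs cost (v : X -> R) :
  (forall x regs', extends regs regs' ->
     wp (body x) regs' cost (fun i regs'' => holds regs'' i (v x))) ->
  wp (tabulate body) regs (#|X| * cost) (fun f regs' => forall x, holds regs' (f x) (v x)).
Proof.
move=> H; pose Inv (done : seq X) (f : X -> nat) regs' :=
  forall x, x \in done -> holds regs' (f x) (v x).
have := @wp_iter X (X -> nat) (enum X)
  (fun x f => bind (body x) (fun i => ret (upd f x i))) (fun=> 0%N) regs cost Inv.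
rewrite -cardE => /(_ _ _) W; apply: wp_weaken (W _ _) => //.
  by move=> f regs' _ I x; apply: I; rewrite mem_enum.
move=> done x rest f regs' _ ext I.
rewrite -[cost]addn0; apply: (wp_seq (H x regs' ext)) => i regs'' ext' hi.
apply: wp_ret => y; rewrite mem_rcons inE /upd; case: eqP => [-> _ //|_ /= yd].
exact: (holds_extends ext' (I y yd)).
Qed.

(** The sum starts from a register, so that 1 + |d|^2 needs no extra addition. *)
Definition dot (X : Type) (xs : seq X) (f g : X -> nat) (acc : nat) : prog nat :=
  iter_prog xs (fun x a => bind (op_arith Mul (f x) (g x))
    (fun p => op_arith Add a p)) acc.

Lemma wp_dot (X : Type) (xs : seq X) (f g : X -> nat) acc regs (u v : X -> R) a :
  holds regs acc a -> (forall x, holds regs (f x) (u x)) ->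
  (forall x, holds regs (g x) (v x)) ->
  wp (dot xs f g acc) regs (size xs * 2)
    (fun i regs' => holds regs' i (a + \sum_(x <- xs) u x * v x)).
Proof.
move=> ha hf hg.
apply: (wp_iter (Inv := fun done i regs' => holds regs' i (a + \sum_(x <- done) u x * v x))).
  by rewrite big_nil addr0.
move=> done x rest i regs' _ ext I.
have := wp_arith Mul (holds_extends ext (hf x)) (holds_extends ext (hg x)).
move=> W; apply: (wp_seq (c1 := 1) (c2 := 1) W) => p regs'' ext' hp.
apply: wp_weaken (wp_arith Add (holds_extends ext' I) hp) => // l regs3 _.
by rewrite -cats1 big_cat big_seq1 /= addrA.
Qed.

Definition holds_mx (m n : nat) regs (f : 'I_m * 'I_n -> nat) (B : 'M[R]_(m, n)) :=
  forall p, holds regs (f p) (B p.1 p.2).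

Lemma holds_mx_extends m n regs regs' (f : 'I_m * 'I_n -> nat) B :
  extends regs regs' -> holds_mx regs f B -> holds_mx regs' f B.
Proof. by move=> e h p; exact: holds_extends (h p). Qed.

Definition mulmx_prog (m k n : nat) (f : 'I_m * 'I_k -> nat)
    (g : 'I_k * 'I_n -> nat) (z : nat) : prog ('I_m * 'I_n -> nat) :=
  tabulate (fun p : 'I_m * 'I_n => dot (enum 'I_k) (fun l => f (p.1, l)) (fun l => g (l, p.2)) z).

Lemma wp_mulmx m k n (f : 'I_m * 'I_k -> nat) (g : 'I_k * 'I_n -> nat) z regs
    (A : 'M[R]_(m, k)) (B : 'M[R]_(k, n)) :
  holds regs z 0 -> holds_mx regs f A -> holds_mx regs g B ->
  wp (mulmx_prog f g z) regs (m * n * (k * 2))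
    (fun h regs' => holds_mx regs' h (A *m B)).
Proof.
move=> hz hf hg; have := @wp_tabulate ('I_m * 'I_n)%type
  (fun p : 'I_m * 'I_n => dot (enum 'I_k) (fun l => f (p.1, l)) (fun l => g (l, p.2)) z)
  regs (k * 2) (fun p => (A *m B) p.1 p.2).
rewrite card_prod !card_ord; apply=> -[i j] regs' ext.
have := @wp_dot _ (enum 'I_k) (fun l => f (i, l)) (fun l => g (l, j)) z regs'
  (fun l => A i l) (fun l => B l j) 0.
rewrite size_enum_ord => W; apply: wp_weaken (W _ _ _) => //.
- by move=> h regs'' _; rewrite add0r mxE -big_enum.
- exact: holds_extends hz.
- by move=> l; exact: (holds_extends ext (hf (i, l))).
- by move=> l; exact: (holds_extends ext (hg (l, j))).
Qed.

End programs.

(** * Computing a pseudoinverse *)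

Section greville_program.
Context (R : realType) (Q D : Type) (answer : D -> Type) (c r : nat).
Variables (fetch : Q -> R) (inspect : forall q : D, answer q).
Local Notation prog := (prog Q answer c r).
Local Notation wpc := (@wp R Q D answer c r fetch inspect _).
Variables (s k : nat).

(** The row b of [greville_step], with d and q already computed. *)
Definition greville_vector (f : 'I_s * 'I_k -> nat) (z : nat)
    (g : 'I_k * 'I_s -> nat) (d : 'I_k -> nat) (q : 'I_s -> nat) : prog ('I_s -> nat) :=
  bind (dot (enum 'I_s) q q z) (fun beta =>
  bind (op_le beta z) (fun null : bool =>
  if null then
    bind (op_const 1) (fun one =>
    bind (dot (enum 'I_k) d d one) (fun w =>
    tabulate (fun l : 'I_s =>
      bind (dot (enum 'I_k) d (fun i => g (i, l)) z) (fun y =>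
      op_arith Div y w))))
  else tabulate (fun l : 'I_s => op_arith Div (q l) beta))).

Definition greville_body (f : 'I_s * 'I_k -> nat) (z : nat) (x : 'I_k)
    (g : 'I_k * 'I_s -> nat) : prog ('I_k * 'I_s -> nat) :=
  bind (tabulate (fun i : 'I_k =>
    dot (enum 'I_s) (fun l => g (i, l)) (fun l => f (l, x)) z)) (fun d =>
  bind (tabulate (fun l : 'I_s =>
    bind (dot (enum 'I_k) (fun i => f (l, i)) d z) (fun y =>
    op_arith Defs.Sub (f (l, x)) y))) (fun q =>
  bind (greville_vector f z g d q) (fun b =>
  tabulate (fun p : 'I_k * 'I_s =>
    if p.1 == x then ret (b p.2)
    else bind (op_arith Mul (d p.1) (b p.2)) (fun y =>
         op_arith Defs.Sub (g p) y))))).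

Definition greville_prog (f : 'I_s * 'I_k -> nat) (z : nat) : prog ('I_k * 'I_s -> nat) :=
  iter_prog (enum 'I_k) (greville_body f z) (fun=> z).

Lemma wp_greville_vector f z g d q regs (Z : 'M[R]_(k, s)) (dv : 'cV[R]_k) (qv : 'cV[R]_s) :
  holds regs z 0 -> holds_mx regs g Z -> (forall i, holds regs (d i) (dv i 0)) ->
  (forall l, holds regs (q l) (qv l 0)) ->
  wpc (greville_vector f z g d q) regs (s * 2 + (1 + (1 + (k * 2 + s * (k * 2 + 1)))))
   (fun b regs' => exists bv : 'rV[R]_s, (forall l, holds regs' (b l) (bv 0 l)) /\
     if (qv^T *m qv) 0 0 == 0 then bv = (1 + (dv^T *m dv) 0 0)^-1 *: (dv^T *m Z)
     else bv = ((qv^T *m qv) 0 0)^-1 *: qv^T).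
Proof.
move=> hz hg hd hq.
have qq : (qv^T *m qv) 0 0 = 0 + \sum_(l <- enum 'I_s) qv l 0 * qv l 0.
  by rewrite add0r mxE big_enum /=; apply: eq_bigr => l _; rewrite mxE.
have := wp_dot c r fetch inspect (enum 'I_s) hz hq hq.
rewrite size_enum_ord -qq; set beta := (qv^T *m qv) 0 0 => W.
have b0 : 0 <= beta by rewrite /beta mxE sumr_ge0 // => l _; rewrite mxE -expr2 sqr_ge0.
apply: (wp_seq W) => ib r1 e1 hb; apply: (wp_seq (wp_le c r fetch inspect hb (holds_extends e1 hz))).
move=> null r2 e2 ->.
have -> : (beta <= 0) = (beta == 0) by rewrite eq_le b0 andbT.
have e02 := extends_trans e1 e2.
case: ifP => _.
  apply: (wp_seq (wp_const c r fetch inspect 1 _)) => one r3 e3 h1.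
  have e03 := extends_trans e02 e3.
  have := wp_dot c r fetch inspect (enum 'I_k) h1 (fun i => holds_extends e03 (hd i)) (fun i => holds_extends e03 (hd i)).
  rewrite size_enum_ord => W1.
  apply: (wp_seq W1) => w r4 e4 hw; have e04 := extends_trans e03 e4.
  have := @wp_tabulate _ _ _ _ c r fetch inspect 'I_s (fun l : 'I_s =>
      bind (dot (enum 'I_k) d (fun i => g (i, l)) z) (fun y =>
      op_arith Div y w)) r4 (k * 2 + 1)
     (fun l => ((1 + (dv^T *m dv) 0 0)^-1 *: (dv^T *m Z)) 0 l).
  rewrite card_ord => W2.
  apply: wp_weaken (W2 _); first exact: leqnn.
    move=> b r5 _ hb5.
    by exists ((1 + (dv^T *m dv) 0 0)^-1 *: (dv^T *m Z)).
  move=> l r5 e5.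
  have e05 := extends_trans e04 e5.
  have := wp_dot c r fetch inspect (enum 'I_k) (holds_extends e05 hz) (fun i => holds_extends e05 (hd i))
    (fun i => holds_extends e05 (hg (i, l))).
  rewrite size_enum_ord => W3.
  apply: (wp_seq W3) => y r6 e6 hy.
  apply: wp_weaken (wp_arith c r fetch inspect Div hy (holds_extends (extends_trans e5 e6) hw)) => // j r7 _.
  have E1 : (dv^T *m Z) 0 l = \sum_(i <- enum 'I_k) dv i 0 * Z i l.
    by rewrite mxE big_enum /=; apply: eq_bigr => i _; rewrite mxE.
  have E2 : (dv^T *m dv) 0 0 = \sum_(i <- enum 'I_k) dv i 0 * dv i 0.
    by rewrite mxE big_enum /=; apply: eq_bigr => i _; rewrite mxE.
  have -> u : (u *: (dv^T *m Z)) 0 l = u * (dv^T *m Z) 0 l by rewrite mxE.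
  by rewrite /= add0r E1 E2 mulrC.
have := @wp_tabulate _ _ _ _ c r fetch inspect 'I_s (fun l : 'I_s =>
   op_arith Div (q l) ib) r2 1 (fun l => (beta^-1 *: qv^T) 0 l).
rewrite card_ord => W2; apply: (wp_weaken _ _ (W2 _)).
- nia.
- by move=> b r3 _ h3; exists (beta^-1 *: qv^T).
move=> l r3 e3.
apply: wp_weaken (wp_arith c r fetch inspect Div (holds_extends (extends_trans e02 e3) (hq l))
  (holds_extends (extends_trans e2 e3) hb)) => // j r4 _.
by rewrite /= !mxE mulrC.
Qed.

(** Columns that the recursion has not reached yet are zero, as [greville_step] expects. *)
Definition mx_on (Y : 'M[R]_(s, k)) (done : seq 'I_k) : 'M[R]_(s, k) :=
  \matrix_(i, j) if j \in done then Y i j else 0.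

Definition greville_inv (Y : 'M[R]_(s, k)) (done : seq 'I_k)
    (g : 'I_k * 'I_s -> nat) (regs : seq R) : Prop :=
  exists Z : 'M[R]_(k, s), [/\ holds_mx regs g Z, penrose (mx_on Y done) Z &
    forall i l, i \notin done -> Z i l = 0].

Lemma wp_greville_body f z x g regs (Y : 'M[R]_(s, k)) done :
  x \notin done -> holds regs z 0 -> holds_mx regs f Y ->
  greville_inv Y done g regs ->
  wpc (greville_body f z x g) regs (8 * (k * s) + 4 * s + 2 * k + 2)
    (fun g' regs' => greville_inv Y (rcons done x) g' regs').
Proof.
move=> xd hz hf [Z [hg pZ Z0]].
pose a := col x Y; pose d := Z *m a; pose q := a - mx_on Y done *m d.
have d0 i : i \notin done -> d i 0 = 0.
  by move=> id; rewrite mxE big1 // => l _; rewrite Z0 // mul0r.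
have qE l : q l 0 = Y l x - (0 + \sum_(i <- enum 'I_k) Y l i * d i 0).
  rewrite !mxE add0r big_enum /=; congr (_ - _); apply: eq_bigr => i _; rewrite mxE.
  by case: ifPn => // /d0 ->; rewrite !mulr0.
apply: (@wp_weaken _ _ _ _ _ _ _ _ _ _ _ (k * (s * 2) + (s * (k * 2 + 1) +
   ((s * 2 + (1 + (1 + (k * 2 + s * (k * 2 + 1))))) + k * s * 2)))) => [|g' r' _ H|].
  nia.
  exact: H.
have W1 : wpc (tabulate (fun i : 'I_k =>
    dot (enum 'I_s) (fun l => g (i, l)) (fun l => f (l, x)) z)) regs (k * (s * 2))
    (fun dr r' => forall i, holds r' (dr i) (d i 0)).
  have := @wp_tabulate _ _ _ _ c r fetch inspect 'I_k (fun i : 'I_k =>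
    dot (enum 'I_s) (fun l => g (i, l)) (fun l => f (l, x)) z) regs (s * 2) (fun i => d i 0).
  rewrite card_ord => W0. apply: wp_weaken (W0 _); [exact: leqnn|by []|move=> i r1 e1].
  have := wp_dot c r fetch inspect (enum 'I_s) (holds_extends e1 hz)
    (fun l => holds_extends e1 (hg (i, l))) (fun l => holds_extends e1 (hf (l, x))).
  rewrite size_enum_ord; apply: wp_weaken => // j r2 _.
  by rewrite add0r mxE big_enum /=; congr holds; apply: eq_bigr => l _; rewrite [in RHS]mxE.
apply: (wp_seq W1) => dr r1 e1 hd.
have W2 : wpc (tabulate (fun l : 'I_s =>
    bind (dot (enum 'I_k) (fun i => f (l, i)) dr z) (fun y =>
    op_arith Defs.Sub (f (l, x)) y))) r1 (s * (k * 2 + 1))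
    (fun qr r' => forall l, holds r' (qr l) (q l 0)).
  have := @wp_tabulate _ _ _ _ c r fetch inspect 'I_s (fun l : 'I_s =>
    bind (dot (enum 'I_k) (fun i => f (l, i)) dr z) (fun y =>
    op_arith Defs.Sub (f (l, x)) y)) r1 (k * 2 + 1) (fun l => q l 0).
  rewrite card_ord => W0; apply: wp_weaken (W0 _); [exact: leqnn|by []|move=> l r2 e2].
  have e02 := extends_trans e1 e2.
  have := wp_dot c r fetch inspect (enum 'I_k) (holds_extends e02 hz)
    (fun i => holds_extends e02 (hf (l, i))) (fun i => holds_extends e2 (hd i)).
  rewrite size_enum_ord => W; apply: (wp_seq W) => y r3 e3 hy.
  rewrite qE; exact: (wp_arith c r fetch inspect Defs.Sub (holds_extends (extends_trans e02 e3) (hf (l, x))) hy).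
apply: (wp_seq W2) => qr r2 e2 hq.
have e02 := extends_trans e1 e2.
have W3 := wp_greville_vector f (holds_extends e02 hz) (holds_mx_extends e02 hg)
  (fun i => holds_extends e2 (hd i)) hq.
apply: (wp_seq W3) => b r3 e3 [bv [hb bE]].
have e03 := extends_trans e02 e3.
pose e : 'cV[R]_k := delta_mx x 0.
pose Z' := Z + (e - d) *m bv.
have Z'E i l : Z' i l = if i == x then bv 0 l else Z i l - d i 0 * bv 0 l.
  have -> : Z' i l = Z i l + ((i == x)%:R - d i 0) * bv 0 l.
    rewrite /Z' [LHS]mxE; congr (_ + _); rewrite [LHS]mxE big_ord1; congr (_ * _).
    by rewrite [LHS]mxE; congr (_ + _); rewrite mxE ?eqxx ?andbT.
  case: eqP => [->|_]; last by rewrite sub0r mulNr.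
  by rewrite (Z0 x) // (d0 x) // subr0 mul1r add0r.
have pZ' : penrose (mx_on Y (rcons done x)) Z'.
  have -> : mx_on Y (rcons done x) = mx_on Y done + a *m e^T.
    apply/matrixP => i j; rewrite !mxE big_ord1 !mxE eqxx andbT mem_rcons inE.
    case: eqP => [->|_] /=; first by rewrite (negbTE xd) add0r mulr1.
    by rewrite mulr0 addr0.
  apply: greville_step => //.
  - by rewrite /e trmx_delta mul_delta_mx; apply/matrixP => i j; rewrite !mxE !ord1.
  - apply/matrixP => i j; rewrite mxE big1 ?mxE // => l _; rewrite !mxE ord1 eqxx andbT.
    by case: eqP => [->|_]; rewrite ?mulr0 // (negbTE xd) mul0r.
  - apply/matrixP => i j; rewrite mxE big1 ?mxE // => l _; rewrite !mxE ord1 eqxx.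
    by case: eqP => [->|_] /=; rewrite ?mul0r // Z0 // mulr0.
have W4 := @wp_tabulate _ _ _ _ c r fetch inspect ('I_k * 'I_s)%type (fun p : 'I_k * 'I_s =>
    if p.1 == x then ret (b p.2)
    else bind (op_arith Mul (dr p.1) (b p.2)) (fun y => op_arith Defs.Sub (g p) y)) r3 2
  (fun p => Z' p.1 p.2).
rewrite card_prod !card_ord in W4.
apply: wp_weaken (W4 _); first exact: leqnn.
  move=> g' r4 _ h4; exists Z'; split => // i l.
  rewrite mem_rcons inE negb_or Z'E => /andP[/negbTE -> id].
  by rewrite Z0 // d0 // mul0r subrr.
move=> [i l] r4 e4; rewrite [_ (i, l)]/=; have e04 := extends_trans e03 e4.
case: ifP => ix.
  apply: (@wp_weaken _ _ _ _ _ _ _ _ _ _ _ 0%N) => [//|y r5 _ H|]; first exact: H.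
  by apply: wp_ret; rewrite /= Z'E ix; exact: holds_extends (hb l).
have W5 := wp_arith c r fetch inspect Mul (holds_extends (extends_trans e2 (extends_trans e3 e4)) (hd i))
   (holds_extends e4 (hb l)).
apply: (wp_seq (c1 := 1) (c2 := 1) W5) => y r5 e5 hy.
rewrite /= Z'E ix.
exact: (wp_arith c r fetch inspect Defs.Sub (holds_extends (extends_trans e04 e5) (hg (i, l))) hy).
Qed.

Lemma wp_greville f z regs (Y : 'M[R]_(s, k)) :
  holds regs z 0 -> holds_mx regs f Y ->
  wpc (greville_prog f z) regs (k * (8 * (k * s) + 4 * s + 2 * k + 2))
    (fun g regs' => holds_mx regs' g (mpinv Y)).
Proof.
move=> hz hf; rewrite -[X in (X * _)%N]card_ord cardE.
apply: (wp_weaken (leqnn _) _ (wp_iter (Inv := greville_inv Y) _ _)).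
- move=> g r' _ [Z [hg pZ _]].
  have YE : mx_on Y (enum 'I_k) = Y by apply/matrixP => i j; rewrite mxE mem_enum.
  by rewrite -(mpinv_unique (Z := Z)) // -YE.
- exists 0; split => [p| |i l _]; rewrite ?mxE //.
  have -> : mx_on Y [::] = 0 by apply/matrixP => i j; rewrite !mxE.
  by split; rewrite ?mulmx0 ?mul0mx ?trmx0.
- move=> done x rest g r' E e I; apply: wp_greville_body => //.
  + have := enum_uniq 'I_k; rewrite -E cat_uniq /= => /and3P[_].
    by rewrite negb_or => /andP[].
  + exact: holds_extends hz.
  + exact: holds_mx_extends hf.
Qed.

End greville_program.

(** * Computing the sketched solution *)

Section embedding_program.
Context (R : realType) (Q D : Type) (answer : D -> Type) (c r : nat).
Variables (fetch : Q -> R) (inspect : forall q : D, answer q).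
Local Notation prog := (prog Q answer c r).
Local Notation wpc := (@wp R Q D answer c r fetch inspect _).
Variables (t m p : nat) (h : 'I_m -> 'I_t) (sg : 'I_m -> R) (B : 'M[R]_(m, p)).
Variables (row : 'I_m -> prog 'I_t) (sign : 'I_m -> prog nat)
  (entry : 'I_m -> 'I_p -> prog nat).
Hypothesis wp_row : forall j regs, wpc (row j) regs 1 (fun i _ => i = h j).
Hypothesis wp_sign : forall j regs, wpc (sign j) regs 1 (fun i regs' => holds regs' i (sg j)).
Hypothesis wp_entry : forall j l regs,
  wpc (entry j l) regs 1 (fun i regs' => holds regs' i (B j l)).

Definition add_scaled_row (j : 'I_m) (F : 'I_t * 'I_p -> nat) : prog ('I_t * 'I_p -> nat) :=
  bind (row j) (fun i => bind (sign j) (fun x =>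
  iter_prog (enum 'I_p) (fun l F => bind (entry j l) (fun v =>
    bind (op_arith Mul x v) (fun u => bind (op_arith Add (F (i, l)) u) (fun a =>
    ret (upd F (i, l) a))))) F)).

(** Multiplication by a matrix with one nonzero entry per column costs a constant
    number of operations for each entry of the other factor. *)
Definition embed_prog (z : nat) : prog ('I_t * 'I_p -> nat) :=
  iter_prog (enum 'I_m) add_scaled_row (fun=> z).

Definition scatter_mx : 'M[R]_(t, m) := \matrix_(i, j) if i == h j then sg j else 0.

Lemma wp_add_scaled_row j F regs (C : 'M[R]_(t, p)) : holds_mx regs F C ->
  wpc (add_scaled_row j F) regs (1 + (1 + p * 3))
   (fun F' regs' => holds_mx regs' F' (C + \matrix_(i, l) (scatter_mx i j * B j l))).
Proof.
move=> hF; apply: (wp_seq (wp_row j regs)) => _ r1 e1 ->.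
apply: (wp_seq (wp_sign j r1)) => x r2 e2 hx.
pose C' (done : seq 'I_p) : 'M[R]_(t, p) :=
  C + \matrix_(i, l) (if l \in done then scatter_mx i j * B j l else 0).
rewrite -[X in (X * 3)%N]size_enum_ord.
apply: (wp_weaken (leqnn _) _ (wp_iter (Inv := fun done F' r' => holds_mx r' F' (C' done)) _ _)).
- move=> F' r' _ H q; have := H q; rewrite !mxE mem_enum //.
- move=> q; rewrite !mxE addr0.
  exact: holds_extends (extends_trans e1 e2) (hF q).
move=> done l rest F' r3 E e3 I.
have ld : l \notin done.
  have := enum_uniq 'I_p; rewrite -E cat_uniq /= => /and3P[_].
  by rewrite negb_or => /andP[].
apply: (wp_seq (c1 := 1) (c2 := 2) (wp_entry j l r3)) => v r4 e4 hv.
apply: (wp_seq (c1 := 1) (c2 := 1) (wp_arith c r fetch inspect Mul (holds_extends (extends_trans e3 e4) hx) hv)) => u r5 e5 hu.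
have e35 := extends_trans e4 e5.
apply: (wp_seq (c1 := 1) (c2 := 0) (wp_arith c r fetch inspect Add (holds_extends e35 (I (h j, l))) hu)) => a r6 e6 ha.
have CE i k : C' (rcons done l) i k = C' done i k +
    (if (i == h j) && (k == l) then sg j * B j l else 0).
  rewrite !mxE mem_rcons inE -addrA; congr (_ + _).
  have [->|_] := eqVneq k l; last by rewrite andbF addr0.
  by rewrite (negbTE ld) add0r andbT /=; case: ifP; rewrite ?mul0r.
apply: wp_ret => -[i k]; rewrite /upd xpair_eqE CE.
case: ifPn => [/andP[/eqP -> /eqP ->]|_]; first exact: ha.
by rewrite addr0; exact: holds_extends (extends_trans e35 e6) (I (i, k)).
Qed.

Lemma wp_embed z regs : holds regs z 0 ->
  wpc (embed_prog z) regs (m * (1 + (1 + p * 3)))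
   (fun F regs' => holds_mx regs' F (scatter_mx *m B)).
Proof.
move=> hz; rewrite -[X in (X * _)%N]size_enum_ord.
pose C (done : seq 'I_m) : 'M[R]_(t, p) :=
  \matrix_(i, l) \sum_(j <- done) scatter_mx i j * B j l.
apply: (wp_weaken (leqnn _) _ (wp_iter (Inv := fun done F' r' => holds_mx r' F' (C done)) _ _)).
- by move=> F r' _ H q; have := H q; rewrite !mxE big_enum.
- by move=> q; rewrite mxE big_nil.
move=> done j rest F r1 _ _ I; apply: (wp_weaken _ _ (wp_add_scaled_row j I)) => // F' r2 _ H q.
by have := H q; rewrite [X in holds _ _ X -> _]mxE [X in holds _ _ (X + _) -> _]mxE [X in holds _ _ (_ + X) -> _]mxE [X in _ -> holds _ _ X]mxE -cats1 big_cat big_seq1.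
Qed.

End embedding_program.

Section algorithm.
Context (R : realType) (m n c r s t s' t' : nat).
Local Notation Q := (real_query m n c r s t s' t').
Local Notation D := (index_query m n).
Local Notation answer := (@index_answer m n t t').
Local Notation prog := (prog Q answer c r).

Local Notation insp q := (@op_inspect Q D answer c r q).
Local Notation ftch q := (@op_fetch Q D answer c r q).

(** Entry k of the list of nonzero entries of A contributes to a single entry of
    Pi A Pi'^T. *)
Definition add_entry (k : nat) (p : 'I_m * 'I_n) (F : 'I_t * 'I_t' -> nat) :
    prog ('I_t * 'I_t' -> nat) :=
  bind (insp (DrawRowM n p.1)) (fun h : 'I_t =>
  bind (insp (DrawRowN m p.2)) (fun h' : 'I_t' =>
  bind (ftch (ValueA _ _ _ _ _ _ _ _ k)) (fun v =>
  bind (ftch (DrawSignM _ _ _ _ _ _ _ p.1)) (fun x =>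
  bind (ftch (DrawSignN _ _ _ _ _ _ _ p.2)) (fun y =>
  bind (op_arith Mul x y) (fun u =>
  bind (op_arith Mul u v) (fun w =>
  bind (op_arith Add (F (h, h')) w) (fun a =>
  ret (upd F (h, h') a))))))))).

(** The list ends where [PositionA] answers [None]; fuel only bounds the depth of
    the tree. *)
Fixpoint scan_entries (fuel k : nat) (F : 'I_t * 'I_t' -> nat) :
    prog ('I_t * 'I_t' -> nat) :=
  if fuel is fuel'.+1 then
    bind (insp (PositionA m n k)) (fun o : option ('I_m * 'I_n) =>
    if o is Some p then bind (add_entry k p F) (scan_entries fuel' k.+1) else ret F)
  else ret F.

(** The order of the two products matters for the cost, and depends on c <= r. *)
Definition sketch_left (G : 'I_s * 'I_t -> nat) (G' : 'I_t' * 'I_s' -> nat)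
    (F : 'I_t * 'I_t' -> nat) (z : nat) : prog ('I_s * 'I_s' -> nat) :=
  if (c <= r)%N then bind (mulmx_prog G F z) (fun H => mulmx_prog H G' z)
  else bind (mulmx_prog F G' z) (fun H => mulmx_prog G H z).

Definition transpose_reg (a b : nat) (f : 'I_a * 'I_b -> nat) : 'I_b * 'I_a -> nat :=
  fun p => f (p.2, p.1).

Definition xhat_prog : prog ('I_c * 'I_r -> nat) :=
  bind (op_const 0) (fun z =>
  bind (scan_entries (m * n).+1 0 (fun=> z)) (fun F =>
  bind (embed_prog (fun j => insp (DrawRowM n j))
    (fun j => ftch (DrawSignM n c r s t s' t' j))
    (fun j l => ftch (EntryM _ _ _ _ _ _ j l)) z) (fun PM =>
  bind (embed_prog (fun j => insp (DrawRowN m j))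
    (fun j => ftch (DrawSignN m c r s t s' t' j))
    (fun j l => ftch (EntryN _ _ _ _ _ _ l j)) z) (fun PN =>
  bind (tabulate (fun p : 'I_s * 'I_t => ftch (DrawNormalM _ _ _ _ _ _ p.1 p.2))) (fun G =>
  bind (tabulate (fun p : 'I_s' * 'I_t' => ftch (DrawNormalN _ _ _ _ _ _ p.1 p.2))) (fun G' =>
  bind (mulmx_prog G PM z) (fun YM =>
  bind (mulmx_prog G' PN z) (fun YN =>
  bind (greville_prog YM z) (fun ZM =>
  bind (greville_prog YN z) (fun ZN =>
  bind (sketch_left G (transpose_reg G') F z) (fun H =>
  bind (mulmx_prog ZM H z) (fun L =>
  mulmx_prog L (transpose_reg ZN) z)))))))))))).

Definition xhat_alg : algorithm m n c r s t s' t' :=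
  xhat_prog (fun f _ => Output Q answer (\matrix_(i, j) f (i, j))) 0.

Definition xhat_cost (z : nat) : nat :=
  1 + ((z * 9 + 1) + (m * (1 + (1 + c * 3)) + (n * (1 + (1 + r * 3)) +
  (s * t + (s' * t' + (s * c * (t * 2) + (s' * r * (t' * 2) +
  (c * (8 * (c * s) + 4 * s + 2 * c + 2) + (r * (8 * (r * s') + 4 * s' + 2 * r + 2) +
  ((if (c <= r)%N then s * t' * (t * 2) + s * s' * (t' * 2)
    else t * s' * (t' * 2) + s * s' * (t * 2)) +
  (c * s' * (s * 2) + c * r * (s' * 2)))))))))))).

Variables (A : 'M[R]_(m, n)) (M : 'M[R]_(m, c)) (N : 'M[R]_(r, n)).
Variables (nz : seq ('I_m * 'I_n)) (DM : sketch R s t m) (DN : sketch R s' t' n).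
Hypothesis nzA : perm_eq nz (enum (support_mx A)).

Local Notation fetch := (fetch_input A nz M N DM DN).
Local Notation inspect := (inspect_input nz DM DN).
Local Notation wpc := (@wp R Q D answer c r fetch inspect _).

Let entry_at (p : 'I_m * 'I_n) (i : 'I_t) (k : 'I_t') : R :=
  (if i == sk_row DM p.1 then (-1) ^+ sk_neg DM p.1 else 0) *
  A p.1 p.2 * (if k == sk_row DN p.2 then (-1) ^+ sk_neg DN p.2 else 0).

Let partial (l : nat) : 'M[R]_(t, t') :=
  \matrix_(i, k) \sum_(p <- take l nz) entry_at p i k.

Lemma wp_add_entry k p F regs : onth nz k = Some p -> holds_mx regs F (partial k) ->
  wpc (add_entry k p F) regs 8 (fun F' regs' => holds_mx regs' F' (partial k.+1)).
Proof.
move=> nzk hF.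
apply: (wp_seq (c1 := 1) (c2 := 7) (wp_inspect _ _ _ _ _ _)) => _ r1 e1 ->.
apply: (wp_seq (c1 := 1) (c2 := 6) (wp_inspect _ _ _ _ _ _)) => _ r2 e2 ->.
apply: (wp_seq (c1 := 1) (c2 := 5) (wp_fetch _ _ _ _ _ _)) => v r3 e3 hv.
apply: (wp_seq (c1 := 1) (c2 := 4) (wp_fetch _ _ _ _ _ _)) => x r4 e4 hx.
apply: (wp_seq (c1 := 1) (c2 := 3) (wp_fetch _ _ _ _ _ _)) => y r5 e5 hy.
apply: (wp_seq (c1 := 1) (c2 := 2) (wp_arith c r fetch inspect Mul (holds_extends e5 hx) hy)) => u r6 e6 hu.
have e36 := extends_trans e4 (extends_trans e5 e6).
apply: (wp_seq (c1 := 1) (c2 := 1) (wp_arith c r fetch inspect Mul hu (holds_extends e36 hv))) => w r7 e7 hw.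
have e07 := extends_trans e1 (extends_trans e2 (extends_trans e3 (extends_trans e36 e7))).
apply: (wp_seq (c1 := 1) (c2 := 0) (wp_arith c r fetch inspect Add (holds_extends e07 (hF _)) hw)) => a r8 e8 ha.
have ksz : (k < size nz)%N.
  by rewrite ltnNge; apply/negP => /onth_default; rewrite nzk.
have PE i l : partial k.+1 i l = partial k i l + entry_at p i l.
  rewrite !mxE (take_nth p) // -cats1 big_cat big_seq1; congr (_ + _).
  by rewrite -odflt_onth nzk.
apply: wp_ret => -[i l]; rewrite /upd xpair_eqE PE /entry_at.
move: ha; rewrite /= nzk /= => ha.
case: eqP => [->|_] /=; last first.
  by rewrite !mul0r addr0; exact: holds_extends (extends_trans e07 e8) (hF (i, l)).
case: eqP => [->|_] /=; last first.
  by rewrite mulr0 addr0; exact: holds_extends (extends_trans e07 e8) (hF (_, l)).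
by rewrite mulrAC.
Qed.

Lemma wp_scan_entries fuel k F regs : (size nz < fuel + k)%N ->
  (k <= size nz)%N -> holds_mx regs F (partial k) ->
  wpc (scan_entries fuel k F) regs ((size nz - k) * 9 + 1)
    (fun F' regs' => holds_mx regs' F' (partial (size nz))).
Proof.
elim: fuel k F regs => [|fuel IH] k F regs lt_k le_k hF.
  by rewrite ltnNge le_k in lt_k.
rewrite /= addnC; apply: (wp_seq (wp_inspect _ _ _ _ _ _)) => _ r1 e1 ->.
rewrite [inspect _]/=; case nzk: (onth nz k) => [p|]; last first.
  have kE : k = size nz by apply/eqP; rewrite eqn_leq le_k -onthNE nzk.
  apply: (@wp_weaken _ _ _ _ _ _ _ _ _ _ _ 0%N) => [//|F' r' _ H|]; first exact: H.
  by apply: wp_ret; rewrite -kE; exact: holds_mx_extends hF.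
have ksz : (k < size nz)%N.
  by rewrite ltnNge; apply/negP => /onth_default; rewrite nzk.
have -> : ((size nz - k) * 9 = 8 + ((size nz - k.+1) * 9 + 1))%N by lia.
apply: (wp_seq (wp_add_entry nzk (holds_mx_extends e1 hF))) => F' r2 e2 hF'.
by apply: IH => //; lia.
Qed.

(** Positions outside the list contribute zero, and the order of a sum is irrelevant. *)
Lemma partial_all : partial (size nz) = embedding_mx DM *m A *m (embedding_mx DN)^T.
Proof.
apply/matrixP => i k; rewrite mxE take_size (perm_big _ nzA) /=.
rewrite big_enum /= mxE.
transitivity (\sum_(p : 'I_m * 'I_n) entry_at p i k).
  rewrite [RHS](bigID (mem (support_mx A))) /= [X in _ = _ + X]big1 ?addr0 // => p.
  by rewrite inE negbK /entry_at => /eqP ->; rewrite mulr0 mul0r.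
rewrite -(pair_bigA _ (fun j l => entry_at (j, l) i k)) exchange_big /=.
apply: eq_bigr => l _; rewrite mxE mulr_suml; apply: eq_bigr => j _.
by rewrite /entry_at !mxE.
Qed.

Lemma embeddingE a b d (E : sketch R a b d) :
  embedding_mx E = scatter_mx (sk_row E) (fun j => (-1) ^+ sk_neg E j).
Proof. by apply/matrixP => i j; rewrite !mxE. Qed.

Lemma wp_xhat regs : wpc xhat_prog regs (xhat_cost (nnz A))
  (fun f regs' => holds_mx regs' f (Xhat A M N (sketch_mx DM) (sketch_mx DN))).
Proof.
have nnzE : nnz A = size nz by rewrite (perm_size nzA) -cardE.
apply: (wp_seq (wp_const c r fetch inspect 0 _)) => z r1 e1 hz.
rewrite mulr0z in hz.
have W2 := @wp_scan_entries (m * n).+1 0 (fun=> z) r1.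
rewrite subn0 -nnzE in W2.
apply: (wp_seq (W2 _ _ _)) => //.
- rewrite addn0 ltnS /nnz; apply: leq_trans (max_card _) _.
  by rewrite card_prod !card_ord.
- by move=> p; rewrite /partial take0 mxE big_nil.
move=> F r2 e2 hF; have hz2 := holds_extends e2 hz.
rewrite nnzE partial_all in hF.
have W3 := wp_embed (h := sk_row DM) (sg := fun j => (-1) ^+ sk_neg DM j) (B := M)
  (fun j rg => wp_inspect c r fetch inspect (DrawRowM n j) rg)
  (fun j rg => wp_fetch c r fetch inspect (DrawSignM n c r s t s' t' j) rg)
  (fun j l rg => wp_fetch c r fetch inspect (EntryM _ _ _ _ _ _ j l) rg) hz2.
apply: (wp_seq W3) => PM r3 e3; rewrite -embeddingE => hPM.
have hz3 := holds_extends e3 hz2.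
have W4 := wp_embed (h := sk_row DN) (sg := fun j => (-1) ^+ sk_neg DN j) (B := N^T)
  (row := fun j => insp (DrawRowN m j)) (sign := fun j => ftch (DrawSignN m c r s t s' t' j))
  (entry := fun j l => ftch (EntryN _ _ _ _ _ _ l j))
  (fun j rg => wp_inspect c r fetch inspect (DrawRowN m j) rg)
  (fun j rg => wp_fetch c r fetch inspect (DrawSignN m c r s t s' t' j) rg) _ hz3.
apply: (wp_seq (W4 _)) => [j l rg|PN r4 e4].
  by rewrite mxE; exact: wp_fetch.
rewrite -embeddingE => hPN; have hz4 := holds_extends e4 hz3.
have W5 := @wp_tabulate _ _ _ _ c r fetch inspect ('I_s * 'I_t)%type
  (fun p => ftch (DrawNormalM _ _ _ _ _ _ p.1 p.2)) r4 1 (fun p => sk_normal DM p.1 p.2)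
  (fun p rg _ => wp_fetch c r fetch inspect _ rg).
rewrite card_prod !card_ord muln1 in W5.
apply: (wp_seq W5) => G r5 e5 hG; have hz5 := holds_extends e5 hz4.
have W6 := @wp_tabulate _ _ _ _ c r fetch inspect ('I_s' * 'I_t')%type
  (fun p => ftch (DrawNormalN _ _ _ _ _ _ p.1 p.2)) r5 1 (fun p => sk_normal DN p.1 p.2)
  (fun p rg _ => wp_fetch c r fetch inspect _ rg).
rewrite card_prod !card_ord muln1 in W6.
apply: (wp_seq W6) => G' r6 e6 hG'; have hz6 := holds_extends e6 hz5.
have e36 := extends_trans e4 (extends_trans e5 e6).
apply: (wp_seq (wp_mulmx c r fetch inspect hz6 (holds_mx_extends e6 hG) (holds_mx_extends e36 hPM))) => YM r7 e7 hYM.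
have hz7 := holds_extends e7 hz6.
have e47 := extends_trans e5 (extends_trans e6 e7).
apply: (wp_seq (wp_mulmx c r fetch inspect hz7 (holds_mx_extends e7 hG') (holds_mx_extends e47 hPN))) => YN r8 e8 hYN.
have hz8 := holds_extends e8 hz7.
apply: (wp_seq (wp_greville c r fetch inspect hz8 (holds_mx_extends e8 hYM))) => ZM r9 e9 hZM.
have hz9 := holds_extends e9 hz8.
apply: (wp_seq (wp_greville c r fetch inspect hz9 (holds_mx_extends e9 hYN))) => ZN ra ea hZN.
have hza := holds_extends ea hz9.
have e7a := extends_trans e7 (extends_trans e8 (extends_trans e9 ea)).
have hGa := holds_mx_extends (extends_trans e6 e7a) hG.
have hG'a : holds_mx ra (transpose_reg G') (sk_normal DN)^T.
  by move=> p; rewrite mxE; exact: holds_extends e7a (hG' (p.2, p.1)).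
have hFa := holds_mx_extends (extends_trans e3 (extends_trans e36 e7a)) hF.
have W7 : wpc (sketch_left G (transpose_reg G') F z) ra
   (if (c <= r)%N then s * t' * (t * 2) + s * s' * (t' * 2)
    else t * s' * (t' * 2) + s * s' * (t * 2))
   (fun H r' => holds_mx r' H (sketch_mx DM *m A *m (sketch_mx DN)^T)).
  rewrite /sketch_left /sketch_mx trmx_mul; case: ifP => _.
    apply: (wp_seq (wp_mulmx c r fetch inspect hza hGa hFa)) => H rb eb hH.
    have := wp_mulmx c r fetch inspect (holds_extends eb hza) hH (holds_mx_extends eb hG'a).
    by rewrite !mulmxA.
  apply: (wp_seq (wp_mulmx c r fetch inspect hza hFa hG'a)) => H rb eb hH.
  have := wp_mulmx c r fetch inspect (holds_extends eb hza) (holds_mx_extends eb hGa) hH.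
  by rewrite !mulmxA.
apply: (wp_seq W7) => H rb eb hH; have hzb := holds_extends eb hza.
apply: (wp_seq (wp_mulmx c r fetch inspect hzb (holds_mx_extends (extends_trans ea eb) hZM) hH)) => L rc ec hL.
have hZN' : holds_mx rc (transpose_reg ZN) (mpinv (sk_normal DN *m (embedding_mx DN *m N^T)))^T.
  by move=> p; rewrite mxE; exact: holds_extends (extends_trans eb ec) (hZN (p.2, p.1)).
have := wp_mulmx c r fetch inspect (holds_extends ec hzb) hL hZN'.
have -> : (mpinv (sk_normal DN *m (embedding_mx DN *m N^T)))^T = mpinv (N *m (sketch_mx DN)^T).
  by rewrite -mpinv_tr mulmxA [in LHS]trmx_mul trmxK.
by rewrite /Xhat mulmxA -/(sketch_mx DM) !mulmxA.
Qed.

Lemma execute_xhat :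
  (execute xhat_alg A nz M N DM DN).1 = Xhat A M N (sketch_mx DM) (sketch_mx DN) /\
  ((execute xhat_alg A nz M N DM DN).2 <= xhat_cost (nnz A))%N.
Proof.
have [f [ext [k [kc hf runE]]]] := wp_xhat [::].
rewrite /execute /xhat_alg (runE (fun f _ => Output Q answer (\matrix_(i, j) f (i, j)))).
rewrite /addcost /= add0n; split => //.
by apply/matrixP => i j; rewrite [LHS]mxE [X in nth _ _ X]mxE; exact: (hf (i, j)).2.
Qed.

End algorithm.

(** * Operation count *)

(** Every summand of the count is compared with monomials of the cost bound,
    using 1 <= c, 1 <= r and 1 <= 1/eps to raise exponents.  At most three
    sizes are multiplied, hence C^3. *)
Lemma xhat_cost_le (R : realType) (C eps : R) (m n c r s t s' t' z : nat) :
  1 <= C -> 0 < eps < 1 -> (0 < c)%N -> (0 < r)%N -> (0 < m)%N -> (0 < n)%N ->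
  t%:R <= C * (c%:R / eps + c%:R ^+ 2) -> s%:R <= C * (c%:R / eps) ->
  t'%:R <= C * (r%:R / eps + r%:R ^+ 2) -> s'%:R <= C * (r%:R / eps) ->
  (xhat_cost m n c r s t s' t' z)%:R <= 50 * C ^+ 3 * cost_bound z m n c r eps.
Proof.
move=> C1 /andP[e0 e1] c0 r0 m0 n0 ht hs ht' hs'.
rewrite /cost_bound.
have geR1 (k : nat) : (0 < k)%N -> 1 <= k%:R :> R by rewrite -(ler_nat R).
have c1 := geR1 _ c0; have r1 := geR1 _ r0.
have mR := geR1 _ m0; have nR := geR1 _ n0.
have iE (k : nat) : (eps ^+ k)^-1 = eps^-1 ^+ k by rewrite exprVn.
rewrite !iE; have x1 : 1 <= eps^-1 by rewrite -(invr1 R) lef_pV2 ?posrE // ltW.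
move: (eps^-1) x1 ht hs ht' hs' {iE} => x x1 ht hs ht' hs'.
set cR : R := c%:R in c1 ht hs *; set rR : R := r%:R in r1 ht' hs' *.
set mm : R := m%:R in mR *; set nn : R := n%:R in nR *.
have C0 : 0 <= C by lra. have x0 : 0 <= x by lra.
have cp : 0 <= cR by lra. have rp : 0 <= rR by lra.
have s0 : 0 <= s%:R :> R by []. have t0 : 0 <= t%:R :> R by [].
have s'0 : 0 <= s'%:R :> R by []. have t'0 : 0 <= t'%:R :> R by [].
have z0 : 0 <= z%:R :> R by [].
have up (a b : R) : 0 <= a -> 1 <= b -> a <= a * b by exact: ler_peMr.
have mg1 (a b : R) : 1 <= a -> 1 <= b -> 1 <= a * b by move=> ha hb; nra.
pose T1 := cR ^+ 2 * rR * x ^+ 3; pose T2 := cR * rR ^+ 2 * x ^+ 3.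
pose T3 := cR ^+ 2 * rR ^+ 2 * x ^+ 2; pose T4 := cR ^+ 3 * rR * x ^+ 2.
pose T5 := cR * rR ^+ 3 * x ^+ 2.
pose T7 := cR ^+ 4 * x; pose T8 := rR ^+ 4 * x.
rewrite -/T1 -/T2 -/T3 -/T4 -/T5 -/T7 -/T8; set T6 := Num.min _ _.
have nn0 (a b : R) : 0 <= a -> 0 <= b -> 0 <= a * b by exact: mulr_ge0.
have pw (a : R) k : 0 <= a -> 0 <= a ^+ k by exact: exprn_ge0.
have P1 : 0 <= T1 by rewrite /T1 !nn0 ?pw. have P2 : 0 <= T2 by rewrite /T2 !nn0 ?pw.
have P3 : 0 <= T3 by rewrite /T3 !nn0 ?pw. have P4 : 0 <= T4 by rewrite /T4 !nn0 ?pw.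
have P5 : 0 <= T5 by rewrite /T5 !nn0 ?pw. have P7 : 0 <= T7 by rewrite /T7 !nn0 ?pw.
have P8 : 0 <= T8 by rewrite /T8 !nn0 ?pw.
have P6 : 0 <= T6 by rewrite /T6 le_min !nn0 ?pw.
have C3 : C <= C ^+ 3 by rewrite exprS; apply: up => //; rewrite expr2 mg1.
have C23 : C ^+ 2 <= C ^+ 3 by rewrite [leRHS]exprSr up ?pw.
have C13 : 1 <= C ^+ 3 by lra.
have C2 := pw C 2 C0; have C30 := pw C 3 C0.
have lift1 (a b : R) : 0 <= b -> a <= C * b -> a <= C ^+ 3 * b.
  by move=> b0 /le_trans; apply; rewrite ler_wpM2r.
have lift2 (a b : R) : 0 <= b -> a <= C ^+ 2 * b -> a <= C ^+ 3 * b.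
  by move=> b0 /le_trans; apply; rewrite ler_wpM2r.
have st : s%:R * t%:R <= C ^+ 2 * (cR ^+ 2 * x ^+ 2 + cR ^+ 3 * x).
  by apply: (le_trans (ler_pM s0 t0 hs ht)); rewrite le_eqVlt; apply/orP; left; apply/eqP; ring.
have st' : s'%:R * t'%:R <= C ^+ 2 * (rR ^+ 2 * x ^+ 2 + rR ^+ 3 * x).
  by apply: (le_trans (ler_pM s'0 t'0 hs' ht')); rewrite le_eqVlt; apply/orP; left; apply/eqP; ring.
have ss : s%:R * s'%:R <= C ^+ 2 * (cR * rR * x ^+ 2).
  by apply: (le_trans (ler_pM s0 s'0 hs hs')); rewrite le_eqVlt; apply/orP; left; apply/eqP; ring.
(* Each monomial is raised to one of the T's by factors that are at least 1. *)
have c2x2 : cR ^+ 2 * x ^+ 2 <= T1.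
  have h : cR ^+ 2 * x ^+ 2 <= cR ^+ 2 * x ^+ 2 * (rR * x) by apply: up; rewrite ?nn0 ?pw ?mg1.
  rewrite /T1. clear -h; lra.
have r2x2 : rR ^+ 2 * x ^+ 2 <= T2.
  have h : rR ^+ 2 * x ^+ 2 <= rR ^+ 2 * x ^+ 2 * (cR * x) by apply: up; rewrite ?nn0 ?pw ?mg1.
  rewrite /T2. clear -h; lra.
have c3x : cR ^+ 3 * x <= T7.
  have h : cR ^+ 3 * x <= cR ^+ 3 * x * cR by apply: up; rewrite ?nn0 ?pw ?mg1.
  rewrite /T7. clear -h; lra.
have r3x : rR ^+ 3 * x <= T8.
  have h : rR ^+ 3 * x <= rR ^+ 3 * x * rR by apply: up; rewrite ?nn0 ?pw ?mg1.
  rewrite /T8. clear -h; lra.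
have c3x2 : cR ^+ 3 * x ^+ 2 <= T4.
  have h : cR ^+ 3 * x ^+ 2 <= cR ^+ 3 * x ^+ 2 * rR by apply: up; rewrite ?nn0 ?pw ?mg1.
  rewrite /T4. clear -h; lra.
have r3x2 : rR ^+ 3 * x ^+ 2 <= T5.
  have h : rR ^+ 3 * x ^+ 2 <= rR ^+ 3 * x ^+ 2 * cR by apply: up; rewrite ?nn0 ?pw ?mg1.
  rewrite /T5. clear -h; lra.
have c3x4 : cR ^+ 3 * x <= T4.
  apply: le_trans c3x2; have h : cR ^+ 3 * x <= cR ^+ 3 * x * x by apply: up; rewrite ?nn0 ?pw ?mg1.
  clear -h; lra.
have r3x5 : rR ^+ 3 * x <= T5.
  apply: le_trans r3x2; have h : rR ^+ 3 * x <= rR ^+ 3 * x * x by apply: up; rewrite ?nn0 ?pw ?mg1.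
  clear -h; lra.
have c2T : cR ^+ 2 <= T4.
  apply: le_trans c3x4; have h : cR ^+ 2 <= cR ^+ 2 * (cR * x) by apply: up; rewrite ?nn0 ?pw ?mg1.
  clear -h; lra.
have r2T : rR ^+ 2 <= T5.
  apply: le_trans r3x5; have h : rR ^+ 2 <= rR ^+ 2 * (rR * x) by apply: up; rewrite ?nn0 ?pw ?mg1.
  clear -h; lra.
have k1 : s%:R * t%:R <= C ^+ 3 * (T1 + T7).
  by apply: lift2; [exact: addr_ge0|apply: (le_trans st); rewrite ler_wpM2l // lerD].
have k2 : s'%:R * t'%:R <= C ^+ 3 * (T2 + T8).
  by apply: lift2; [exact: addr_ge0|apply: (le_trans st'); rewrite ler_wpM2l // lerD].
have k3 : cR * (s%:R * t%:R) <= C ^+ 3 * (T4 + T7).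
  apply: lift2; first exact: addr_ge0.
  apply: (le_trans (ler_wpM2l cp st)).
  rewrite mulrCA ler_wpM2l // /T7; clear -c3x2; lra.
have k4 : rR * (s'%:R * t'%:R) <= C ^+ 3 * (T5 + T8).
  apply: lift2; first exact: addr_ge0.
  apply: (le_trans (ler_wpM2l rp st')).
  rewrite mulrCA ler_wpM2l // /T8; clear -r3x2; lra.
have k5 : cR ^+ 2 * s%:R <= C ^+ 3 * T4.
  apply: lift1 => //; apply: (le_trans (ler_wpM2l (pw cR 2%N cp) hs)).
  rewrite mulrCA ler_wpM2l //; clear -c3x4; lra.
have k6 : rR ^+ 2 * s'%:R <= C ^+ 3 * T5.
  apply: lift1 => //; apply: (le_trans (ler_wpM2l (pw rR 2%N rp) hs')).
  rewrite mulrCA ler_wpM2l //; clear -r3x5; lra.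
have k7 : cR * (s%:R * s'%:R) <= C ^+ 3 * T1.
  apply: lift2 => //; apply: (le_trans (ler_wpM2l cp ss)).
  rewrite mulrCA ler_wpM2l // /T1; have h : cR ^+ 2 * rR * x ^+ 2 <= cR ^+ 2 * rR * x ^+ 2 * x by (apply: up; rewrite ?nn0 ?pw ?mg1).
  by clear -h; lra.
have k8 : cR * rR * s'%:R <= C ^+ 3 * T2.
  apply: lift1 => //; apply: (le_trans (ler_wpM2l (nn0 _ _ cp rp) hs')).
  rewrite mulrCA ler_wpM2l // /T2; have h : cR * rR ^+ 2 * x <= cR * rR ^+ 2 * x * (x * x) by (apply: up; rewrite ?nn0 ?pw ?mg1).
  by clear -h; lra.
have k9 : cR * s%:R <= cR ^+ 2 * s%:R.
  have h : cR * s%:R <= cR * s%:R * cR by apply: up; rewrite ?nn0 ?pw ?mg1.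
  clear -h; lra.
have k10 : rR * s'%:R <= rR ^+ 2 * s'%:R.
  have h : rR * s'%:R <= rR * s'%:R * rR by apply: up; rewrite ?nn0 ?pw ?mg1.
  clear -h; lra.
have k11 : cR <= cR ^+ 2 by rewrite expr2 up.
have k12 : rR <= rR ^+ 2 by rewrite expr2 up.
have m1 : mm <= mm * cR by rewrite up // (le_trans ler01).
have n1 : nn <= nn * rR by rewrite up // (le_trans ler01).
have i1 : 1 <= mm * cR by exact: mg1.
(* The only products of three sizes; the choice of order produces the minimum T6. *)
have middle : ((if (c <= r)%N then s * t' * (t * 2) + s * s' * (t' * 2)
    else t * s' * (t' * 2) + s * s' * (t * 2))%N)%:R
    <= 2 * C ^+ 3 * (T1 + T2 + T3 + T4 + T5 + T6).
  case: ifP => cr.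
    have crR : cR <= rR by rewrite ler_nat.
    have h6 : cR ^+ 3 * rR ^+ 2 * x = T6.
      rewrite /T6 minC min_l //.
      have -> : cR ^+ 2 * rR ^+ 3 * x = cR ^+ 2 * rR ^+ 2 * x * rR by ring.
      have -> : cR ^+ 3 * rR ^+ 2 * x = cR ^+ 2 * rR ^+ 2 * x * cR by ring.
      by rewrite ler_wpM2l // !nn0 ?pw.
    have h1 := ler_pM (nn0 _ _ s0 t0) t'0 st ht'.
    have h2 := ler_pM (nn0 _ _ s0 s'0) t'0 ss ht'.
    rewrite !(natrD, natrM).
    have E1 : C ^+ 2 * (cR ^+ 2 * x ^+ 2 + cR ^+ 3 * x) * (C * (rR * x + rR ^+ 2))
      = C ^+ 3 * (T1 + T3 + T4 + cR ^+ 3 * rR ^+ 2 * x) by rewrite /T1 /T3 /T4; ring.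
    have E2 : C ^+ 2 * (cR * rR * x ^+ 2) * (C * (rR * x + rR ^+ 2))
      = C ^+ 3 * (T2 + T5) by rewrite /T2 /T5; ring.
    rewrite E1 h6 in h1; rewrite E2 in h2; clear -h1 h2; lra.
  have crR : rR <= cR by rewrite ler_nat; move/negbT: cr; rewrite -ltnNge => /ltnW.
  have h6 : cR ^+ 2 * rR ^+ 3 * x = T6.
    rewrite /T6 min_l //.
    have -> : cR ^+ 2 * rR ^+ 3 * x = cR ^+ 2 * rR ^+ 2 * x * rR by ring.
    have -> : cR ^+ 3 * rR ^+ 2 * x = cR ^+ 2 * rR ^+ 2 * x * cR by ring.
    by rewrite ler_wpM2l // !nn0 ?pw.
  have h1 := ler_pM (nn0 _ _ s'0 t'0) t0 st' ht.
  have h2 := ler_pM (nn0 _ _ s0 s'0) t0 ss ht.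
  rewrite !(natrD, natrM).
  have E1 : C ^+ 2 * (rR ^+ 2 * x ^+ 2 + rR ^+ 3 * x) * (C * (cR * x + cR ^+ 2))
    = C ^+ 3 * (T2 + T3 + T5 + cR ^+ 2 * rR ^+ 3 * x) by rewrite /T2 /T3 /T5; ring.
  have E2 : C ^+ 2 * (cR * rR * x ^+ 2) * (C * (cR * x + cR ^+ 2))
    = C ^+ 3 * (T1 + T4) by rewrite /T1 /T4; ring.
  rewrite E1 h6 in h1; rewrite E2 in h2; clear -h1 h2; lra.
rewrite /xhat_cost; move: (if _ then _ else _)%N middle => mid hmid.
have up3 (b : R) : 0 <= b -> b <= C ^+ 3 * b by move=> b0; rewrite ler_peMl.
have Q0 := up3 _ z0; have Q1 : mm * cR <= C ^+ 3 * (mm * cR) by apply: up3; apply: nn0 => //; exact: (le_trans ler01 mR).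
have Q2 : nn * rR <= C ^+ 3 * (nn * rR) by apply: up3; apply: nn0 => //; exact: (le_trans ler01 nR).
have Q4 := up3 _ P4; have Q5 := up3 _ P5.
have W1 := nn0 _ _ C30 P1; have W2 := nn0 _ _ C30 P2; have W3 := nn0 _ _ C30 P3.
have W4 := nn0 _ _ C30 P4; have W5 := nn0 _ _ C30 P5; have W6 := nn0 _ _ C30 P6.
have W7 := nn0 _ _ C30 P7; have W8 := nn0 _ _ C30 P8.
rewrite !(natrD, natrM) -/cR -/rR -/mm -/nn.
clearbody T1 T2 T3 T4 T5 T6 T7 T8.
lra.
Qed.

(** * Outputs of computation trees are measurable *)

Lemma measurable_inv (R : realType) : measurable_fun setT (fun x : R => x^-1).
Proof.
rewrite -(setvU [set 0 : R]); apply/measurable_funU => //.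
  exact: measurableC.
split; last exact: measurable_fun_set1.
apply: open_continuous_measurable_fun; first exact/closed_openC/closed_eq.
by move=> x; rewrite inE /= => /eqP x0; exact: inv_continuous.
Qed.

Section run_measurable.
Context (R : realType) (d : measure_display) (T : measurableType d).
Context (Q D : Type) (answer : D -> Type) (c r : nat).
Variables (fetch : T -> Q -> R) (inspect : T -> forall q : D, answer q).
Hypothesis mfetch : forall q, measurable_fun setT (fetch ^~ q).
Hypothesis minspect : forall q (E : answer q -> set T),
  (forall a, measurable (E a)) -> measurable [set w | E (inspect w q) w].

Let mregs n (regs : T -> seq R) := (forall w, size (regs w) = n) /\
  forall i, measurable_fun setT (fun w => nth 0 (regs w) i).

Let mregs_rcons n regs x : mregs n regs -> measurable_fun setT x ->
  mregs n.+1 (fun w => rcons (regs w) (x w)).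
Proof.
move=> [sz mr] mx; split=> [w|i]; first by rewrite size_rcons sz.
under eq_fun do rewrite nth_rcons sz.
case: (i < n)%N; first exact: mr.
by case: (i == n) => //; exact: measurable_cst.
Qed.

Let arith_measurable o x y : measurable_fun setT x -> measurable_fun setT y ->
  measurable_fun setT (fun w : T => arith_eval o (x w) (y w) : R).
Proof.
move=> mx my; case: o => /=.
- exact: measurable_funD.
- exact: measurable_funB.
- exact: measurable_funM.
- by apply: measurable_funM => //; apply: (measurableT_comp (@measurable_inv R)).
Qed.

(** Induction on the tree.  Contents of registers are measurable functions of the
    outcome; comparisons and answers to index queries split the sample space
    into measurable pieces, on each of which a subtree is run. *)
Lemma run_measurable (p : tree Q answer c r) n (regs : T -> seq R) i j : mregs n regs ->
  measurable_fun setT (fun w => (run (fetch w) (inspect w) p (regs w)).1 i j).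
Proof.
move=> mr _ B mB; rewrite setTI; elim: p n regs mr => //=.
- move=> o n regs [_ mr]; have := mr (o i j) measurableT B mB; rewrite setTI.
  by congr measurable; apply/seteqP; split=> w /=; rewrite mxE.
- by move=> z k IH n regs mr; apply: (IH n.+1); apply: mregs_rcons.
- move=> o a b k IH n regs mr; apply: (IH n.+1); apply: mregs_rcons => //.
  by apply: arith_measurable; exact: mr.2.
- move=> a b k1 IH1 k2 IH2 n regs mr.
  pose le := [set w | nth 0 (regs w) a <= nth 0 (regs w) b].
  have mle : measurable le.
    by rewrite -[X in measurable X]setTI; apply: measurable_fun_ler => //; exact: mr.2.
  rewrite (_ : _ @^-1` B =
    (le `&` ((fun w => (run (fetch w) (inspect w) k1 (regs w)).1 i j) @^-1` B)) `|`
    (~` le `&` ((fun w => (run (fetch w) (inspect w) k2 (regs w)).1 i j) @^-1` B))).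
    apply: measurableU; apply: measurableI => //; first exact: IH1 mr.
      exact: measurableC.
    exact: IH2 mr.
  apply/seteqP; split=> w; rewrite /le /=; case: ifP => h.
  + by left.
  + by right; split => //; apply/negP.
  + by case=> -[].
  + by case=> -[]; rewrite ?h.
- by move=> q k IH n regs mr; apply: (IH n.+1); apply: mregs_rcons.
- move=> q k IH n regs mr.
  apply: (@minspect q (fun a => (fun w => (run (fetch w) (inspect w) (k a) (regs w)).1 i j) @^-1` B)).
  by move=> a; exact: IH mr.
Qed.

End run_measurable.

(** The pseudoinverse is discontinuous, but the algorithm computes Xhat with
    finitely many arithmetic operations and comparisons. *)
Lemma Xhat_measurable (R : realType) (d : measure_display) (T : measurableType d)
    (P : probability T R) (m n c r s t s' t' : nat)
    (A : 'M[R]_(m, n)) (M : 'M[R]_(m, c)) (N : 'M[R]_(r, n))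
    (DM : T -> sketch R s t m) (DN : T -> sketch R s' t' n) i j :
  sketch_laws P DM -> sketch_laws P DN ->
  measurable_fun setT (fun w => Xhat A M N (sketch_mx (DM w)) (sketch_mx (DN w)) i j).
Proof.
move=> lawsM lawsN; pose nz := enum (support_mx A).
have nzA : perm_eq nz (enum (support_mx A)) by [].
under eq_fun do rewrite -(execute_xhat M N (DM _) (DN _) nzA).1.
apply: (@run_measurable _ _ _ _ _ _ _ _ _ _ _ _ _ 0%N) => //.
- case=> [k|i' j'|i' j'|j'|j'|i' k|i' k] /=; try exact: measurable_cst.
  + exact: col_sign_measurable lawsM j'.
  + exact: col_sign_measurable lawsN j'.
  + exact: gauss_measurable lawsM (i', k).
  + exact: gauss_measurable lawsN (i', k).
- case=> [k|j'|j'] E mE /=.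
  + exact: mE.
  + rewrite (_ : [set w | _] = \bigcup_a ([set w | sk_row (DM w) j' = a] `&` E a)).
      apply: fin_bigcup_measurable => // a _; apply: measurableI => //.
      exact: row_measurable lawsM j' a.
    apply/seteqP; split=> w /=; first by exists (sk_row (DM w) j').
    by case=> a _ [<-].
  + rewrite (_ : [set w | _] = \bigcup_a ([set w | sk_row (DN w) j' = a] `&` E a)).
      apply: fin_bigcup_measurable => // a _; apply: measurableI => //.
      exact: row_measurable lawsN j' a.
    apply/seteqP; split=> w /=; first by exists (sk_row (DN w) j').
    by case=> a _ [<-].
Qed.

(** * Success event, sketch sizes and operation count together *)

Lemma frobenius_le_sqr (R : realType) (m n : nat) (B : 'M[R]_(m, n)) (x : R) : 0 <= x ->
  (frobenius B <= x) = (frob2 B <= x ^+ 2).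
Proof.
move=> x0; rewrite -[in RHS](sqr_sqrtr (frob2_ge0 B)) -/(frobenius B).
by rewrite ler_pXn2r // nnegrE sqrtr_ge0.
Qed.

Theorem theorem6 (R : realType) (delta : R) (hdelta : 0 < delta < 1) :
  exists C K : R, 0 < C /\ 0 < K /\
  forall (eps : R) (c r : nat), 0 < eps < 1 -> (0 < c)%N -> (0 < r)%N ->
  exists t sc t' sr : nat,
    [/\ (0 < t)%N, (0 < sc)%N, (0 < t')%N & (0 < sr)%N] /\
    [/\ t%:R <= C * (c%:R / eps + c%:R ^+ 2),
        sc%:R <= C * (c%:R / eps),
        t'%:R <= C * (r%:R / eps + r%:R ^+ 2) &
        sr%:R <= C * (r%:R / eps)] /\
  forall m n : nat, (0 < m)%N -> (0 < n)%N ->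
    (forall (A : 'M[R]_(m, n)) (M : 'M[R]_(m, c)) (N : 'M[R]_(r, n)),
      let Xstar := mpinv M *m A *m mpinv N in
      (forall X : 'M[R]_(c, r),
         frobenius (A - M *m Xstar *m N) <= frobenius (A - M *m X *m N)) /\
      forall (d : measure_display) (T : measurableType d)
        (P : probability T R)
        (DM : T -> sketch R sc t m) (DN : T -> sketch R sr t' n),
        independent_sketches P DM DN ->
        let good := [set w |
          let X := Xhat A M N (sketch_mx (DM w)) (sketch_mx (DN w)) in
          frobenius (A - M *m X *m N)
            <= (1 + eps) * frobenius (A - M *m Xstar *m N)] in
        measurable good /\ ((1 - delta)%:E <= P good)%E) /\
    (exists alg : algorithm m n c r sc t sr t',
      forall (A : 'M[R]_(m, n)) (M : 'M[R]_(m, c)) (N : 'M[R]_(r, n))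
        (nz : seq ('I_m * 'I_n))
        (DM : sketch R sc t m) (DN : sketch R sr t' n),
        perm_eq nz (enum (support_mx A)) ->
        (execute alg A nz M N DM DN).1
          = Xhat A M N (sketch_mx DM) (sketch_mx DN) /\
        (execute alg A nz M N DM DN).2%:R
          <= K * cost_bound (nnz A) m n c r eps).
Proof.
have d0 : 0 < delta by case/andP: hdelta.
have [C C1 sizes] := sketch_sizes d0.
have C0 : 0 < C by apply: lt_le_trans C1; exact: ltr01.
exists C, (50 * C ^+ 3); split=> //; split.
  by rewrite mulr_gt0 ?ltr0n // exprn_gt0.
move=> eps c r e01 c0 r0; have [e0 e1] := andP e01.
have [t [s [[t0 s0 tC sC] [embM rateM]]]] := sizes eps c e01 c0.
have [t' [s' [[t0' s0' tC' sC'] [embN rateN]]]] := sizes eps r e01 r0.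
exists t, s, t', s'; split=> //; split=> // m n m0 n0; split; last first.
  exists (xhat_alg m n c r s t s' t') => A M N nz DM DN nzA.
  have [out cost] := execute_xhat M N DM DN nzA; split=> //.
  apply: (@le_trans _ _ (xhat_cost m n c r s t s' t' (nnz A))%:R); first by rewrite ler_nat.
  exact: xhat_cost_le.
move=> A M N Xstar; split=> [X|d T P DM DN indep]; first exact: regression_optimal.
have [lawsM lawsN _] := indep.
(* With e = eps / 9 the bound 1 + 9 e is 1 + eps, at most (1 + eps)^2. *)
have e9 : 0 < eps / 9 <= 1.
  rewrite divr_gt0 ?ltr0n //= ler_pdivrMr ?ltr0n // mul1r.
  by apply: le_trans (ltW e1) _; rewrite ler1n.
have [bad [mbad Pbad bad_good]] :=
  sketched_regression_success indep s0 t0 s0' t0' A M N hdelta e9 embM embN rateM rateN.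
set good := [set w | _].
have x0 : 0 <= (1 + eps) * frobenius (A - M *m Xstar *m N).
  by apply: mulr_ge0; [apply: addr_ge0 => //; exact: ltW|exact: sqrtr_ge0].
have goodE : good = [set w | frob2 (A - M *m Xhat A M N (sketch_mx (DM w)) (sketch_mx (DN w)) *m N)
    <= ((1 + eps) * frobenius (A - M *m Xstar *m N)) ^+ 2].
  by apply/seteqP; split=> w; rewrite /good /= frobenius_le_sqr.
have mgood : measurable good.
  rewrite goodE -[X in measurable X]setTI; apply: measurable_fun_ler => //.
  apply: frob2_fun_measurable => a b; under eq_fun do rewrite mxE.
  apply: measurable_funD => //; under eq_fun do rewrite mxE.
  apply: measurableT_comp => //; under eq_fun do rewrite mxE.
  apply: measurable_sum => j; apply: measurable_funM => //; under eq_fun do rewrite mxE.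
  apply: measurable_sum => l; apply: measurable_funM => //.
  exact: Xhat_measurable lawsM lawsN.
split=> //; apply: (@le_trans _ _ (P (~` bad))).
  by rewrite probability_setC // EFinB; apply: leeB.
apply: le_measure; rewrite ?inE //; first exact: measurableC.
move=> w /= nbad; rewrite goodE /=; apply: le_trans (bad_good w nbad) _.
rewrite exprMn [frobenius _ ^+ 2]sqr_sqrtr ?frob2_ge0 //.
apply: ler_wpM2r; first exact: frob2_ge0.
have -> : 9 * (eps / 9) = eps by field.
by rewrite expr2 ler_peMr //; [apply: addr_ge0 => //; exact: ltW|rewrite lerDl; exact: ltW].
Qed.
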